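(* Let $\eta>0$, let $\frac32<s\le2$ and let $u_0\in H^s(\mathbb{R})$ be a (real-valued) initial datum such that, for some $\varepsilon>0$ and some $c>0$, $|u_0(x)|\le\frac{c}{1+|x|^{2+\varepsilon}}$ and $\left|\frac{d}{dx}u_0(x)\right|\le\frac{c}{1+|x|^2}$ for all $x\in\mathbb{R}$. Let $u$ be the global solution arising from $u_0$ of $$\partial_t u+u\,\partial_x u+\partial_x^3u+\eta(\mathcal{H}\partial_x u+\mathcal{H}\partial_x^3u)=0 \ \text{ on } ]0,+\infty[\times\mathbb{R},\qquad u(0,\cdot)=u_0,$$ and let $t>0$. 1) Assume that $\int_{\mathbb{R}}u_0(y)\,dy\ne0$. Then there exist $M>0$ and a constant $c_{\eta,t}$ with $0<c_{\eta,t}<c_\eta e^{4\eta t}$, where $c_\eta>0$ is a constant depending only on $\eta$, such that for all $|x|>M$ $$\frac{c_{\eta,t}\,t}{2|x|^2}\left|\int_{\mathbb{R}}u_0(y)\,dy\right|\le|u(t,x)|.$$ 2) Assume that $\int_{\mathbb{R}}u_0(y)\,dy=0$. Then, for $0<\varepsilon\le1$, for all $x\in\mathbb{R}$ $$|u(t,x)|\le\frac{C'}{1+|x|^{2+\varepsilon}},$$ where the constant $C'=C'(\eta,\varepsilon,t,u_0,\|u\|_{H^s})>0$ does not depend on $x$.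
   Context: Conventions: $\widehat f(\xi)=\int_{\mathbb{R}}e^{-ix\xi}f(x)\,dx$, $\mathcal{F}^{-1}g(x)=\frac1{2\pi}\int_{\mathbb{R}}e^{ix\xi}g(\xi)\,d\xi$. $\mathcal{H}$ is the Hilbert transform with Fourier symbol $i\,\mathrm{sign}(\xi)$, i.e. $\mathcal{H}\varphi(x)=\mathrm{p.v.}\frac1\pi\int_{\mathbb{R}}\frac{\varphi(y)}{y-x}\,dy$. For $\eta>0$, $t>0$ the kernel is $K_\eta(t,x)=\mathcal{F}^{-1}\big(e^{i\xi^3t-\eta t(|\xi|^3-|\xi|)}\big)(x)$. The Cauchy problem is understood through its equivalent integral formulation $$u(t,x)=K_\eta(t,\cdot)*u_0(x)-\frac12\int_0^tK_\eta(t-\tau,\cdot)*\partial_x(u^2)(\tau,\cdot)(x)\,d\tau.$$ For $u_0\in H^s(\mathbb{R})$, $\frac32<s\le2$, with $|u_0(x)|\le\frac{c}{1+|x|^2}$, there is a unique $u\in\mathcal{C}([0,+\infty[,H^s(\mathbb{R}))$ satisfying this integral equation; it belongs to $\mathcal{C}(]0,+\infty[,\mathcal{C}^\infty(\mathbb{R}))$ and satisfies $|u(t,x)|\le C(t)/(1+|x|^2)$ for all $t>0$, $x\in\mathbb{R}$. This is ''the global solution arising from $u_0$''. *)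

(* Defs.v *)
From mathcomp Require Import all_boot all_order all_algebra.
From mathcomp Require Import complex.
From mathcomp Require Import all_classical all_reals all_analysis.
Set Implicit Arguments.
Unset Strict Implicit.
Unset Printing Implicit Defensive.
Import Order.TTheory GRing.Theory Num.Theory.
Import numFieldNormedType.Exports.

Local Open Scope classical_set_scope.
Local Open Scope ring_scope.
Local Open Scope complex_scope.

Section Definitions.
Context {R : realType}.
Notation mu := (@lebesgue_measure R).
Implicit Types (f : R -> R) (g h : R -> R[i]) (D : set R) (s eta t x xi : R).

Definition expi (a : R) : R[i] := cos a +i* sin a.

Definition L2norm h : \bar R :=
  'N[mu]_2%:E[EFin \o (@ComplexField.Normc.normc R \o h)]%E.

Definition cintegral D h : R[i] :=
  (\int[mu]_(y in D) complex.Re (h y)) +i* (\int[mu]_(y in D) complex.Im (h y)).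

Definition inv_fourier g x : R[i] :=
  ((2 * pi)^-1)%:C * cintegral setT (fun xi => expi (x * xi) * g xi).

Definition K_symbol eta t xi : R[i] :=
  (expR (- (eta * t * (`|xi| ^+ 3 - `|xi|))))%:C * expi (xi ^+ 3 * t).

(* K_symbol (- xi) is the conjugate of K_symbol xi, so for t > 0 the
   inverse Fourier transform is real and taking its real part loses nothing. *)
Definition K eta t x : R :=
  complex.Re (inv_fourier (K_symbol eta t) x).

Definition convolution (f1 f2 : R -> R) x : R :=
  \int[mu]_y (f1 (x - y) * f2 y).

Definition truncated_fourier (n : nat) f xi : R[i] :=
  cintegral `[- n%:R, n%:R] (fun x => expi (- (x * xi)) * (f x)%:C).

(* g represents the Fourier(-Plancherel) transform of f in L^2. *)
Definition is_fourier f g : Prop :=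
  [/\ @complex.Re R \o g \in Lfun mu 2%:E,
      @complex.Im R \o g \in Lfun mu 2%:E &
      L2norm (truncated_fourier n f \- g) @[n --> \oo] --> (0 : \bar R)%E].

(* By Plancherel's theorem is_fourier f has a solution, unique up to a.e.
   equality, for every f in L^2; the default value is then never used. *)
Definition fourier f : R -> R[i] := xget (cst 0) [set g | is_fourier f g].

Definition Hs_norm s f : \bar R :=
  L2norm (fun xi => ((1 + xi ^+ 2) `^ (s / 2))%:C * fourier f xi).

Definition Hs s f : Prop :=
  f \in Lfun mu 2%:E /\ (Hs_norm s f < +oo)%E.

Definition continuous_path_Hs s (u : R -> R -> R) : Prop :=
  forall t, 0 <= t -> Hs s (u t) /\
    Hs_norm s (u r \- u t) @[r --> within `[0, +oo[ (nbhs t)] --> (0 : \bar R)%E.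

(* Integral (Duhamel) formulation of
     u_t + u u_x + u_xxx + eta (H u_x + H u_xxx) = 0,  u(0) = u0.
   Since s > 1/2 in all uses, each element u(t) of H^s is identified with its
   continuous representative, which makes the pointwise values of u meaningful;
   as K eta 0 is the Dirac mass, the equation at t = 0 is u(0) = u0. *)
Definition global_solution eta s (u0 : R -> R) (u : R -> R -> R) : Prop :=
  [/\ continuous_path_Hs s u,
      forall t, 0 <= t -> continuous (u t),
      u 0 = u0 &
      forall t x, 0 < t ->
        u t x = convolution (K eta t) u0 x
          - 2^-1 * \int[mu]_(tau in `]0, t[)
              convolution (K eta (t - tau))
                (derive1 (fun y => u tau y ^+ 2)) x].

End Definitions.

(* Main.v *)
Require Import Defs.
From mathcomp Require Import all_boot all_order all_algebra.
From mathcomp Require Import complex.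
From mathcomp Require Import all_classical all_reals all_analysis.
From mathcomp Require Import measurable_realfun ring lra.
Set Implicit Arguments.
Unset Strict Implicit.
Unset Printing Implicit Defensive.
Import Order.TTheory GRing.Theory Num.Theory.
Import numFieldNormedType.Exports.

Local Open Scope classical_set_scope.
Local Open Scope ring_scope.

(** The symbol of K eta t behaves like 1 + eta t |xi| near zero frequency, is
smooth elsewhere and decays rapidly. Its only singularity is thus the corner
at zero, and integrating by parts on each half-line gives
K eta t x = - eta t / (pi x^2) + O(|x|^-3): see [K_asymp]. After the rescaling
z = t^(1/3) xi the same integrations by parts yield estimates that are uniform
for small times: with r = t^(1/3), the kernel is at most a multiple of the
Poisson kernel r / (r^2 + x^2), and its derivative is at most a multiple of
r^-2 / (1 + |x|^3): see [K_bound] and [G_bound].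

In the integral equation the derivative can be moved to the kernel, so that
u(t) = K_t * u0 - 1/2 \int_0^t (K_(t - tau))' * u(tau)^2 dtau. The first term
equals - eta t / (pi x^2) \int u0 up to O(|x|^(-2 - min(eps, 1))), by
[linear_asymptotics]. The second one is O(|x|^-3) as soon as
|u(tau, x)| <= N / (1 + x^2) uniformly on [0, t], because then the square decays
like x^-4, the derivative of the kernel decays like |x|^-3, and
(t - tau)^(-2/3) is integrable. Both claims follow from the resulting
expansion [solution_asymptotics], with c_eta = eta and c_eta_t = eta / pi: if
the mean of u0 does not vanish the main term dominates for large |x|, and
otherwise only the error is left.

The decay of u on [0, t] comes from an a priori estimate, [decay_step]. If |u|
is at most B e^(lam tau) (1 / (1 + x^2) + delta), then estimating one factor of
u^2 in this way and the other one by a uniform bound, the integral equation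
gives the same inequality with B replaced by C + B / 2, for lam large enough
and C independent of delta. Starting from the uniform bound of u, iterating and
letting delta tend to zero, the decay follows.

Two facts on u(tau) enter: a bound that is uniform for tau in [0, t], and a
square that is continuously differentiable with bounded derivative. Both are
cases of the Sobolev embedding for s > 3/2, [sobolev]. Since the Sobolev norm
refers to the Fourier-Plancherel transform, this rests on the existence of that
transform ([fourier_exists], from Plancherel's inequality and completeness) and
on Fourier inversion ([inversion]); both are obtained by damping frequencies
with exp(- delta |xi|), which turns inversion integrals into convolutions with
Poisson kernels. *)

(** * Integration on the real line *)

Section toolbox.
Context {R : realType}.
Notation mu := (@lebesgue_measure R).
Implicit Types (f g : R -> R) (D : set R) (r x y : R).

Lemma integrable_dom D f g : measurable D -> measurable_fun D f ->
  (forall x, D x -> `|f x| <= g x) -> mu.-integrable D (EFin \o g) ->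
  mu.-integrable D (EFin \o f).
Proof.
move=> mD mf fg; apply: le_integrable => //; first exact/measurable_EFinP.
by move=> x Dx /=; rewrite lee_fin (le_trans (fg _ Dx))// ler_norm.
Qed.

(** The integral of a nonnegative function is the supremum of the integrals of
the simple functions below it, so it is monotone on arbitrary functions,
measurable or not. *)
Lemma nnintegral_le (h1 h2 : R -> \bar R) : (forall x, (0 <= h1 x)%E) ->
  (forall x, (h1 x <= h2 x)%E) ->
  (\int[mu]_x h1 x <= \int[mu]_x h2 x)%E.
Proof.
move=> h10 h12.
have h20 x : (0 <= h2 x)%E by exact: le_trans (h12 x).
rewrite ge0_integralTE// ge0_integralTE//.
apply: le_ereal_sup => _ [h hh <-]; exists h => // x.
by apply: le_trans (h12 x); exact: hh.
Qed.

Lemma ge0_le_integral_nomeas D (h1 h2 : R -> \bar R) :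
  (forall x, D x -> (0 <= h1 x)%E) ->
  (forall x, D x -> (h1 x <= h2 x)%E) ->
  (\int[mu]_(x in D) h1 x <= \int[mu]_(x in D) h2 x)%E.
Proof.
move=> h10 h12; rewrite integral_mkcond [leRHS]integral_mkcond.
apply: nnintegral_le => x; rewrite /patch; case: ifPn => // /set_mem Dx.
  exact: h10.
exact: h12.
Qed.

(** The Duhamel integral is only ever estimated through this bound: the
integrand in time is a spatial convolution whose dependence on time is not
known to be measurable, but monotonicity of the positive and negative parts is
enough. *)
Lemma normr_Rintegral_dom D f g : measurable D ->
  (forall x, D x -> `|f x| <= g x) -> mu.-integrable D (EFin \o g) ->
  `|\int[mu]_(x in D) f x| <= \int[mu]_(x in D) g x.
Proof.
move=> mD fg ig; rewrite /Rintegral.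
have gfin : (\int[mu]_(x in D) (g x)%:E)%E \is a fin_num by exact: integrable_fin_num.
rewrite integralE.
set a := (X in (X - _)%E); set b := (X in (_ - X)%E).
have a0 : (0 <= a)%E by apply: integral_ge0 => x _; exact: funepos_ge0.
have b0 : (0 <= b)%E by apply: integral_ge0 => x _; exact: funeneg_ge0.
have ag : (a <= \int[mu]_(x in D) (g x)%:E)%E.
  apply: ge0_le_integral_nomeas => x Dx; first exact: funepos_ge0.
  rewrite funeposE ge_max lee_fin (le_trans (ler_norm _) (fg _ Dx))/=.
  by rewrite lee_fin (le_trans _ (fg _ Dx)).
have bg : (b <= \int[mu]_(x in D) (g x)%:E)%E.
  apply: ge0_le_integral_nomeas => x Dx; first exact: funeneg_ge0.
  rewrite funenegE ge_max lee_fin (le_trans _ (fg _ Dx))/=; last first.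
    by rewrite -normrN ler_norm.
  by rewrite lee_fin (le_trans _ (fg _ Dx)).
have afin : a \is a fin_num by rewrite ge0_fin_numE// (le_lt_trans ag)// ltey_eq gfin.
have bfin : b \is a fin_num by rewrite ge0_fin_numE// (le_lt_trans bg)// ltey_eq gfin.
rewrite fineB//.
move: a0 b0 ag bg; rewrite -(fineK afin) -(fineK bfin) -(fineK gfin) !lee_fin /=.
by move=> ? ? ? ?; rewrite ler_norml; apply/andP; split; lra.
Qed.

Lemma cvg_Rintegral_trunc D f : measurable D -> mu.-integrable D (EFin \o f) ->
  \int[mu]_(x in D `&` `[- n%:R, n%:R]) f x @[n --> \oo] -->
  \int[mu]_(x in D) f x.
Proof.
move=> mD fi.
have mf := measurable_int _ fi.
apply: fine_cvg; rewrite fineK; last exact: integrable_fin_num.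
under eq_fun => n do rewrite integral_mkcondr.
apply: (@dominated_cvg _ _ _ mu _ mD
  (fun n => (EFin \o f) \_ `[- n%:R, n%:R]) (EFin \o f) (abse \o (EFin \o f))) => //.
- move=> n; apply/measurable_restrict => //.
  by apply: measurable_funS mf => //; apply: subIsetl.
- move=> x Dx.
  apply: cvg_near_cst; near=> n; rewrite /patch ifT// inE/= in_itv/=.
  have : `|x| <= n%:R by near: n; exact: nbhs_infty_ger.
  by rewrite ler_norml.
- exact: integrable_abse.
- move=> n x Dx; rewrite /patch; case: ifP => //= _.
  by rewrite normr0 lee_fin.
Unshelve. all: by end_near. Qed.

Lemma FTC_segment (F f : R -> R) a b : a <= b ->
  (forall x : R, is_derive x 1 F (f x)) -> continuous f ->
  \int[mu]_(x in `[a, b]) f x = F b - F a.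
Proof.
rewrite le_eqVlt => /orP[/eqP->|ab] dF cf.
  by rewrite set_itv1 Rintegral_set1 subrr.
have cF : continuous F.
  by move=> x; apply/differentiable_continuous/derivable1_diffP.
rewrite /Rintegral (@continuous_FTC2 _ f F)//.
- exact: continuous_subspaceT.
- split; first by move=> x _.
    by apply: cvg_at_right_filter; exact: cF.
  by apply: cvg_at_left_filter; exact: cF.
- by move=> x _; rewrite derive1E derive_val.
Qed.

Lemma FTC_halfline (F f : R -> R) :
  (forall x : R, is_derive x 1 F (f x)) -> continuous f ->
  mu.-integrable `[0, +oo[ (EFin \o f) -> F n%:R @[n --> \oo] --> (0 : R) ->
  \int[mu]_(x in `[0, +oo[) f x = - F 0.
Proof.
move=> dF cf fi F0.
have := cvg_Rintegral_trunc (measurable_itv _) fi.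
under eq_fun => n.
  rewrite (_ : _ `&` _ = `[0, n%:R]%classic); last first.
    apply/seteqP; split => x /=; rewrite !in_itv/=.
      by rewrite andbT => -[-> /andP[_ ->]].
    move=> /andP[h0 ->]; rewrite h0 !andbT; split => //.
    by rewrite (le_trans _ h0)// oppr_le0.
  rewrite (FTC_segment _ dF)//.
  over.
move=> /cvg_lim <- //; apply/cvg_lim => //.
by rewrite -[X in _ --> X]add0r; apply: cvgB => //; exact: cvg_cst.
Qed.

Lemma FTC_line (F f : R -> R) :
  (forall x : R, is_derive x 1 F (f x)) -> continuous f ->
  mu.-integrable setT (EFin \o f) -> F n%:R @[n --> \oo] --> (0 : R) ->
  F (- n%:R) @[n --> \oo] --> (0 : R) ->
  \int[mu]_x f x = 0.
Proof.
move=> dF cf fi F0 FN0.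
have := cvg_Rintegral_trunc measurableT fi.
under eq_fun => n.
  rewrite setTI (FTC_segment _ dF)//; last by rewrite (@le_trans _ _ 0)// oppr_le0.
  over.
move=> /cvg_lim <- //; apply/cvg_lim => //.
by rewrite -[X in _ --> X](subrr 0); exact: cvgB.
Qed.

Lemma ge0_integral_line (F f : R -> R) (a b : R) :
  (forall x : R, is_derive x 1 F (f x)) -> continuous f -> (forall x, 0 <= f x) ->
  F n%:R @[n --> \oo] --> b ->
  F (- n%:R) @[n --> \oo] --> a ->
  (\int[mu]_x (f x)%:E)%E = (b - a)%:E.
Proof.
move=> dF cf f0 Fb Fa.
have mf : measurable_fun setT f by exact: continuous_measurable_fun.
pose fn n := (EFin \o f) \_ `[- n%:R, n%:R].
have mfn n : measurable_fun setT (fn n).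
  by apply/(measurable_restrictT (EFin \o f)) => //; apply/measurable_EFinP; exact: measurable_funTS.
have fn0 n x : setT x -> (0 <= fn n x)%E.
  by rewrite /fn /patch; case: ifP => // _ _ /=; rewrite lee_fin.
have ndfn x : setT x -> {homo fn ^~ x : m n / (m <= n)%N >-> (m <= n)%E}.
  move=> _ m n mn; rewrite /fn /patch.
  case: ifPn => [/set_mem/= /[!in_itv]/= /andP[h1 h2]|_]; last first.
    by case: ifP => //=; rewrite lee_fin.
  have mn' : (m%:R : R) <= n%:R by rewrite ler_nat.
  rewrite ifT// inE/= in_itv/=; apply/andP; split; last exact: le_trans mn'.
  by apply: le_trans h1; rewrite lerN2.
have := @cvg_monotone_convergence _ _ _ mu _ measurableT _ mfn fn0 ndfn.
rewrite (_ : (fun x => _) = EFin \o f); last first.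
  apply/funext => x; apply/cvg_lim => //.
  apply: cvg_near_cst; near=> n; rewrite /fn /patch ifT// inE/= in_itv/=.
  have : `|x| <= n%:R by near: n; exact: nbhs_infty_ger.
  by rewrite ler_norml.
move=> /cvg_lim <- //; apply/cvg_lim => //.
rewrite (_ : (fun n => _) = fun n => (F n%:R - F (- n%:R))%:E).
  apply: cvg_EFin; first by near=> n.
  exact: cvgB.
apply/funext => n.
rewrite /fn -integral_mkcond -(FTC_segment _ dF)//; last first.
  by rewrite (@le_trans _ _ 0)// oppr_le0.
rewrite /Rintegral fineK//.
apply: integrable_fin_num => //.
apply: continuous_compact_integrable; first exact: segment_compact.
exact: continuous_subspaceT.
Unshelve. all: by end_near. Qed.

Lemma ge0_integral_halfline (F f : R -> R) (b : R) :
  (forall x : R, is_derive x 1 F (f x)) -> continuous f -> (forall x, 0 <= x -> 0 <= f x) ->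
  F x @[x --> +oo] --> b ->
  (\int[mu]_(x in `[0%R, +oo[) (f x)%:E)%E = (b - F 0)%:E.
Proof.
move=> dF cf f0 Fb.
have cF : continuous F.
  by move=> x; apply/differentiable_continuous/derivable1_diffP.
rewrite (ge0_continuous_FTC2y _ _ Fb)//.
- exact: continuous_subspaceT.
- by apply: cvg_at_right_filter; exact: cF.
- by move=> x _; rewrite derive1E derive_val.
Qed.

Lemma even_halfline_alg (a b c d : R) :
  a = 2 * b -> a - c = 2 * (b - d) -> c = 2 * d.
Proof. by move=> -> ?; lra. Qed.

(** Writing f as g minus the nonnegative even function g - f reduces the claim
to nonnegative functions. *)
Lemma even_halfline f g : continuous f -> continuous g ->
  f =1 f \o -%R -> g =1 g \o -%R -> (forall x, `|f x| <= g x) ->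
  mu.-integrable `[0, +oo[ (EFin \o g) ->
  mu.-integrable setT (EFin \o f) /\
  \int[mu]_x f x = 2 * \int[mu]_(x in `[0, +oo[) f x.
Proof.
move=> cf cg ef eg fg gi.
have half0 : [set x : R | 0 <= x] = `[0, +oo[%classic by rewrite set_itvcy.
have mh : measurable (`[0, +oo[ : set R) by [].
have fi : mu.-integrable `[0, +oo[ (EFin \o f).
  apply: integrable_dom gi => //.
  by apply: measurable_funTS; exact: continuous_measurable_fun.
have evi (h : R -> R) : continuous h -> (forall x, 0 <= h x) -> h =1 h \o -%R ->
    mu.-integrable `[0, +oo[ (EFin \o h) ->
    mu.-integrable setT (EFin \o h) /\
    \int[mu]_x h x = 2 * \int[mu]_(x in `[0, +oo[) h x.
  move=> ch h0 eh hi.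
  have E := ge0_symfun_integralT h0 ch eh.
  rewrite half0 in E; split; last first.
    by rewrite /Rintegral E fineM//; exact: integrable_fin_num.
  apply/integrableP; split.
    by apply/measurable_EFinP; exact: continuous_measurable_fun.
  under eq_integral => x _ do rewrite /= ger0_norm//.
  rewrite E ltey_eq fin_numM//.
  exact: integrable_fin_num.
have g0 x : 0 <= g x by exact: le_trans (fg x).
have gf0 x : 0 <= g x - f x by rewrite subr_ge0 (le_trans (ler_norm _)).
have gfi : mu.-integrable `[0, +oo[ (EFin \o (g \- f)).
  by rewrite (_ : _ \o _ = (EFin \o g) \- (EFin \o f))%E//; exact: integrableB.
have [Gi GE] := evi g cg g0 eg gi.
have cgf : continuous (g \- f) by move=> x; apply: cvgB; [exact: cg|exact: cf].
have egf : g \- f =1 (g \- f) \o -%R by move=> x /=; rewrite eg ef.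
have [Di DE] := evi _ cgf gf0 egf gfi.
have fT : mu.-integrable setT (EFin \o f).
  apply: integrable_dom Gi => //; exact: continuous_measurable_fun.
split => //; apply: (even_halfline_alg GE); move: DE; rewrite /= !RintegralB//.
Qed.

Lemma is_derive_atan_scale (a b x : R) :
  is_derive x 1 (fun x => atan (a * x + b)) (a / (1 + (a * x + b) ^+ 2)).
Proof.
apply: is_derive_eq; rewrite !(scaler0, scaler1, addr0, add0r)/GRing.scale/= ?mulr1.
by rewrite mulrC.
Qed.

Lemma cvgNn_atan (a b : R) : 0 < a ->
  atan (a * n%:R + b) @[n --> \oo] --> pi / 2 /\
  atan (a * - n%:R + b) @[n --> \oo] --> - (pi / 2 : R).
Proof.
move=> a0.
have h c : a * n%:R + c @[n --> \oo] --> +oo.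
  apply/cvgryPge => M; near=> n.
  rewrite -lerBlDr mulrC -ler_pdivrMr//; near: n; exact: nbhs_infty_ger.
split.
  by apply: (cvg_comp _ _ (h b)); exact: cvgy_atan.
under eq_fun => n do rewrite -[_ + b]opprK atanN opprD mulrN opprK.
by apply: cvgN; apply: (cvg_comp _ _ (h (- b))); exact: cvgy_atan.
Unshelve. all: by end_near. Qed.

(** Up to the factor 1/pi, the Poisson kernel of the half-plane at height r,
and also the Fourier transform of a two-sided exponential; it serves as
profile of the kernel K, as transform of the damping factor and as approximate
identity. *)
Definition poisson (r x : R) : R := r / (r ^+ 2 + x ^+ 2).

Lemma poisson_den_gt0 r x : 0 < r -> 0 < r ^+ 2 + x ^+ 2.
Proof. by move=> r0; rewrite ltr_pwDl ?exprn_gt0 ?sqr_ge0. Qed.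

Lemma poisson_ge0 r x : 0 < r -> 0 <= poisson r x.
Proof. by move=> r0; rewrite divr_ge0 ?ltW// poisson_den_gt0. Qed.

Lemma continuous_poisson r : 0 < r -> continuous (poisson r).
Proof.
move=> r0 x; apply: cvgM; first exact: cvg_cst.
apply: cvgV; first by rewrite gt_eqF// poisson_den_gt0.
apply: cvgD; first exact: cvg_cst.
exact: exprn_continuous.
Qed.

Lemma integral_poisson r x : 0 < r ->
  (\int[mu]_y (poisson r (x - y))%:E = pi%:E)%E.
Proof.
move=> r0.
have rV0 : 0 < r^-1 by rewrite invr_gt0.
have [h1 h2] := cvgNn_atan (- x / r) rV0.
have dA (y : R) : is_derive y 1 (fun y => atan (r^-1 * y - x / r)) (poisson r (x - y)).
  rewrite (_ : poisson _ _ = r^-1 / (1 + (r^-1 * y - x / r) ^+ 2)).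
    by have := is_derive_atan_scale r^-1 (- x / r) y; rewrite mulNr.
  rewrite /poisson; have rN0 : r != 0 by rewrite gt_eqF.
  have d1 : r ^+ 2 + (x - y) ^+ 2 != 0 by rewrite gt_eqF// poisson_den_gt0.
  have d2 : r ^+ 2 + (y - x) ^+ 2 != 0 by rewrite gt_eqF// poisson_den_gt0.
  rewrite (_ : 1 + _ = (r ^+ 2 + (y - x) ^+ 2) / r ^+ 2); last by field.
  by rewrite -opprB sqrrN; field; rewrite rN0.
have cpx : continuous (fun y => poisson r (x - y)).
  move=> y; apply: (@continuous_comp _ _ _ (fun y => x - y) (poisson r)).
    by apply: cvgB; [exact: cvg_cst|exact: cvg_id].
  exact: continuous_poisson.
rewrite (ge0_integral_line dA cpx (a := - (pi / 2)) (b := pi / 2)).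
- by congr EFin; lra.
- by move=> y; exact: poisson_ge0.
- by move: h1; rewrite mulNr.
- by move: h2; rewrite mulNr.
Qed.

Lemma integrable_poisson r x : 0 < r ->
  mu.-integrable setT (EFin \o (fun y => poisson r (x - y))).
Proof.
move=> r0; apply/integrableP; split.
  apply/measurable_EFinP; apply: continuous_measurable_fun => y.
  apply: (@continuous_comp _ _ _ (fun y => x - y) (poisson r)); last exact: continuous_poisson.
  by apply: cvgB; [exact: cvg_cst|exact: cvg_id].
under eq_integral => y _ do rewrite /= ger0_norm ?poisson_ge0//.
by rewrite integral_poisson// ltry.
Qed.

Lemma Rintegral_poisson r x : 0 < r -> \int[mu]_y poisson r (x - y) = pi.
Proof. by move=> r0; rewrite /Rintegral integral_poisson. Qed.

Lemma poissonN r x : poisson r (- x) = poisson r x.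
Proof. by rewrite /poisson sqrrN. Qed.

Lemma poisson1E x : poisson 1 x = (1 + x ^+ 2)^-1.
Proof. by rewrite /poisson expr1n div1r. Qed.

Lemma integrable_poisson_half r : 0 < r ->
  mu.-integrable `[0, +oo[ (EFin \o poisson r).
Proof.
move=> r0; apply: (@integrableS _ _ _ _ setT) => //.
rewrite (_ : poisson r = fun y => poisson r (0 - y)); first exact: integrable_poisson.
by apply/funext => y; rewrite sub0r poissonN.
Qed.

Lemma Rintegral_poisson_half r : 0 < r ->
  \int[mu]_(x in `[0, +oo[) poisson r x = pi / 2.
Proof.
move=> r0.
have pg x : `|poisson r x| <= poisson r x by rewrite ger0_norm// poisson_ge0.
have ev : poisson r =1 poisson r \o -%R by move=> x; rewrite /= poissonN.
have cp := continuous_poisson r0.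
have [_ E] := even_halfline cp cp ev ev pg (integrable_poisson_half r0).
have := Rintegral_poisson 0 r0; under eq_Rintegral do rewrite sub0r poissonN.
by rewrite E => <-; rewrite mulrC mulKf.
Qed.

Lemma L1Z f c : mu.-integrable setT (EFin \o f) ->
  mu.-integrable setT (EFin \o (fun x => c * f x)).
Proof. by move=> i; exact: (integrableZl _ c i). Qed.

Lemma L1D f g : mu.-integrable setT (EFin \o f) -> mu.-integrable setT (EFin \o g) ->
  mu.-integrable setT (EFin \o (fun x => f x + g x)).
Proof. by move=> i j; exact: (integrableD _ i j). Qed.

Lemma L1B f g : mu.-integrable setT (EFin \o f) -> mu.-integrable setT (EFin \o g) ->
  mu.-integrable setT (EFin \o (fun x => f x - g x)).
Proof. by move=> i j; exact: (integrableB _ i j). Qed.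

Lemma RintZ f c : mu.-integrable setT (EFin \o f) ->
  \int[mu]_x (c * f x) = c * \int[mu]_x f x.
Proof. by move=> i; exact: RintegralZl. Qed.

Lemma RintD f g : mu.-integrable setT (EFin \o f) -> mu.-integrable setT (EFin \o g) ->
  \int[mu]_x (f x + g x) = \int[mu]_x f x + \int[mu]_x g x.
Proof. by move=> i j; exact: RintegralD. Qed.

Lemma RintB f g : mu.-integrable setT (EFin \o f) -> mu.-integrable setT (EFin \o g) ->
  \int[mu]_x (f x - g x) = \int[mu]_x f x - \int[mu]_x g x.
Proof. by move=> i j; exact: RintegralB. Qed.

Lemma Rint_eq f g : f =1 g -> \int[mu]_x f x = \int[mu]_x g x.
Proof. by move=> fg; apply: eq_Rintegral. Qed.

Lemma Rint_le f g : mu.-integrable setT (EFin \o f) -> mu.-integrable setT (EFin \o g) ->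
  (forall x, f x <= g x) -> \int[mu]_x f x <= \int[mu]_x g x.
Proof. by move=> i j fg; apply: le_Rintegral. Qed.

Lemma L1_measurable f : mu.-integrable setT (EFin \o f) -> measurable_fun setT f.
Proof. by move=> ih; apply/measurable_EFinP; exact: measurable_int ih. Qed.

Lemma L1_dom f g : measurable_fun setT f -> (forall x, `|f x| <= g x) ->
  mu.-integrable setT (EFin \o g) -> mu.-integrable setT (EFin \o f).
Proof. by move=> mf fg; apply: integrable_dom. Qed.

Lemma L1_eq f g : f =1 g -> mu.-integrable setT (EFin \o f) -> mu.-integrable setT (EFin \o g).
Proof. by move=> fg; apply: eq_integrable => // x _ /=; rewrite fg. Qed.

Lemma mfM f g : measurable_fun setT f -> measurable_fun setT g ->
  measurable_fun setT (fun x => f x * g x).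
Proof. by move=> mf mg; exact: measurable_funM. Qed.

Lemma mfD f g : measurable_fun setT f -> measurable_fun setT g ->
  measurable_fun setT (fun x => f x + g x).
Proof. by move=> mf mg; exact: measurable_funD. Qed.

Lemma mfB f g : measurable_fun setT f -> measurable_fun setT g ->
  measurable_fun setT (fun x => f x - g x).
Proof. by move=> mf mg; exact: measurable_funB. Qed.

Lemma is_derive_integral D (f df : R -> R -> R) g : measurable D ->
  (forall x, mu.-integrable D (EFin \o f x)) ->
  (forall x y, D y -> is_derive x 1 (f ^~ y) (df x y)) ->
  mu.-integrable D (EFin \o g) -> (forall y, 0 <= g y) ->
  (forall x y, D y -> `|df x y| <= g y) ->
  forall x, is_derive x 1 (fun x => \int[mu]_(y in D) f x y) (\int[mu]_(y in D) df x y).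
Proof.
move=> mD fi dfi gi g0 dfg x.
have Ix : `]x - 1, x + 1[%classic x by rewrite /= in_itv/=; apply/andP; split; lra.
have d1 z y : `]x - 1, x + 1[%classic z -> D y -> derivable (f^~ y) z 1.
  by move=> _ Dy; have [] := dfi z y Dy.
have dE z y : D y -> partial1of2 f z y = df z y.
  by move=> Dy; rewrite partial1of2E; have [] := dfi z y Dy.
have d2 z y : `]x - 1, x + 1[%classic z -> D y -> `|partial1of2 f z y| <= g y.
  by move=> _ Dy; rewrite dE// dfg.
have fi' z : `]x - 1, x + 1[%classic z -> mu.-integrable D (EFin \o f z) by move=> _.
have H := @derivable_under_integral R _ _ mu f D mD _ _ _ Ix fi' d1 g g0 gi d2.
apply: DeriveDef; first exact: H.
rewrite -derive1E (@differentiation_under_integral R _ _ mu f D mD _ _ _ Ix fi' d1 g g0 gi d2).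
by apply: eq_Rintegral => y /set_mem Dy; rewrite dE.
Qed.

End toolbox.

(** * The kernel of the linear equation *)

Section kernel.
Context {R : realType}.
Notation mu := (@lebesgue_measure R).
Variable (eta : R).
Hypothesis eta_gt0 : 0 < eta.
Implicit Types (P Q : {poly {poly R}}) (r x y z q xi : R).

(** Amplitudes of oscillatory integrals are polynomials in z = r xi whose
coefficients are polynomials in q = r^2: keeping q symbolic makes every bound
uniform for r in a bounded interval. *)
Definition peval q P : {poly R} := map_poly (horner_eval q) P.
Definition ev q P z : R := (peval q P).[z].

Lemma evD q P Q z : ev q (P + Q) z = ev q P z + ev q Q z.
Proof. by rewrite /ev /peval rmorphD hornerD. Qed.
Lemma evN q P z : ev q (- P) z = - ev q P z.
Proof. by rewrite /ev /peval rmorphN hornerN. Qed.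
Lemma evM q P Q z : ev q (P * Q) z = ev q P z * ev q Q z.
Proof. by rewrite /ev /peval rmorphM hornerM. Qed.
Lemma ev1 q z : ev q 1 z = 1.
Proof. by rewrite /ev /peval rmorph1 hornerC. Qed.
Lemma ev0 q z : ev q 0 z = 0.
Proof. by rewrite /ev /peval rmorph0 hornerC. Qed.
Lemma evX q z : ev q 'X z = z.
Proof. by rewrite /ev /peval map_polyX hornerX. Qed.
Lemma evC q (c : {poly R}) z : ev q c%:P z = c.[q].
Proof. by rewrite /ev /peval map_polyC hornerC. Qed.
Lemma evXn q n z : ev q 'X^n z = z ^+ n.
Proof. by rewrite /ev /peval map_polyXn hornerXn. Qed.

Lemma derive_horner (p : {poly R}) z : is_derive z 1 (horner p) p^`().[z].
Proof.
apply: DeriveDef; first exact: derivable_horner.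
by rewrite -derive1E derivE.
Qed.

Lemma is_derive_ev q P z : is_derive z 1 (ev q P) (ev q P^`() z).
Proof. by rewrite /ev /peval -deriv_map; exact: derive_horner. Qed.

Lemma ev_bound P (q0 : R) : exists C n, 0 <= C /\
  forall q z, 0 <= q <= q0 -> 0 <= z -> `|ev q P z| <= C * (1 + z) ^+ n.
Proof.
have hc (c : {poly R}) : exists2 C, 0 <= C & forall q, 0 <= q <= q0 -> `|c.[q]| <= C.
  elim/poly_ind: c => [|c a [C C0 IH]].
    by exists 0 => // q _; rewrite horner0 normr0.
  exists (C * `|q0| + `|a|) => [|q /[dup] qq /andP[q1 q2]].
    by rewrite addr_ge0// mulr_ge0.
  rewrite !hornerE (le_trans (ler_normD _ _))// lerD2r normrM ler_pM//; first exact: IH.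
  by rewrite ger0_norm// (le_trans q2)// ler_norm.
elim/poly_ind: P => [|P c [C [n [C0 IH]]]].
  by exists 0, 0%N; split => // q z _ _; rewrite ev0 normr0 mul0r.
have [D D0 HD] := hc c.
exists (C + D), n.+1; split => [|q z qq z0]; first exact: addr_ge0.
rewrite evD evM evX evC (le_trans (ler_normD _ _))// mulrDl lerD//.
  rewrite normrM exprSr mulrA ler_pM//; first exact: IH.
  by rewrite ger0_norm// lerDr.
rewrite (le_trans (HD _ qq))// ler_peMr// exprn_ege1// lerDl//.
Qed.

Lemma pow_le_expR n y : 0 <= y -> y ^+ n <= n%:R ^+ n * expR y.
Proof.
move=> y0; case: n => [|n].
  by rewrite expr0 mul1r; rewrite (le_trans _ (expR_ge1Dx _))// lerDl.
have -> : expR y = expR (y / n.+1%:R) ^+ n.+1.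
  by rewrite -expRM_natr divfK.
rewrite -exprMn lerXn2r ?nnegrE ?mulr_ge0 ?expR_ge0//.
rewrite mulrC -ler_pdivrMr// (le_trans _ (expR_ge1Dx _))// lerDr//.
Qed.

(** The factor exp(- eta z^3) beats exp(eta q z) and any power of z, with a
constant that depends on q only through an upper bound. *)
Lemma envelope_bound (q0 : R) n : exists2 C, 0 <= C & forall q z, q <= q0 -> 0 <= z ->
  expR (eta * (q * z - z ^+ 3)) * (1 + z) ^+ n <= C.
Proof.
(* The summand 1 in A is what leaves a spare - z in the exponent, see key. *)
pose A := eta * `|q0| + 1; pose c1 := A * (A / eta + 1).
exists (n%:R ^+ n * expR (c1 + 1)) => [|q z qq z0].
  by rewrite mulr_ge0// ?exprn_ge0// expR_ge0.
have A0 : 0 <= A by rewrite addr_ge0// mulr_ge0// ltW.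
have key : eta * (q * z - z ^+ 3) <= c1 - z.
  suff : A * z - eta * z ^+ 3 <= c1.
    have : eta * (q * z) <= eta * (`|q0| * z).
      by rewrite ler_pM2l// ler_wpM2r// (le_trans qq)// ler_norm.
    rewrite /A mulrBr mulrDl mul1r -mulrA.
    move: (eta * (q * z)) (eta * (`|q0| * z)) (eta * z ^+ 3) c1 => a b c d.
    by clear; move=> ? ?; lra.
  have [h|h] := leP (A / eta) (z ^+ 2).
    rewrite (@le_trans _ _ 0)//; last first.
      by rewrite /c1 mulr_ge0// addr_ge0// divr_ge0// ltW.
    by rewrite exprSr mulrA -mulrBl mulr_le0_ge0// subr_le0 mulrC -ler_pdivrMr.
  rewrite (@le_trans _ _ (A * z))//.
    by rewrite lerBlDr lerDl mulr_ge0 ?exprn_ge0// ltW.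
  rewrite ler_wpM2l// (@le_trans _ _ (z ^+ 2 + 1))//; last by rewrite lerD2r ltW.
  have := sqr_ge0 (z - 1); rewrite sqrrB1 ; nra.
rewrite (le_trans (ler_wpM2r _ (_ : _ <= expR (c1 - z))))//.
- by rewrite exprn_ge0// addr_ge0.
- by rewrite ler_expR.
rewrite (le_trans (ler_wpM2l _ (pow_le_expR n (_ : 0 <= 1 + z))))//.
- exact: addr_ge0.
rewrite mulrCA -expRD (_ : _ + (1 + z) = c1 + 1)//.
by clear; move: c1 => c; lra.
Qed.

(** phase_re + i phase_im is the derivative in z of eta (q z - z^3) + i z^3,
the exponent of the symbol of the kernel for positive frequencies after the
rescaling z = r xi, t = r^3. *)
Definition phase_re : {poly {poly R}} := (eta *: 'X)%:P - (3 * eta)%:P%:P * 'X^2.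
Definition phase_im : {poly {poly R}} := 3%:P%:P * 'X^2.

Lemma ev_phase_re q z : ev q phase_re z = eta * (q - 3 * z ^+ 2).
Proof. rewrite /phase_re evD evN evM !evC evXn hornerZ hornerX !hornerC; ring. Qed.
Lemma ev_phase_im q z : ev q phase_im z = 3 * z ^+ 2.
Proof. by rewrite /phase_im evM !evC evXn !hornerC. Qed.

(** deriv_re + i deriv_im is the amplitude obtained by differentiating (P + i
Q)(q, z) exp(eta (q z - z^3) + i z^3) in z. *)
Definition deriv_re P Q := P^`() + P * phase_re - Q * phase_im.
Definition deriv_im P Q := Q^`() + Q * phase_re + P * phase_im.

(** The real part of (P + i Q)(q, z) exp(eta (q z - z^3) + i (z^3 + x xi))
with z = r xi and q = r^2. *)
Definition osc r x P Q xi : R :=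
  expR (eta * (r ^+ 2 * (r * xi) - (r * xi) ^+ 3)) *
  (ev (r ^+ 2) P (r * xi) * cos ((r * xi) ^+ 3 + x * xi)
   - ev (r ^+ 2) Q (r * xi) * sin ((r * xi) ^+ 3 + x * xi)).

Lemma is_derive_ev_scale r q P xi :
  is_derive xi 1 (fun xi => ev q P (r * xi)) (r * ev q P^`() (r * xi)).
Proof.
have := @is_derive1_comp R (ev q P) (fun xi => r * xi) xi _ r (is_derive_ev q P _).
rewrite mulrC; apply.
by apply: is_derive_eq; rewrite scaler1 ?scaler0 ?addr0 ?add0r.
Qed.

Lemma is_derive_phase r x xi : is_derive xi 1 (fun xi => (r * xi) ^+ 3 + x * xi)
  (3 * r * (r * xi) ^+ 2 + x).
Proof.
apply: is_derive_eq; rewrite /GRing.scale/= ?mulr0 ?addr0 ?mulr1.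
by rewrite ?expr2; ring.
Qed.

Lemma is_derive_cos_phase r x xi : is_derive xi 1 (fun xi => cos ((r * xi) ^+ 3 + x * xi))
  (- sin ((r * xi) ^+ 3 + x * xi) * (3 * r * (r * xi) ^+ 2 + x)).
Proof. exact: (is_derive1_comp (is_derive_cos _) (is_derive_phase r x xi)). Qed.

Lemma is_derive_sin_phase r x xi : is_derive xi 1 (fun xi => sin ((r * xi) ^+ 3 + x * xi))
  (cos ((r * xi) ^+ 3 + x * xi) * (3 * r * (r * xi) ^+ 2 + x)).
Proof. exact: (is_derive1_comp (is_derive_sin _) (is_derive_phase r x xi)). Qed.

Lemma is_derive_env r xi : is_derive xi 1
  (fun xi => expR (eta * (r ^+ 2 * (r * xi) - (r * xi) ^+ 3)))
  (expR (eta * (r ^+ 2 * (r * xi) - (r * xi) ^+ 3)) *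
    (eta * (r ^+ 2 * r - 3 * r * (r * xi) ^+ 2))).
Proof.
have h : is_derive xi 1 (fun xi => eta * (r ^+ 2 * (r * xi) - (r * xi) ^+ 3))
    (eta * (r ^+ 2 * r - 3 * r * (r * xi) ^+ 2)).
  apply: is_derive_eq; rewrite /GRing.scale/= ?mulr0 ?addr0 ?mulr1.
  by rewrite ?expr2; ring.
exact: (is_derive1_comp (is_derive_expR _) h).
Qed.

Lemma is_derive_osc r x P Q xi :
  is_derive xi 1 (osc r x P Q) (r * osc r x (deriv_re P Q) (deriv_im P Q) xi + x * osc r x (- Q) P xi).
Proof.
have := is_derive_env r xi; have := is_derive_cos_phase r x xi.
have := is_derive_sin_phase r x xi; have := is_derive_ev_scale r (r ^+ 2) P xi.
have := is_derive_ev_scale r (r ^+ 2) Q xi.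
rewrite /osc => d1 d2 d3 d4 d5.
apply: is_derive_eq; rewrite /GRing.scale/=.
rewrite /deriv_re /deriv_im !(evD, evN, evM, ev_phase_re, ev_phase_im); ring.
Qed.

Lemma continuous_osc r x P Q : continuous (osc r x P Q).
Proof.
by move=> xi; apply/differentiable_continuous/derivable1_diffP; case: (is_derive_osc r x P Q xi).
Qed.

Lemma osc_bound P Q (r0 : R) : exists2 C, 0 <= C &
  forall r x xi, 0 <= r <= r0 -> 0 <= xi ->
    `|osc r x P Q xi| <= C / (1 + (r * xi) ^+ 2).
Proof.
have [C [n [C0 hP]]] := ev_bound P (r0 ^+ 2).
have [D [m [D0 hQ]]] := ev_bound Q (r0 ^+ 2).
have [E E0 hE] := envelope_bound (r0 ^+ 2) (n + m + 2).
exists ((C + D) * E) => [|r x xi /andP[r1 r2] xi0]; first by rewrite mulr_ge0// addr_ge0.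
have rr : 0 <= r ^+ 2 <= r0 ^+ 2 by rewrite sqr_ge0 lerXn2r ?nnegrE ?(le_trans r1).
have z0 : 0 <= r * xi by exact: mulr_ge0.
rewrite /osc; set z := r * xi in z0 *; set q := r ^+ 2 in rr *.
rewrite normrM ger0_norm ?expR_ge0// ler_pdivlMr ?ltr_pwDl ?sqr_ge0//.
have h1 : `|ev q P z * cos (z ^+ 3 + x * xi) - ev q Q z * sin (z ^+ 3 + x * xi)|
    <= (C + D) * (1 + z) ^+ (n + m).
  rewrite (le_trans (ler_normB _ _))// mulrDl lerD//.
    rewrite normrM -[leRHS]mulr1 ler_pM ?cos_max ?normr_ge0//.
    rewrite (le_trans (hP _ _ rr z0))// ler_wpM2l// ler_weXn2l ?leq_addr// lerDl//.
  rewrite normrM -[leRHS]mulr1 ler_pM ?normr_ge0//.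
    rewrite (le_trans (hQ _ _ rr z0))// ler_wpM2l// ler_weXn2l ?leq_addl// lerDl//.
  by rewrite ler_norml sin_geN1 sin_le1.
have h2 : 1 + z ^+ 2 <= (1 + z) ^+ 2 by rewrite sqrrD expr1n mul1r lerD2r lerDl mulrn_wge0.
have := hE q z (andP rr).2 z0; rewrite exprD => h3.
apply: (@le_trans _ _ (expR (eta * (q * z - z ^+ 3)) *
    ((C + D) * (1 + z) ^+ (n + m)) * (1 + z) ^+ 2)).
  rewrite ler_pM ?mulr_ge0 ?expR_ge0 ?normr_ge0 ?addr_ge0 ?sqr_ge0//.
  by rewrite ler_wpM2l// expR_ge0.
rewrite [X in X <= _](_ : _ = (C + D) * (expR (eta * (q * z - z ^+ 3)) *
    ((1 + z) ^+ (n + m) * (1 + z) ^+ 2))); last by ring.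
by rewrite ler_wpM2l// addr_ge0.
Qed.

Lemma osc_env r xi : 0 < r -> (1 + (r * xi) ^+ 2)^-1 = r^-1 * poisson r^-1 xi.
Proof.
move=> r0; rewrite /poisson; have rN0 : r != 0 by rewrite gt_eqF.
have h : 1 + (r * xi) ^+ 2 != 0 by rewrite gt_eqF// ltr_pwDl ?sqr_ge0.
rewrite (_ : r^-1 ^+ 2 + _ = (1 + (r * xi) ^+ 2) / r ^+ 2); last by field.
by field; rewrite rN0.
Qed.

Lemma integrable_osc_env r C : 0 < r ->
  mu.-integrable `[0, +oo[ (EFin \o (fun xi => C / (1 + (r * xi) ^+ 2))).
Proof.
move=> r0; rewrite (_ : _ \o _ = fun x => ((C / r)%:E * (EFin \o poisson r^-1) x)%E).
  by apply: integrableZl => //; apply: integrable_poisson_half; rewrite invr_gt0.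
by apply/funext => xi /=; rewrite osc_env// mulrA EFinM.
Qed.

Lemma Rintegral_osc_env r C : 0 < r ->
  \int[mu]_(xi in `[0, +oo[) (C / (1 + (r * xi) ^+ 2)) = C / r * (pi / 2).
Proof.
move=> r0; have rV0 : 0 < r^-1 by rewrite invr_gt0.
under eq_Rintegral => xi _ do rewrite osc_env// mulrA.
by rewrite RintegralZl//= ?Rintegral_poisson_half//; exact: integrable_poisson_half.
Qed.

Lemma integrable_osc r x P Q : 0 < r -> mu.-integrable `[0, +oo[ (EFin \o osc r x P Q).
Proof.
move=> r0; have [C C0 h] := osc_bound P Q r.
apply: integrable_dom (integrable_osc_env C r0) => //.
  by apply: measurable_funTS; apply: continuous_measurable_fun; exact: continuous_osc.
by move=> xi /=; rewrite in_itv/= andbT => xi0; apply: h => //; rewrite ltW/=.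
Qed.

(** The rescaled oscillatory half-line integral; the factor r is the Jacobian
of z = r xi, which makes it bounded uniformly in r. *)
Definition J r x P Q : R := r * \int[mu]_(xi in `[0, +oo[) osc r x P Q xi.

Lemma J_bound P Q (r0 : R) : exists2 C, 0 <= C & forall r x, 0 < r <= r0 -> `|J r x P Q| <= C.
Proof.
have [C C0 h] := osc_bound P Q r0; exists (C * (pi / 2)).
  by rewrite mulr_ge0// divr_ge0// pi_ge0.
move=> r x /andP[r1 r2]; rewrite /J normrM gtr0_norm//.
rewrite mulrC -ler_pdivlMr// mulrAC -Rintegral_osc_env//.
apply: normr_Rintegral_dom => //; last exact: integrable_osc_env.
by move=> xi /=; rewrite in_itv/= andbT => xi0; apply: h => //; rewrite ltW.
Qed.

Lemma osc_cvg0 r x P Q : 0 < r -> osc r x P Q n%:R @[n --> \oo] --> (0 : R).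
Proof.
move=> r0; have [C C0 h] := osc_bound P Q r.
apply/cvgr0Pnorm_le => e e0; near=> n.
have n0 : (0 : R) < n%:R by near: n; exact: nbhs_infty_gtr.
rewrite (le_trans (h _ _ _ _ _))//; first by rewrite ltW/=.
rewrite ler_pdivrMr ?ltr_pwDl ?sqr_ge0//.
rewrite (@le_trans _ _ (e * (r ^+ 2 * n%:R)))//; last first.
  rewrite ler_pM2l// exprMn (@le_trans _ _ (r ^+ 2 * n%:R ^+ 2))//; last by rewrite lerDr.
  rewrite ler_pM2l ?exprn_gt0// ler_eXnr// ler1n.
  by rewrite -(ltr0n R).
rewrite mulrA mulrC -ler_pdivrMr ?mulr_gt0 ?exprn_gt0//.
near: n; exact: nbhs_infty_ger.
Unshelve. all: by end_near. Qed.

(** The amplitude produced by one integration by parts, i.e. the derivative of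
- i (P + i Q) times the exponential. *)
Definition ibp_re P Q := deriv_re Q (- P).
Definition ibp_im P Q := deriv_im Q (- P).

(** One integration by parts against exp(i x xi): each power of x / r costs
one derivative of the amplitude and one boundary term at zero frequency.
Iterating it gives the spatial decay of the kernel, and the first boundary
term that does not vanish gives its leading tail. *)
Lemma J_rec r x P Q : 0 < r ->
  x / r * J r x P Q = - ev (r ^+ 2) Q 0 - J r x (ibp_re P Q) (ibp_im P Q).
Proof.
move=> r0.
have d xi := is_derive_osc r x Q (- P) xi.
have i1 := integrable_osc x P Q r0; have i2 := integrable_osc x (ibp_re P Q) (ibp_im P Q) r0.
have j1 : mu.-integrable `[0, +oo[ (EFin \o (fun xi => r * osc r x (ibp_re P Q) (ibp_im P Q) xi)).
  exact: (integrableZl _ r i2).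
have j2 : mu.-integrable `[0, +oo[ (EFin \o (fun xi => x * osc r x P Q xi)).
  exact: (integrableZl _ x i1).
have E0 : osc r x Q (- P) 0 = ev (r ^+ 2) Q 0.
  by rewrite /osc !mulr0 expr0n/= addr0 subr0 mulr0 expR0 cos0 sin0 mulr0 mulr1 subr0 mul1r.
have d' xi : is_derive xi 1 (osc r x Q (- P))
    (r * osc r x (ibp_re P Q) (ibp_im P Q) xi + x * osc r x P Q xi).
  by have := d xi; rewrite opprK.
have c : continuous (fun xi => r * osc r x (ibp_re P Q) (ibp_im P Q) xi + x * osc r x P Q xi).
  by move=> xi; apply: cvgD; apply: cvgM; try exact: cvg_cst; exact: continuous_osc.
have := FTC_halfline d' c (integrableD _ j1 j2) (osc_cvg0 _ _ _ r0).
rewrite E0 RintegralD// !RintegralZl// /J => E.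
have /eqP := E (measurable_itv _); rewrite -subr_eq0 => /eqP {}E.
apply/eqP; rewrite -subr_eq0 -[X in _ == X]E; apply/eqP.
by field; rewrite gt_eqF.
Qed.

Lemma is_derive_osc_x r x P Q xi : r != 0 ->
  is_derive x 1 (fun x => osc r x P Q xi) (r^-1 * osc r x (- (Q * 'X)) (P * 'X) xi).
Proof.
move=> r0; rewrite /osc.
have h : is_derive x 1 (fun x => (r * xi) ^+ 3 + x * xi) xi.
  apply: is_derive_eq; rewrite /GRing.scale/=. by ring.
have hc := is_derive1_comp (is_derive_cos _) h.
have hs := is_derive1_comp (is_derive_sin _) h.
apply: is_derive_eq; rewrite /GRing.scale/= !(evD, evN, evM, evX).
by field.
Qed.

Lemma is_derive_J r x P Q : 0 < r ->
  is_derive x 1 (fun x => J r x P Q) (r^-1 * J r x (- (Q * 'X)) (P * 'X)).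
Proof.
move=> r0; have rN0 : r != 0 by rewrite gt_eqF.
have [C C0 h] := osc_bound (- (Q * 'X)) (P * 'X) r.
have H := @is_derive_integral R `[0, +oo[ (fun x xi => osc r x P Q xi)
  (fun x xi => r^-1 * osc r x (- (Q * 'X)) (P * 'X) xi)
  (fun xi => (r^-1 * C) / (1 + (r * xi) ^+ 2)).
have {}H : is_derive x 1 (fun x => \int[mu]_(xi in `[0, +oo[) osc r x P Q xi)
   (\int[mu]_(xi in `[0, +oo[) (r^-1 * osc r x (- (Q * 'X)) (P * 'X) xi)).
  apply: H => //.
  - by move=> z; exact: integrable_osc.
  - by move=> z xi _; exact: is_derive_osc_x.
  - exact: integrable_osc_env.
  - by move=> xi; rewrite divr_ge0 ?mulr_ge0 ?invr_ge0 ?(ltW r0)// addr_ge0// sqr_ge0.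
  - move=> z xi /=; rewrite in_itv/= andbT => xi0.
    rewrite normrM ger0_norm ?invr_ge0 ?(ltW r0)// -mulrA ler_wpM2l ?invr_ge0 ?(ltW r0)//.
    by apply: h => //; rewrite ltW/=.
rewrite RintegralZl// in H; last exact: integrable_osc.
rewrite /J; apply: is_derive_eq; rewrite /GRing.scale/= ?mul0r ?addr0; ring.
Qed.

Lemma continuous_J r P Q : 0 < r -> continuous (fun x => J r x P Q).
Proof.
by move=> r0 x; apply/differentiable_continuous/derivable1_diffP; case: (is_derive_J x P Q r0).
Qed.

(** The symbol at - xi is the conjugate of the symbol at xi, so that K is
twice the real part of an integral over positive frequencies, where the
absolute values disappear. *)
Lemma K_J r x : 0 < r -> K eta (r ^+ 3) x = (pi * r)^-1 * J r x 1 0.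
Proof.
move=> r0.
pose f xi := expR (- (eta * r ^+ 3 * (`|xi| ^+ 3 - `|xi|))) * cos (x * xi + xi ^+ 3 * r ^+ 3).
have KE : K eta (r ^+ 3) x = (2 * pi)^-1 * \int[mu]_xi f xi.
  rewrite /K /inv_fourier /= /cintegral mul0r subr0; congr (_ * _).
  apply: eq_Rintegral => xi _; rewrite /K_symbol /expi /f /= !mul0r !addr0 subr0 cosD.
  by ring.
pose env xi := expR (- (eta * r ^+ 3 * (`|xi| ^+ 3 - `|xi|))).
have fosc xi : 0 <= xi -> f xi = osc r x 1 0 xi.
  move=> xi0; rewrite /f /osc ev1 ev0 mul1r mul0r subr0 ger0_norm//; congr (expR _ * cos _); ring.
have cn : continuous (fun xi : R => `|xi|) by exact: norm_continuous.
have ce : continuous env.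
  move=> z; apply: (@continuous_comp _ _ _ (fun xi => - (eta * r ^+ 3 * (`|xi| ^+ 3 - `|xi|))) expR); last exact: continuous_expR.
  apply: cvgN; apply: cvgM; first exact: cvg_cst.
  apply: cvgB; last exact: cn.
  by apply: (@continuous_comp _ _ _ (fun xi : R => `|xi|) (fun y => y ^+ 3)); [exact: cn|exact: exprn_continuous].
have cf : continuous f.
  move=> z; apply: cvgM; first exact: ce.
  apply: (@continuous_comp _ _ _ (fun xi => x * xi + xi ^+ 3 * r ^+ 3) cos); last exact: continuous_cos.
  apply: cvgD; apply: cvgM; try exact: cvg_cst; [exact: cvg_id|exact: exprn_continuous].
have ef : f =1 f \o -%R.
  move=> z; rewrite /f /= normrN; congr (_ * _).
  by rewrite -[LHS]cosN; congr cos; rewrite mulrN exprNn; ring.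
have ee : env =1 env \o -%R by move=> z; rewrite /env/= normrN.
have fe z : `|f z| <= env z.
  by rewrite /f normrM ger0_norm ?expR_ge0// ler_piMr ?expR_ge0// cos_max.
have ie : mu.-integrable `[0, +oo[ (EFin \o env).
  have [C C0 h] := osc_bound 1 0 r.
  apply: integrable_dom (integrable_osc_env C r0) => //.
    by apply: measurable_funTS; exact: continuous_measurable_fun.
  move=> xi /=; rewrite in_itv/= andbT => xi0.
  rewrite ger0_norm ?expR_ge0//.
  rewrite (le_trans _ (h r (- r ^+ 3 * xi ^+ 2) xi _ _))//; last by rewrite ltW/=.
  rewrite /osc ev1 ev0 mul1r mul0r subr0 (_ : _ + _ * xi = 0); last by ring.
  rewrite cos0 mulr1 ger0_norm ?expR_ge0// /env ger0_norm//.
  by rewrite ler_expR le_eqVlt; apply/orP; left; apply/eqP; ring.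
have [_ E] := even_halfline cf ce ef ee fe ie.
rewrite KE E /J.
rewrite (@eq_Rintegral _ _ _ mu _ (osc r x 1 0) f); last first.
  by move=> xi; rewrite inE/= in_itv/= andbT => xi0; exact: fosc.
have pi0 : pi != 0 :> R by rewrite gt_eqF// pi_gt0.
have rN0 : r != 0 by rewrite gt_eqF.
by move: pi pi0 => p p0; field; rewrite rN0 p0.
Qed.

(** The spatial derivative of the kernel at time r^3. *)
Definition G r x : R := (pi * r ^+ 2)^-1 * J r x 0 'X.

Lemma is_derive_K r x : 0 < r -> is_derive x 1 (K eta (r ^+ 3)) (G r x).
Proof.
move=> r0.
rewrite (_ : K eta _ = fun x => (pi * r)^-1 * J r x 1 0); last first.
  by apply/funext => y; exact: K_J.
have := is_derive_J x 1 0 r0; rewrite mul0r oppr0 mul1r => H.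
apply: is_derive_eq; rewrite /GRing.scale/= ?mul0r ?addr0 /G.
have pi0 : pi != 0 :> R by rewrite gt_eqF// pi_gt0.
have rN0 : r != 0 by rewrite gt_eqF.
by move: pi pi0 => p p0; field; rewrite rN0 p0.
Qed.

Lemma continuous_K r : 0 < r -> continuous (K eta (r ^+ 3)).
Proof.
by move=> r0 x; apply/differentiable_continuous/derivable1_diffP; case: (is_derive_K x r0).
Qed.

Lemma continuous_G r : 0 < r -> continuous (G r).
Proof. by move=> r0 x; apply: cvgM; [exact: cvg_cst|exact: continuous_J]. Qed.

(** Three integrations by parts. The first boundary term is imaginary and
vanishes from the real part; the second contributes - eta r^2, which reflects
the jump at zero of the derivative of the symbol, due to the term |xi|: it is
responsible for the slow decay x^-2 of the kernel. *)
Lemma K_expansion (r0 : R) : exists2 C, 0 <= C & forall r x, 0 < r <= r0 ->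
  [/\ `|J r x 1 0| <= C, (x / r) ^+ 2 * `|J r x 1 0| <= C &
   `|x / r| * `|(x / r) ^+ 2 * J r x 1 0 + eta * r ^+ 2| <= C].
Proof.
pose P1 := ibp_re 1 0; pose Q1 := ibp_im 1 0; pose P2 := ibp_re P1 Q1; pose Q2 := ibp_im P1 Q1.
pose P3 := ibp_re P2 Q2; pose Q3 := ibp_im P2 Q2.
have [C1 C10 h1] := J_bound 1 0 r0; have [C2 C20 h2] := J_bound P2 Q2 r0.
have [C3 C30 h3] := J_bound P3 Q3 r0; have [C4 [n [C40 h4]]] := ev_bound Q2 (r0 ^+ 2).
exists (C1 + (C2 + eta * r0 ^+ 2) + (C3 + C4)) => [|r x rr].
  by rewrite !addr_ge0// mulr_ge0// ?sqr_ge0 ?ltW.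
have [r_gt0 rr0] := andP rr.
have r0_ge0 : 0 <= r0 by rewrite (le_trans _ rr0)// ltW.
have e2 : 0 <= eta * r ^+ 2 <= eta * r0 ^+ 2.
  apply/andP; split; first by rewrite mulr_ge0 ?sqr_ge0 ?ltW.
  by rewrite ler_pM2l// lerXn2r// nnegrE// ltW.
have E1 : x / r * J r x 1 0 = - J r x P1 Q1.
  by rewrite J_rec// ev0 oppr0 sub0r.
have Q10 : ev (r ^+ 2) Q1 0 = - (eta * r ^+ 2).
  rewrite /Q1 /ibp_im /deriv_im derivN (_ : 1^`() = 0); last exact: (derivC 1).
  by rewrite !(evD, evN, evM, ev_phase_re, ev_phase_im, ev0, ev1); ring.
have E2 : (x / r) ^+ 2 * J r x 1 0 = - (eta * r ^+ 2) + J r x P2 Q2.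
  by rewrite expr2 -mulrA E1 mulrN J_rec// Q10 -/P2 -/Q2; ring.
have E3 : x / r * ((x / r) ^+ 2 * J r x 1 0 + eta * r ^+ 2) = - ev (r ^+ 2) Q2 0 - J r x P3 Q3.
  by rewrite E2 addrAC addNr add0r J_rec.
have b1 := h1 r x rr; have b2 := h2 r x rr; have b3 := h3 r x rr.
have b4 : `|ev (r ^+ 2) Q2 0| <= C4.
  have := h4 (r ^+ 2) 0; rewrite addr0 expr1n mulr1; apply => //.
  by rewrite sqr_ge0 lerXn2r// nnegrE ltW.
move: e2 => /andP[e20 e2]; have eta_r0 := le_trans e20 e2; split.
- by rewrite (le_trans b1)// -addrA lerDl !addr_ge0.
- rewrite -[X in X * _]ger0_norm ?sqr_ge0// -normrM E2.
  rewrite (le_trans (ler_normD _ _))// normrN (ger0_norm e20).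
  rewrite (@le_trans _ _ (C2 + eta * r0 ^+ 2))//; first by rewrite addrC lerD.
  by rewrite -[leLHS]add0r -[leLHS]addr0 !lerD// addr_ge0.
- rewrite -normrM E3 (le_trans (ler_normB _ _))// normrN.
  rewrite (@le_trans _ _ (C3 + C4))//; first by rewrite addrC lerD.
  by rewrite lerDr !addr_ge0.
Qed.

(** The amplitude of the derivative carries a factor z, which kills the
boundary terms of the first two integrations by parts: the derivative decays
like |x|^-3. *)
Lemma G_expansion (r0 : R) : exists2 C, 0 <= C & forall r x, 0 < r <= r0 ->
  `|J r x 0 'X| <= C /\ `|x / r| ^+ 3 * `|J r x 0 'X| <= C.
Proof.
pose P1 := ibp_re 0 'X; pose Q1 := ibp_im 0 'X; pose P2 := ibp_re P1 Q1; pose Q2 := ibp_im P1 Q1.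
pose P3 := ibp_re P2 Q2; pose Q3 := ibp_im P2 Q2.
have [C1 C10 h1] := J_bound 0 'X r0.
have [C3 C30 h3] := J_bound P3 Q3 r0; have [C4 [n [C40 h4]]] := ev_bound Q2 (r0 ^+ 2).
exists (C1 + (C3 + C4)) => [|r x rr]; first by rewrite !addr_ge0.
have [r_gt0 rr0] := andP rr.
have E1 : x / r * J r x 0 'X = - J r x P1 Q1.
  by rewrite J_rec// evX oppr0 sub0r.
have Q10 : ev (r ^+ 2) Q1 0 = 0.
  rewrite /Q1 /ibp_im /deriv_im oppr0 deriv0 !(evD, evN, evM, ev_phase_re, ev_phase_im, ev0, ev1, evX).
  by ring.
have E2 : (x / r) ^+ 2 * J r x 0 'X = J r x P2 Q2.
  by rewrite expr2 -mulrA E1 mulrN J_rec// Q10 -/P2 -/Q2; ring.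
have E3 : (x / r) ^+ 3 * J r x 0 'X = - ev (r ^+ 2) Q2 0 - J r x P3 Q3.
  by rewrite exprS -mulrA E2 J_rec.
have b1 := h1 r x rr; have b3 := h3 r x rr.
have b4 : `|ev (r ^+ 2) Q2 0| <= C4.
  have := h4 (r ^+ 2) 0; rewrite addr0 expr1n mulr1; apply => //.
  by rewrite sqr_ge0 lerXn2r// nnegrE ?(ltW r_gt0)// (le_trans (ltW r_gt0)).
split; first by rewrite (le_trans b1)// lerDl addr_ge0.
rewrite -normrX -normrM E3 (le_trans (ler_normB _ _))// normrN.
rewrite (@le_trans _ _ (C3 + C4))//; first by rewrite addrC lerD.
by rewrite lerDr.
Qed.

(** At time t = r^3 the kernel is dominated by a Poisson kernel of width r,
hence bounded in L^1 uniformly for bounded times. *)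
Lemma K_bound (r0 : R) : exists2 C, 0 <= C & forall r x, 0 < r <= r0 ->
  `|K eta (r ^+ 3) x| <= C * poisson r x.
Proof.
have [C C0 h] := K_expansion r0; exists (2 * C / pi) => [|r x rr].
  by rewrite divr_ge0 ?mulr_ge0// pi_ge0.
have [r_gt0 rr0] := andP rr; have [h1 h2 _] := h r x rr.
have rN0 : r != 0 by rewrite gt_eqF.
have pi0 : pi != 0 :> R by rewrite gt_eqF// pi_gt0.
have d0 : r ^+ 2 + x ^+ 2 != 0 by rewrite gt_eqF// poisson_den_gt0.
rewrite K_J// normrM ger0_norm ?invr_ge0 ?mulr_ge0 ?pi_ge0 ?(ltW r_gt0)//.
rewrite (_ : 2 * C / pi * _ = (pi * r)^-1 * (2 * C / (1 + (x / r) ^+ 2))); last first.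
  rewrite /poisson (_ : 1 + _ = (r ^+ 2 + x ^+ 2) / r ^+ 2); last by field.
  by move: pi pi0 => p p0; field; rewrite ?rN0 ?p0 ?d0.
rewrite ler_wpM2l ?invr_ge0 ?mulr_ge0 ?pi_ge0 ?(ltW r_gt0)//.
rewrite ler_pdivlMr ?ltr_pwDl ?sqr_ge0// mulrDr mulr1 mulrC [X in X <= _]addrC.
by rewrite mulr_natl mulr2n lerD// mulrC.
Qed.

(** The price r^-2 = t^(-2/3) of one spatial derivative is integrable in
time. *)
Lemma G_bound (r0 : R) : exists2 C, 0 <= C & forall r x, 0 < r <= r0 ->
  `|G r x| <= C / r ^+ 2 / (1 + `|x| ^+ 3).
Proof.
have [C C0 h] := G_expansion r0; exists (C * (1 + `|r0| ^+ 3) / pi) => [|r x rr].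
  by rewrite divr_ge0 ?pi_ge0// ?mulr_ge0// addr_ge0// exprn_ge0.
have [r_gt0 rr0] := andP rr; have [h1 h2] := h r x rr.
have rN0 : r != 0 by rewrite gt_eqF.
have pi0 : pi != 0 :> R by rewrite gt_eqF// pi_gt0.
have d0 : 1 + `|x| ^+ 3 != 0 by rewrite gt_eqF// ltr_pwDl ?exprn_ge0.
rewrite /G normrM ger0_norm; last first.
  by rewrite invr_ge0 mulr_ge0 ?pi_ge0 ?sqr_ge0.
rewrite (_ : C * _ / pi / _ / _ = (pi * r ^+ 2)^-1 * (C * (1 + `|r0| ^+ 3) / (1 + `|x| ^+ 3))); last first.
  by move: pi pi0 => p p0; field; rewrite ?rN0 ?p0 ?d0.
rewrite ler_wpM2l//; first by rewrite invr_ge0 mulr_ge0 ?pi_ge0 ?sqr_ge0.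
rewrite ler_pdivlMr ?ltr_pwDl ?exprn_ge0// mulrDr mulr1 mulrDr mulr1 lerD//.
move: h2; rewrite normrM normfV (ger0_norm (ltW r_gt0)) expr_div_n.
rewrite mulrAC ler_pdivrMr ?exprn_gt0// mulrC => /le_trans; apply.
rewrite ler_wpM2l// lerXn2r ?nnegrE ?(ltW r_gt0)//.
by rewrite (le_trans rr0)// ler_norm.
Qed.

(** The tail of the kernel, read off the second boundary term of the
integrations by parts. *)
Lemma K_asymp r : 0 < r -> exists2 C, 0 <= C & forall x, x != 0 ->
  `|K eta (r ^+ 3) x + eta * r ^+ 3 / (pi * x ^+ 2)| <= C / `|x| ^+ 3.
Proof.
move=> r_gt0; have [C C0 h] := K_expansion r; exists (C * r ^+ 2 / pi) => [|x x0].
  by rewrite divr_ge0 ?pi_ge0// mulr_ge0// sqr_ge0.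
have [|_ _ {}h] := h r x; first by rewrite r_gt0/=.
have rN0 : r != 0 by rewrite gt_eqF.
have pi0 : pi != 0 :> R by rewrite gt_eqF// pi_gt0.
have nx0 : 0 < `|x| by rewrite normr_gt0.
rewrite K_J// ler_pdivlMr ?exprn_gt0// -normrX -normrM.
set j := J r x 1 0 in h *.
rewrite (_ : _ * x ^+ 3 = r ^+ 2 / pi * (x / r * ((x / r) ^+ 2 * j + eta * r ^+ 2))); last first.
  by move: pi pi0 => p p0; field; rewrite ?x0 ?rN0 ?p0.
have rp : 0 <= r ^+ 2 / pi by rewrite divr_ge0 ?sqr_ge0 ?pi_ge0.
by rewrite normrM ger0_norm// -[leRHS]mulrA [leRHS]mulrC ler_wpM2l// normrM.
Qed.

End kernel.

(** * Fourier transforms of integrable functions *)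

Section fourier_theory.
Context {R : realType}.
Notation mu := (@lebesgue_measure R).
Implicit Types (f g h : R -> R) (x y xi delta : R).

Lemma Fubini_dom (F : R -> R -> R) h k :
  measurable_fun setT (fun p : R * R => F p.1 p.2) ->
  mu.-integrable setT (EFin \o h) -> mu.-integrable setT (EFin \o k) ->
  (forall x, 0 <= h x) -> (forall x, 0 <= k x) ->
  (forall x y, `|F x y| <= h x * k y) ->
  mu.-integrable setT (EFin \o (fun x => \int[mu]_y F x y)) /\
      (\int[mu]_x \int[mu]_y F x y = \int[mu]_y \int[mu]_x F x y).
Proof.
move=> mF ih ik h0 k0 Fhk.
pose G (p : R * R) : \bar R := (F p.1 p.2)%:E.
have mG : measurable_fun setT G by exact/measurable_EFinP.
have mF1 x : measurable_fun setT (fun y => F x y).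
  by apply: (measurableT_comp mF (pair1_measurable x)).
have mF2 y : measurable_fun setT (fun x => F x y).
  by apply: (measurableT_comp mF (pair2_measurable y)).
have i1 x : mu.-integrable setT (EFin \o (fun y => F x y)).
  apply: (@integrable_dom _ _ _ (fun y => h x * k y)) => //.
  exact: (integrableZl _ (h x) ik).
have i2 y : mu.-integrable setT (EFin \o (fun x => F x y)).
  apply: (@integrable_dom _ _ _ (fun x => k y * h x)) => //.
    by move=> x _; rewrite mulrC.
  exact: (integrableZl _ (k y) ih).
have iG : (mu \x mu)%E.-integrable setT G.
  apply/integrable12ltyP => //.
  apply: (@le_lt_trans _ _ (\int[mu]_x \int[mu]_y (h x * k y)%:E)%E).
    apply: ge0_le_integral_nomeas => x _.
      by apply: integral_ge0 => y _; rewrite lee_fin.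
    apply: ge0_le_integral_nomeas => y _; first by rewrite lee_fin.
    by rewrite lee_fin.
  under eq_integral => x _.
    under eq_integral do rewrite EFinM.
    rewrite integralZl//.
    over.
  rewrite -(fineK (integrable_fin_num measurableT ik)).
  rewrite integralZr//.
  rewrite -(fineK (integrable_fin_num measurableT ih)) -EFinM ltry//.
have E1 x : (\int[mu]_y G (x, y))%E = (\int[mu]_y F x y)%:E.
  by rewrite /Rintegral fineK//; exact: (integrable_fin_num measurableT (i1 x)).
have E2 y : (\int[mu]_x G (x, y))%E = (\int[mu]_x F x y)%:E.
  by rewrite /Rintegral fineK//; exact: (integrable_fin_num measurableT (i2 y)).
split.
- have := integrable_fubini_F iG; rewrite /fubini_F.
  by rewrite (_ : (fun x => _) = EFin \o (fun x => \int[mu]_y F x y))//; apply/funext.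
- have := Fubini iG.
  under eq_integral do rewrite E1.
  under [RHS]eq_integral do rewrite E2.
  by rewrite {3 4}/Rintegral => ->.
Qed.

(** The damping factor exp(- delta |xi|) makes the inversion integrals
absolutely convergent; its Fourier transform is a Poisson kernel. *)
Definition decay delta xi : R := expR (- (delta * `|xi|)).

Lemma continuous_decay delta : continuous (decay delta).
Proof.
move=> z; apply: (@continuous_comp _ _ _ (fun xi => - (delta * `|xi|)) expR); last exact: continuous_expR.
by apply: cvgN; apply: cvgM; [exact: cvg_cst|exact: norm_continuous].
Qed.

Lemma decay_ge0 delta xi : 0 <= decay delta xi. Proof. exact: expR_ge0. Qed.

Lemma decay_le1 delta xi : 0 < delta -> decay delta xi <= 1.
Proof. by move=> d0; rewrite expR_le1 oppr_le0 mulr_ge0// ltW. Qed.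

Lemma cvgn_expRN delta : 0 < delta -> expR (- (delta * n%:R)) @[n --> \oo] --> (0 : R).
Proof.
move=> d0; apply: (@cvg_comp _ _ _ (fun n : nat => delta * n%:R) (fun x => expR (- x)) _ +oo); last first.
  exact: cvgr_expR.
apply/cvgryPge => M; near=> n; rewrite mulrC -ler_pdivrMr//; near: n; exact: nbhs_infty_ger.
Unshelve. all: by end_near. Qed.

Lemma integrable_decay_half delta : 0 < delta ->
  mu.-integrable `[0, +oo[ (EFin \o decay delta).
Proof.
move=> d0.
have ie : mu.-integrable `[0, +oo[ (EFin \o (fun xi => expR (- (delta * xi)))).
  have dF (xi : R) : is_derive xi 1 (fun xi => - (expR (- (delta * xi)) / delta)) (expR (- (delta * xi))).
    have h : is_derive xi 1 (fun xi => - (delta * xi)) (- delta).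
      by apply: is_derive_eq; rewrite /GRing.scale/=; ring.
    have h2 := is_derive1_comp (is_derive_expR _) h.
    apply: is_derive_eq; rewrite /GRing.scale/=; field; by rewrite gt_eqF.
  have cf : continuous (fun xi => expR (- (delta * xi))).
    move=> z; apply: (@continuous_comp _ _ _ (fun xi => - (delta * xi)) expR); last exact: continuous_expR.
    by apply: cvgN; apply: cvgM; [exact: cvg_cst|exact: cvg_id].
  apply/integrableP; split.
    by apply/measurable_EFinP; apply: measurable_funTS; exact: continuous_measurable_fun.
  under eq_integral => x _ do rewrite /= ger0_norm ?expR_ge0//.
  rewrite (ge0_integral_halfline dF cf (b := 0))//; first by rewrite ltry.
  rewrite -oppr0; apply: cvgN; rewrite -[X in _ --> X](mul0r delta^-1); apply: cvgMr_tmp.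
  apply: (@cvg_comp _ _ _ (fun x : R => delta * x) (fun x => expR (- x)) _ +oo); last exact: cvgr_expR.
  exact: gt0_cvgMry.
apply: integrable_dom ie => //.
  by apply: measurable_funTS; apply: continuous_measurable_fun; exact: continuous_decay.
move=> x /=; rewrite in_itv/= andbT => x0.
by rewrite ger0_norm ?decay_ge0// /decay ger0_norm.
Qed.

Lemma cvg_decay xi : decay n.+1%:R^-1 xi @[n --> \oo] --> (1 : R).
Proof.
have h : - (n.+1%:R^-1 * `|xi|) @[n --> \oo] --> (0 : R).
  rewrite -oppr0; apply: cvgN; rewrite -(mul0r `|xi|); apply: cvgMr_tmp.
  exact: cvg_harmonic.
by have := @continuous_cvg _ _ _ _ _ _ expR _ (@continuous_expR R 0) h; rewrite expR0 => H; exact: H.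
Qed.

Lemma laplace_cos delta z : 0 < delta ->
  mu.-integrable setT (EFin \o (fun xi => decay delta xi * cos (z * xi))) /\
  \int[mu]_xi (decay delta xi * cos (z * xi)) = 2 * poisson delta z.
Proof.
move=> d0.
have cc : continuous (fun xi => cos (z * xi)).
  move=> w; apply: (@continuous_comp _ _ _ (fun xi => z * xi) cos); last exact: continuous_cos.
  by apply: cvgM; [exact: cvg_cst|exact: cvg_id].
have cf : continuous (fun xi => decay delta xi * cos (z * xi)).
  by move=> w; apply: cvgM; [exact: continuous_decay|exact: cc].
have ef : (fun xi => decay delta xi * cos (z * xi)) =1 (fun xi => decay delta xi * cos (z * xi)) \o -%R.
  by move=> w; rewrite /= /decay normrN mulrN cosN.
have ee : decay delta =1 decay delta \o -%R by move=> w; rewrite /= /decay normrN.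
have fe w : `|decay delta w * cos (z * w)| <= decay delta w.
  by rewrite normrM ger0_norm ?expR_ge0// ler_piMr ?expR_ge0// cos_max.
have [I ->] := even_halfline cf (@continuous_decay delta) ef ee fe (integrable_decay_half d0).
split => //; congr (2 * _).
pose w := delta ^+ 2 + z ^+ 2.
have w0 : w != 0 by rewrite gt_eqF// poisson_den_gt0.
pose F xi := expR (- (delta * xi)) * (z * sin (z * xi) - delta * cos (z * xi)) / w.
have dF xi : is_derive xi 1 F (expR (- (delta * xi)) * cos (z * xi)).
  have h : is_derive xi 1 (fun xi => - (delta * xi)) (- delta).
    by apply: is_derive_eq; rewrite /GRing.scale/=; ring.
  have h2 := is_derive1_comp (is_derive_expR _) h.
  have k : is_derive xi 1 (fun xi => z * xi) z.
    by apply: is_derive_eq; rewrite /GRing.scale/=; ring.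
  have k1 := is_derive1_comp (is_derive_cos _) k.
  have k2 := is_derive1_comp (is_derive_sin _) k.
  rewrite /F; apply: is_derive_eq; rewrite /GRing.scale/= /w; field.
  exact: w0.
have E : {in `[0, +oo[%classic, (fun xi => decay delta xi * cos (z * xi)) =1 (fun xi => expR (- (delta * xi)) * cos (z * xi))}.
  by move=> xi; rewrite inE/= in_itv/= andbT => xi0; rewrite /decay ger0_norm.
have If : mu.-integrable `[0, +oo[ (EFin \o (fun xi => expR (- (delta * xi)) * cos (z * xi))).
  apply: (@eq_integrable _ _ _ mu _ _ (EFin \o (fun xi => decay delta xi * cos (z * xi)))) => //.
    by move=> xi /E /= ->.
  by apply: (@integrableS _ _ _ _ setT).
rewrite (@eq_Rintegral _ _ _ mu _ (fun xi => expR (- (delta * xi)) * cos (z * xi)) _ E).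
rewrite (FTC_halfline dF)//.
- rewrite /F !mulr0 cos0 sin0 oppr0 expR0 mulr0 sub0r mulr1 mul1r mulNr opprK.
  by rewrite /poisson.
- move=> x; apply: cvgM; last exact: cc.
  apply: (@continuous_comp _ _ _ (fun xi => - (delta * xi)) expR); last exact: continuous_expR.
  by apply: cvgN; apply: cvgM; [exact: cvg_cst|exact: cvg_id].
- apply/cvgr0Pnorm_le => e e0.
  have c0 : 0 < (`|z| + delta) / `|w| by rewrite divr_gt0 ?normr_gt0// ltr_wpDl.
  have /cvgr0Pnorm_le /(_ (e / ((`|z| + delta) / `|w|))) := cvgn_expRN d0.
  rewrite divr_gt0// => /(_ isT); apply: filterS => n; rewrite ler_pdivlMr//.
  apply: le_trans; rewrite /F -mulrA normrM ler_wpM2l// normrM normfV ler_wpM2r//.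
  rewrite (le_trans (ler_normB _ _))// !normrM (ger0_norm (ltW d0)) lerD//.
    by rewrite ler_piMr// ler_norml sin_geN1 sin_le1.
  by rewrite ler_piMr// ?cos_max// ltW.
Qed.

Lemma integrable_decay delta : 0 < delta -> mu.-integrable setT (EFin \o decay delta).
Proof.
move=> d0; have [+ _] := laplace_cos 0 d0.
by rewrite (_ : (fun xi => _) = decay delta)//; apply/funext => xi; rewrite mul0r cos0 mulr1.
Qed.

Lemma Rintegral_decay delta : 0 < delta -> \int[mu]_xi decay delta xi = 2 / delta.
Proof.
move=> d0; have [_] := laplace_cos 0 d0.
rewrite (_ : (fun xi => _) = decay delta); last by apply/funext => xi; rewrite mul0r cos0 mulr1.
by move=> ->; rewrite /poisson; field; rewrite gt_eqF.
Qed.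

(** For a real function h the real and imaginary parts of the Fourier
transform are cosft h and - sinft h. *)
Definition cosft h xi : R := \int[mu]_x (cos (x * xi) * h x).
Definition sinft h xi : R := \int[mu]_x (sin (x * xi) * h x).

Lemma measurable_mul2 : measurable_fun setT (fun p : R * R => p.1 * p.2).
Proof. by apply: measurable_funM; [exact: measurable_fst|exact: measurable_snd]. Qed.

Lemma measurable_cos_lin (a : R) : measurable_fun setT (fun y => cos (a * y)).
Proof.
apply: continuous_measurable_fun => y.
apply: (@continuous_comp _ _ _ (fun y => a * y) cos); last exact: continuous_cos.
by apply: cvgM; [exact: cvg_cst|exact: cvg_id].
Qed.

Lemma measurable_sin_lin (a : R) : measurable_fun setT (fun y => sin (a * y)).
Proof.
apply: continuous_measurable_fun => y.
apply: (@continuous_comp _ _ _ (fun y => a * y) sin); last exact: continuous_sin.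
by apply: cvgM; [exact: cvg_cst|exact: cvg_id].
Qed.

Lemma mcos : measurable_fun setT (cos : R -> R).
Proof. by apply: continuous_measurable_fun; exact: continuous_cos. Qed.
Lemma msin : measurable_fun setT (sin : R -> R).
Proof. by apply: continuous_measurable_fun; exact: continuous_sin. Qed.

Lemma integrable_cos_mul h xi : mu.-integrable setT (EFin \o h) ->
  mu.-integrable setT (EFin \o (fun x => cos (x * xi) * h x)).
Proof.
move=> ih; have mh := L1_measurable ih.
apply: (@integrable_dom _ _ _ (fun x => `|h x|)) => //.
- apply: measurable_funM => //; under eq_fun do rewrite mulrC; exact: measurable_cos_lin.
- by move=> x _; rewrite normrM ler_piMl// cos_max.
- exact: integrable_norm.
Qed.

Lemma integrable_sin_mul h xi : mu.-integrable setT (EFin \o h) ->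
  mu.-integrable setT (EFin \o (fun x => sin (x * xi) * h x)).
Proof.
move=> ih; have mh := L1_measurable ih.
apply: (@integrable_dom _ _ _ (fun x => `|h x|)) => //.
- apply: measurable_funM => //; under eq_fun do rewrite mulrC; exact: measurable_sin_lin.
- by move=> x _; rewrite normrM ler_piMl// ler_norml sin_geN1 sin_le1.
- exact: integrable_norm.
Qed.

Lemma normr_cosft h xi : mu.-integrable setT (EFin \o h) -> `|cosft h xi| <= \int[mu]_x `|h x|.
Proof.
move=> ih; apply: normr_Rintegral_dom => //; last exact: integrable_norm.
by move=> x _; rewrite normrM ler_piMl// cos_max.
Qed.

Lemma normr_sinft h xi : mu.-integrable setT (EFin \o h) -> `|sinft h xi| <= \int[mu]_x `|h x|.
Proof.
move=> ih; apply: normr_Rintegral_dom => //; last exact: integrable_norm.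
by move=> x _; rewrite normrM ler_piMl// ler_norml sin_geN1 sin_le1.
Qed.

(** Measurability of a partial integral comes from Fubini, which asks for
integrability in xi as well: multiply by exp(- |xi|) and divide afterwards. *)
Lemma measurable_trigft (c : R -> R) h : measurable_fun setT c -> (forall x, `|c x| <= 1) ->
  mu.-integrable setT (EFin \o h) ->
  measurable_fun setT (fun xi => \int[mu]_x (c (x * xi) * h x)).
Proof.
move=> mc c1 ih; have mh := L1_measurable ih.
pose F xi x : R := decay 1 xi * (c (x * xi) * h x).
have md : measurable_fun setT (decay 1).
  by apply: continuous_measurable_fun; exact: continuous_decay.
have ixi xi : mu.-integrable setT (EFin \o (fun x => c (x * xi) * h x)).
  apply: (@integrable_dom _ _ _ (fun x => `|h x|)) => //.
  - apply: measurable_funM => //; apply: measurableT_comp => //.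
    by apply: measurable_funM.
  - by move=> x _; rewrite normrM ler_piMl// cos_max.
  - exact: integrable_norm.
have [] := @Fubini_dom F (decay 1) (fun x => `|h x|).
- rewrite /F; apply: measurable_funM.
    by apply: (measurableT_comp md); exact: measurable_fst.
  apply: measurable_funM; last by apply: (measurableT_comp mh); exact: measurable_snd.
  apply: (measurableT_comp mc).
  by apply: measurable_funM; [exact: measurable_snd|exact: measurable_fst].
- exact: integrable_decay.
- exact: integrable_norm.
- by move=> x; exact: decay_ge0.
- by move=> x /=.
- move=> xi x; rewrite /F !normrM (ger0_norm (decay_ge0 _ _)) ler_wpM2l ?decay_ge0//=.
  by rewrite ler_piMl.
move=> /measurable_int/measurable_EFinP mF _.
have -> : (fun xi => \int[mu]_x (c (x * xi) * h x)) = fun xi => (expR `|xi|) * \int[mu]_x F xi x.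
  apply/funext => xi; rewrite /F RintegralZl// mulrA /decay mul1r -expRD addrN expR0 mul1r.
  by [].
apply: measurable_funM => //; apply: measurableT_comp => //.
Qed.

Lemma measurable_cosft h : mu.-integrable setT (EFin \o h) -> measurable_fun setT (cosft h).
Proof. by apply: measurable_trigft; [exact: mcos|exact: cos_max]. Qed.

Lemma measurable_sinft h : mu.-integrable setT (EFin \o h) -> measurable_fun setT (sinft h).
Proof. by apply: measurable_trigft; [exact: msin|move=> x; rewrite ler_norml sin_geN1 sin_le1]. Qed.

Lemma Rintegral_cos_shift h x xi : mu.-integrable setT (EFin \o h) ->
  \int[mu]_y (cos ((x - y) * xi) * h y) = cos (x * xi) * cosft h xi + sin (x * xi) * sinft h xi.
Proof.
move=> ih; have i1 := integrable_cos_mul xi ih; have i2 := integrable_sin_mul xi ih.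
rewrite /cosft /sinft -(RintZ _ i1) -(RintZ _ i2) -(RintD (L1Z _ i1) (L1Z _ i2)).
by apply: Rint_eq => y; rewrite mulrBl cosB; ring.
Qed.

(** Fourier inversion for integrable functions, damped: the damping turns the
inverse transform into a convolution with the Poisson kernel. *)
Lemma poisson_fourier h delta x : 0 < delta -> mu.-integrable setT (EFin \o h) ->
  \int[mu]_y (h y * (2 * poisson delta (x - y))) =
  \int[mu]_xi (decay delta xi * (cos (x * xi) * cosft h xi + sin (x * xi) * sinft h xi)).
Proof.
move=> d0 ih; have mh := L1_measurable ih.
have md : measurable_fun setT (decay delta).
  by apply: continuous_measurable_fun; exact: continuous_decay.
pose F y xi : R := h y * (decay delta xi * cos ((x - y) * xi)).
have [] := @Fubini_dom F (fun x => `|h x|) (decay delta).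
- rewrite /F; apply: measurable_funM; first by apply: (measurableT_comp mh); exact: measurable_fst.
  apply: measurable_funM; first by apply: (measurableT_comp md); exact: measurable_snd.
  apply: (measurableT_comp mcos).
  apply: measurable_funM; last exact: measurable_snd.
  by apply: measurable_funB => //; exact: measurable_fst.
- exact: integrable_norm.
- exact: integrable_decay.
- by move=> y /=.
- by move=> xi; exact: decay_ge0.
- move=> y xi; rewrite /F !normrM ler_wpM2l// (ger0_norm (decay_ge0 _ _)) ler_piMr ?decay_ge0//.
  exact: cos_max.
move=> _ E; transitivity (\int[mu]_y \int[mu]_xi F y xi).
  apply: Rint_eq => y; have [I L] := laplace_cos (x - y) d0.
  by rewrite /F (RintZ _ I) L.
apply: (etrans E); apply: Rint_eq => xi; rewrite -Rintegral_cos_shift//.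
have I : mu.-integrable setT (EFin \o (fun y => cos ((x - y) * xi) * h y)).
  apply: (L1_dom (g := fun y => `|h y|)).
  - apply: measurable_funM => //; apply: (measurableT_comp mcos).
    by apply: measurable_funM => //; exact: measurable_funB.
  - by move=> y; rewrite normrM ler_piMl// cos_max.
  - exact: integrable_norm.
by rewrite -(RintZ _ I); apply: Rint_eq => y; rewrite /F; ring.
Qed.

Lemma integrable_sqr_poisson (h2 : R -> R) delta x : 0 < delta ->
  mu.-integrable setT (EFin \o h2) ->
  mu.-integrable setT (EFin \o (fun y => h2 y * poisson delta (x - y))).
Proof.
move=> d0 ih; have mh := L1_measurable ih.
apply: (@integrable_dom _ _ _ (fun y => delta^-1 * `|h2 y|)) => //.
- apply: measurable_funM => //; apply: (measurableT_comp (f := poisson delta)).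
    by apply: continuous_measurable_fun; exact: continuous_poisson.
  exact: measurable_funB.
- move=> y _; rewrite normrM mulrC ler_wpM2r// ger0_norm ?poisson_ge0//.
  rewrite /poisson ler_pdivrMr ?poisson_den_gt0// mulrDr expr2 mulrA mulVf ?gt_eqF// mul1r.
  by rewrite lerDl mulr_ge0 ?sqr_ge0// invr_ge0 ltW.
- exact: (integrableZl _ delta^-1 (integrable_norm ih)).
Qed.

Lemma tonelli_poisson (h2 : R -> R) delta : 0 < delta -> (forall x, 0 <= h2 x) ->
  mu.-integrable setT (EFin \o h2) ->
  mu.-integrable setT (EFin \o (fun x => \int[mu]_y (h2 y * poisson delta (x - y)))) /\
  \int[mu]_x \int[mu]_y (h2 y * poisson delta (x - y)) = pi * \int[mu]_y h2 y.
Proof.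
move=> d0 h0 ih; have mh := L1_measurable ih.
have mp : measurable_fun setT (poisson delta).
  by apply: continuous_measurable_fun; exact: continuous_poisson.
pose G (p : R * R) : \bar R := (h2 p.2 * poisson delta (p.1 - p.2))%:E.
have mG : measurable_fun setT G.
  apply/measurable_EFinP; apply: measurable_funM.
    by apply: (measurableT_comp mh); exact: measurable_snd.
  apply: (measurableT_comp mp).
  by apply: measurable_funB; [exact: measurable_fst|exact: measurable_snd].
have G0 p : (0 <= G p)%E by rewrite lee_fin mulr_ge0// poisson_ge0.
have E1 x : (\int[mu]_y G (x, y))%E = (\int[mu]_y (h2 y * poisson delta (x - y)))%:E.
  rewrite /Rintegral fineK//.
  exact: (integrable_fin_num measurableT (integrable_sqr_poisson x d0 ih)).
have H : (\int[mu]_x \int[mu]_y G (x, y))%E = (pi * \int[mu]_y h2 y)%:E.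
  rewrite (@fubini_tonelli _ _ _ _ R mu mu G mG G0).
  rewrite (_ : (fun y => _) = fun y => ((h2 y)%:E * pi%:E)%E); last first.
    apply/funext => y; rewrite /G/=; under eq_integral do rewrite EFinM -opprB poissonN.
    rewrite integralZl ?integral_poisson//; exact: integrable_poisson.
  by rewrite integralZr// muleC EFinM /Rintegral fineK//; exact: integrable_fin_num.
rewrite (_ : (fun x => _) = fun x => (\int[mu]_y (h2 y * poisson delta (x - y)))%:E) in H; last first.
  by apply/funext.
split; last by rewrite {1}/Rintegral H.
apply/integrableP; split.
  have := @measurable_fun_fubini_tonelli_F _ _ _ _ R mu G mG G0.
  rewrite (_ : fubini_F _ _ = EFin \o (fun x => \int[mu]_y (h2 y * poisson delta (x - y))))//.
  by apply/funext => x; rewrite /fubini_F E1.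
under eq_integral => x _.
  rewrite /= ger0_norm; last first.
    by apply: Rintegral_ge0 => y _; rewrite mulr_ge0// poisson_ge0.
  over.
by rewrite H ltry.
Qed.

(** By the damped inversion formula the left-hand side is the double integral
of 2 h(x) h(y) against the Poisson kernel of x - y; bounding 2 h(x) h(y) by
h(x)^2 + h(y)^2 and integrating out one variable gives the bound. *)
Lemma plancherel_damped h delta : 0 < delta ->
  mu.-integrable setT (EFin \o h) -> mu.-integrable setT (EFin \o (fun x => h x ^+ 2)) ->
  \int[mu]_xi (decay delta xi * (cosft h xi ^+ 2 + sinft h xi ^+ 2)) <=
  2 * pi * \int[mu]_x h x ^+ 2.
Proof.
move=> d0 ih ih2; have mh := L1_measurable ih.
have md : measurable_fun setT (decay delta).
  by apply: continuous_measurable_fun; exact: continuous_decay.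
pose B x xi := cos (x * xi) * cosft h xi + sin (x * xi) * sinft h xi.
pose N1 := \int[mu]_x `|h x|.
have N10 : 0 <= N1 by exact: Rintegral_ge0.
pose F x xi : R := h x * (decay delta xi * B x xi).
have Bb x xi : `|B x xi| <= 2 * N1.
  rewrite (le_trans (ler_normD _ _))// mulr_natl mulr2n lerD// normrM.
    by rewrite -[leRHS]mul1r ler_pM ?cos_max// normr_cosft.
  by rewrite -[leRHS]mul1r ler_pM ?normr_sinft// ler_norml sin_geN1 sin_le1.
have [] := @Fubini_dom F (fun x => `|h x|) (fun xi => 2 * N1 * decay delta xi).
- rewrite /F; apply: measurable_funM; first by apply: (measurableT_comp mh); exact: measurable_fst.
  apply: measurable_funM; first by apply: (measurableT_comp md); exact: measurable_snd.
  apply: measurable_funD; apply: measurable_funM.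
  + by apply: (measurableT_comp mcos); exact: measurable_mul2.
  + by apply: (measurableT_comp (measurable_cosft ih)); exact: measurable_snd.
  + by apply: (measurableT_comp msin); exact: measurable_mul2.
  + by apply: (measurableT_comp (measurable_sinft ih)); exact: measurable_snd.
- exact: integrable_norm.
- exact: (integrableZl _ (2 * N1) (integrable_decay d0)).
- by move=> y /=.
- by move=> xi; rewrite !mulr_ge0// decay_ge0.
- move=> x xi; rewrite /F !normrM ler_wpM2l// (ger0_norm (decay_ge0 _ _)) mulrC.
  by rewrite ler_wpM2r ?decay_ge0.
move=> iF E.
have -> : \int[mu]_xi (decay delta xi * (cosft h xi ^+ 2 + sinft h xi ^+ 2)) =
    \int[mu]_x \int[mu]_xi F x xi.
  apply: esym; apply: (etrans E); apply: Rint_eq => xi; rewrite /F; apply: esym.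
  have i1 := integrable_cos_mul xi ih; have i2 := integrable_sin_mul xi ih.
  transitivity (\int[mu]_x (decay delta xi * cosft h xi * (cos (x * xi) * h x) +
     decay delta xi * sinft h xi * (sin (x * xi) * h x))); last first.
    by apply: Rint_eq => x; rewrite /B; ring.
  rewrite (RintD (L1Z _ i1) (L1Z _ i2)) (RintZ _ i1) (RintZ _ i2).
  by rewrite -/(cosft h xi) -/(sinft h xi); ring.
have h20 x : 0 <= h x ^+ 2 by exact: sqr_ge0.
have [iT T] := tonelli_poisson d0 h20 ih2.
pose U x := pi * h x ^+ 2 + \int[mu]_y (h y ^+ 2 * poisson delta (x - y)).
have iU1 : mu.-integrable setT (EFin \o (fun x => pi * h x ^+ 2)).
  exact: (integrableZl _ pi ih2).
have iU : mu.-integrable setT (EFin \o U) by exact: (integrableD _ iU1 iT).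
have -> : 2 * pi * \int[mu]_x h x ^+ 2 = \int[mu]_x U x.
  by rewrite /U (RintD iU1 iT) (RintZ _ ih2) T; ring.
apply: (Rint_le iF iU) => x.
have I : mu.-integrable setT (EFin \o (fun xi => decay delta xi * B x xi)).
  apply: (L1_dom (g := fun xi => 2 * N1 * decay delta xi)).
  - apply: mfM; first exact: md.
    apply: mfD; apply: mfM.
    + exact: measurable_cos_lin.
    + exact: measurable_cosft.
    + exact: measurable_sin_lin.
    + exact: measurable_sinft.
  - by move=> xi; rewrite normrM (ger0_norm (decay_ge0 _ _)) mulrC ler_wpM2r ?decay_ge0.
  - exact: (L1Z _ (integrable_decay d0)).
rewrite /F (RintZ _ I).
have PF : \int[mu]_y (h y * (2 * poisson delta (x - y))) = \int[mu]_xi (decay delta xi * B x xi) := poisson_fourier x d0 ih.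
rewrite -PF /U.
have ihp := integrable_sqr_poisson x d0 ih.
have ihp2 := integrable_sqr_poisson x d0 ih2.
have ip := integrable_poisson x d0.
have -> : \int[mu]_y (h y * (2 * poisson delta (x - y))) =
    2 * \int[mu]_y (h y * poisson delta (x - y)).
  by rewrite -(RintZ _ ihp); apply: Rint_eq => y; ring.
rewrite -(Rintegral_poisson x d0) [X in _ <= X + _]mulrC -(RintZ _ ip) -(RintD (L1Z _ ip) ihp2).
rewrite mulrA -(RintZ _ ihp).
apply: (Rint_le (L1Z _ ihp) (L1D (L1Z _ ip) ihp2)) => y.
have := poisson_ge0 (x - y) d0; move: (poisson delta (x - y)) (h x) (h y) => p a b p0.
have := mulr_ge0 (sqr_ge0 (a - b)) p0; clear; nra.
Qed.

Lemma limn_einf_le (u : nat -> \bar R) c m :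
  (forall n, (m <= n)%N -> (u n <= c)%E) -> (limn_einf u <= c)%E.
Proof.
move=> uc; rewrite limn_einf_lim; apply: lime_le; first exact: is_cvg_einfs.
apply: nearW => n; apply: le_trans (uc _ (leq_maxr n m)).
by apply: ereal_inf_lbound; exists (maxn n m) => //=; exact: leq_maxl.
Qed.

(** Remove the damping with Fatou. The inequality is what makes the transforms
of truncations a Cauchy sequence in L^2. *)
Lemma plancherel_le h :
  mu.-integrable setT (EFin \o h) -> mu.-integrable setT (EFin \o (fun x => h x ^+ 2)) ->
  (\int[mu]_xi (cosft h xi ^+ 2 + sinft h xi ^+ 2)%:E <= (2 * pi * \int[mu]_x h x ^+ 2)%:E)%E.
Proof.
move=> ih ih2.
have mC := measurable_cosft ih; have mS := measurable_sinft ih.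
have mN : measurable_fun setT (fun xi => cosft h xi ^+ 2 + sinft h xi ^+ 2).
  by apply: measurable_funD; apply: measurable_funX.
have md d : measurable_fun setT (decay d).
  by apply: continuous_measurable_fun; exact: continuous_decay.
pose N1 := \int[mu]_x `|h x|.
have N10 : 0 <= N1 by exact: Rintegral_ge0.
have Nb xi : cosft h xi ^+ 2 + sinft h xi ^+ 2 <= 2 * N1 ^+ 2.
  rewrite mulr_natl mulr2n -(real_normK (num_real (cosft h xi))) -(real_normK (num_real (sinft h xi))).
  by rewrite lerD// lerXn2r ?nnegrE// ?normr_cosft// normr_sinft.
have N0 xi : 0 <= cosft h xi ^+ 2 + sinft h xi ^+ 2 by rewrite addr_ge0// sqr_ge0.
pose f n xi : \bar R := (decay n.+1%:R^-1 xi * (cosft h xi ^+ 2 + sinft h xi ^+ 2))%:E.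
have mf n : measurable_fun setT (f n) by apply/measurable_EFinP; exact: measurable_funM.
have f0 n xi : setT xi -> (0 <= f n xi)%E by move=> _; rewrite lee_fin mulr_ge0// decay_ge0.
have flim xi : f n xi @[n --> \oo] --> (cosft h xi ^+ 2 + sinft h xi ^+ 2)%:E.
  apply: cvg_EFin; first by near=> n.
  rewrite -[X in _ --> X]mul1r; apply: cvgMr_tmp.
  exact: cvg_decay.
have := fatou mu measurableT mf f0.
rewrite (_ : (fun x => _) = fun xi => (cosft h xi ^+ 2 + sinft h xi ^+ 2)%:E); last first.
  apply/funext => xi; rewrite is_cvg_limn_einfE; first exact/cvg_lim.
  by apply/cvg_ex; eexists; exact: flim.
move=> /le_trans; apply; apply: (limn_einf_le (m := 0)) => n _.
have d0 : 0 < n.+1%:R^-1 :> R by [].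
have If : mu.-integrable setT (EFin \o (fun xi => decay n.+1%:R^-1 xi * (cosft h xi ^+ 2 + sinft h xi ^+ 2))).
  apply: (L1_dom (g := fun xi => 2 * N1 ^+ 2 * decay n.+1%:R^-1 xi)).
  - exact: measurable_funM.
  - by move=> xi; rewrite ger0_norm ?mulr_ge0 ?decay_ge0// mulrC ler_wpM2r ?decay_ge0.
  - by apply: L1Z; exact: integrable_decay.
have := plancherel_damped d0 ih ih2; rewrite -lee_fin; apply: le_trans.
by rewrite /Rintegral fineK//; exact: (integrable_fin_num measurableT If).
Unshelve. all: by end_near. Qed.

End fourier_theory.

(** * Completeness of the space of square-integrable functions *)

Section riesz_fischer.
Context {R : realType}.
Notation mu := (@lebesgue_measure R).
Implicit Types (f g h : R -> R) (x y xi delta : R).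

Lemma measurable_limn_einf (f : nat -> R -> \bar R) :
  (forall n, measurable_fun setT (f n)) ->
  measurable_fun setT (fun x => limn_einf (f ^~ x)).
Proof.
move=> mf.
rewrite (_ : (fun x => _) = fun x => (- limn_esup (fun n => - f n x))%E).
  apply: measurableT_comp => //; apply: measurable_fun_limn_esup => n.
  exact: measurableT_comp.
apply/funext => x; rewrite -(limn_einfN (fun n => - f n x)%E); congr limn_einf.
by apply/funext => n /=; rewrite oppeK.
Qed.

Lemma fast_subseq (b : nat -> R) : b n @[n --> \oo] --> (0 : R) ->
  exists nk : nat -> nat, [/\ forall k, (k <= nk k)%N, forall k, (nk k <= nk k.+1)%N &
    forall k, b (nk k) <= (4^-1) ^+ k].
Proof.
move=> b0.
have H k : exists N, forall m, (N <= m)%N -> b m <= 4^-1 ^+ k.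
  move/cvgr0Pnorm_le : b0 => /(_ (4^-1 ^+ k)); rewrite exprn_gt0// => /(_ isT)[N _ hN].
  by exists N => m Nm; apply: le_trans (hN m Nm); exact: ler_norm.
have /choice [N hN] := H.
pose nk := fix nk k := if k is j.+1 then maxn (nk j).+1 (N k) else N 0%N.
have nS k : nk k.+1 = maxn (nk k).+1 (N k.+1) by [].
have nN k : (N k <= nk k)%N by case: k => [//|k]; rewrite nS leq_maxr.
exists nk; split => [k|k|k].
- elim: k => [//|k IH]; rewrite nS (leq_trans _ (leq_maxl _ _))//.
- by rewrite nS (leq_trans _ (leq_maxl _ _)).
- exact: hN.
Qed.

(** Along a subsequence with squared increments at most 4^-k the series of 2^k
times the squared increments has finite integral, so it is finite almost
everywhere; since |d| <= 2^-k + 2^k d^2 the subsequence then converges, and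
Fatou transfers the Cauchy bounds to the limit. *)
Lemma riesz_fischer (c : nat -> R -> R) (b : nat -> R) :
  (forall n, measurable_fun setT (c n)) -> b n @[n --> \oo] --> (0 : R) ->
  (forall m n, (m <= n)%N -> (\int[mu]_xi ((c n xi - c m xi) ^+ 2)%:E <= (b m)%:E)%E) ->
  exists2 g : R -> R, measurable_fun setT g &
    forall m, (\int[mu]_xi ((g xi - c m xi) ^+ 2)%:E <= (b m)%:E)%E.
Proof.
move=> mc b0 hb; have [nk [nk_ge nk_mono nk_b]] := fast_subseq b0.
have mdif k j : measurable_fun setT (fun xi => ((c k xi - c j xi) ^+ 2)%:E).
  by apply/measurable_EFinP; apply: measurable_funX; exact: measurable_funB.
(* Half of the gain 4^-k pays for the weight 2^k, the other half for summability. *)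
pose D k xi : \bar R := (2 ^+ k * (c (nk k.+1) xi - c (nk k) xi) ^+ 2)%:E.
have mD k : measurable_fun setT (D k).
  apply/measurable_EFinP; apply: measurable_funM => //.
  by apply: measurable_funX; exact: measurable_funB.
have D0 k xi : setT xi -> (0 <= D k xi)%E.
  by move=> _; rewrite lee_fin; apply: mulr_ge0; [exact: exprn_ge0|exact: sqr_ge0].
pose S xi : \bar R := (\sum_(0 <= k <oo) D k xi)%E.
have geo : limn (series (geometric (1 : R) 2^-1)) = 2.
  apply/cvg_lim => //.
  have := @cvg_geometric_series R 1 2^-1.
  rewrite ger0_norm// (_ : 1 / _ = 2); last by field.
  apply; rewrite invf_lt1//; lra.
have iS : mu.-integrable setT S.
  apply/integrableP; split.
    have H := @ge0_emeasurable_sum _ _ R setT D xpredT (fun k x Tx _ => D0 k x Tx) (fun k _ => mD k).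
    exact: H.
  apply: (@le_lt_trans _ _ (\int[mu]_xi S xi)%E).
    apply: ge0_le_integral_nomeas => x _; first exact: abse_ge0.
    by rewrite gee0_abs//; apply: nneseries_ge0 => k _ _; exact: D0.
  rewrite integral_nneseries//.
  apply: (@le_lt_trans _ _ (\sum_(0 <= k <oo) (geometric 1 2^-1 k)%:E)%E).
    apply: lee_nneseries => [*|k _]; first by apply: integral_ge0 => x _; exact: D0.
    rewrite /D /=; under eq_integral do rewrite EFinM.
    rewrite ge0_integralZl//=; last 2 first.
      - exact: mdif.
      - by move=> x _; rewrite lee_fin sqr_ge0.
    apply: (@le_trans _ _ ((2 ^+ k)%:E * (4^-1 ^+ k)%:E)%E).
      apply: lee_wpmul2l; first by rewrite lee_fin exprn_ge0.
      by apply: (le_trans (hb _ _ (nk_mono k))); rewrite lee_fin.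
    rewrite -EFinM lee_fin mul1r -exprMn (_ : 2 * 4^-1 = 2^-1)//; by field.
  rewrite (_ : (\sum_(0 <= k <oo) _)%E = (limn (series (geometric (1 : R) 2^-1)))%:E).
    by rewrite ltry.
  rewrite -EFin_lim; last first.
    by apply: is_cvg_geometric_series; rewrite ger0_norm// invf_lt1//; lra.
  by congr (limn _); apply/funext => n; rewrite /series/= sumEFin.
have Scvg xi : S xi \is a fin_num -> cvgn (fun k => c (nk k) xi).
  move=> Sfin.
  have bd : cvgn [normed series (telescope (fun k => c (nk k) xi))].
    apply: (@series_le_cvg _ _ (fun k => geometric 1 2^-1 k + fine (D k xi))).
    - by move=> n /=.
    - move=> n; rewrite addr_ge0//; last exact: fine_ge0 (D0 _ _ _).
      by rewrite /geometric/= mul1r exprn_ge0.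
    - move=> k; rewrite /telescope /D/= mul1r.
      set d := _ - _.
      have q0 : 0 < 2 ^+ k :> R by rewrite exprn_gt0.
      rewrite exprVn.
      have qp : (2 ^+ k)^-1 * 2 ^+ k = 1 :> R by rewrite mulVf// gt_eqF.
      have p0 : 0 < (2 ^+ k)^-1 :> R by rewrite invr_gt0.
      rewrite -(real_normK (num_real d)).
      move: (2 ^+ k) ((2 ^+ k)^-1) `|d| q0 p0 qp => q p e q0 p0 qp.
      have : 0 <= p * ((q * e) ^+ 2 - q * e + 1).
        rewrite mulr_ge0 ?(ltW p0)//; have := sqr_ge0 (q * e - 2^-1); move: (q * e) => w.
        clear; nra.
      rewrite (_ : p * _ = (p * q) * (q * e ^+ 2) - (p * q) * e + p); last by ring.
      by rewrite qp !mul1r => h; clear -h; lra.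
    - have gc : cvgn (series (geometric (1 : R) 2^-1)).
        by apply: is_cvg_geometric_series; rewrite ger0_norm// invf_lt1//; lra.
      have Dc : cvgn (series (fun k => fine (D k xi))).
        apply: nondecreasing_is_cvgn.
          apply: nondecreasing_series => n _ _; exact: fine_ge0 (D0 _ _ _).
        exists (fine (S xi)) => _ [n _ <-].
        rewrite -lee_fin fineK// /series/= -sumEFin.
        exact: (@nneseries_lim_ge R (D^~ xi) xpredT 0%N n (fun k _ _ => D0 k xi I)).
      have -> : series (fun k => geometric 1 2^-1 k + fine (D k xi)) =
          (fun n => series (geometric (1 : R) 2^-1) n + series (fun k => fine (D k xi)) n).
        by apply/funext => n; rewrite /series/= -big_split.
      exact: (is_cvgD gc Dc).
  have := normed_cvg bd; rewrite telescopeK => h.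
  have h2 := is_cvgD h (@is_cvg_cst _ (c (nk 0%N) xi) _ \oo _).
  have -> : (fun k => c (nk k) xi) = (fun k => c (nk k) xi - c (nk 0%N) xi + c (nk 0%N) xi).
    by apply/funext => n; rewrite subrK.
  exact: h2.
(* Off the null set where S is infinite this is the limit of the subsequence;
   the superior limit gives a measurable function everywhere. *)
pose g xi : R := fine (limn_esup (fun k => (c (nk k) xi)%:E)).
have mg : measurable_fun setT g.
  apply: measurableT_comp => //; apply: measurable_fun_limn_esup => n.
  exact/measurable_EFinP.
have glim xi : S xi \is a fin_num -> c (nk k) xi @[k --> \oo] --> g xi.
  move=> /Scvg h; rewrite /g.
  have h' : (c (nk k) xi)%:E @[k --> \oo] --> (limn (fun k => c (nk k) xi))%:E.
    by apply: cvg_EFin; [near=> k|exact: h].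
  by rewrite is_cvg_limn_esupE; [rewrite (cvg_lim _ h')|apply/cvg_ex; eexists; exact: h'].
exists g => // m.
have mcm k : measurable_fun setT (fun xi => ((c (nk k) xi - c m xi) ^+ 2)%:E).
  by apply/measurable_EFinP; apply: measurable_funX; exact: measurable_funB.
pose L xi := limn_einf (fun k => ((c (nk k) xi - c m xi) ^+ 2)%:E).
have mgc : measurable_fun setT (fun xi => ((g xi - c m xi) ^+ 2)%:E).
  by apply/measurable_EFinP; apply: measurable_funX; exact: measurable_funB.
have mL : measurable_fun setT L by exact: measurable_limn_einf.
have E : (\int[mu]_xi ((g xi - c m xi) ^+ 2)%:E = \int[mu]_xi L xi)%E.
  apply: (@ge0_ae_eq_integral _ _ R mu setT _ L) => //.
  - by move=> x _; rewrite lee_fin sqr_ge0.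
  - move=> x _; rewrite /L limn_einf_lim; apply: lime_ge; first exact: is_cvg_einfs.
    by apply: nearW => n; apply: le_ereal_inf_tmp => _ [k _ <-]; rewrite lee_fin sqr_ge0.
  - apply: filterS (integrable_ae measurableT iS) => xi /(_ I) /glim h _.
    have h' : ((c (nk k) xi - c m xi) ^+ 2)%:E @[k --> \oo] --> ((g xi - c m xi) ^+ 2)%:E.
      apply: cvg_EFin; first by near=> k.
      have h2 : c (nk k) xi - c m xi @[k --> \oo] --> g xi - c m xi.
        by apply: cvgB => //; exact: cvg_cst.
      have := @continuous_cvg _ _ _ _ _ _ (fun y : R => y ^+ 2) _ (@exprn_continuous R 2 _) h2.
      by apply.
    by rewrite /L is_cvg_limn_einfE; [rewrite (cvg_lim _ h')|apply/cvg_ex; eexists; exact: h'].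
rewrite E; apply: (le_trans (fatou mu measurableT mcm _)).
  by move=> n x _; rewrite lee_fin sqr_ge0.
apply: (limn_einf_le (m := m)) => k mk; apply: hb.
by rewrite (leq_trans mk).
Unshelve. all: by end_near.
Qed.
End riesz_fischer.

(** * Fourier transforms of square-integrable functions *)

Section fourier_L2.
Context {R : realType}.
Notation mu := (@lebesgue_measure R).
Implicit Types (f : R -> R) (g h : R -> R[i]) (x y xi delta : R).

(** The squared modulus, kept as a polynomial in the real and imaginary parts
so that no square root appears under integrals. *)
Definition sqnormc h xi : R := complex.Re (h xi) ^+ 2 + complex.Im (h xi) ^+ 2.

Lemma sqnormc_ge0 h xi : 0 <= sqnormc h xi.
Proof. by rewrite addr_ge0// sqr_ge0. Qed.

Lemma normc_sqr (z : R[i]) : ComplexField.Normc.normc z ^+ 2 = complex.Re z ^+ 2 + complex.Im z ^+ 2.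
Proof. by case: z => a b /=; rewrite sqr_sqrtr// addr_ge0// sqr_ge0. Qed.

Lemma normc_ge0 (z : R[i]) : 0 <= ComplexField.Normc.normc z.
Proof. by case: z => a b /=; exact: sqrtr_ge0. Qed.

Lemma L2norm_root h : (L2norm h = (\int[mu]_xi (sqnormc h xi)%:E) `^ 2^-1)%E.
Proof.
rewrite /L2norm unlock; congr (_ `^ _)%E; apply: eq_integral => xi _ /=.
by congr EFin; rewrite powR_mulrn// ger0_norm ?normc_ge0// normc_sqr.
Qed.

Lemma int_sqnormc_ge0 h : (0 <= \int[mu]_xi (sqnormc h xi)%:E)%E.
Proof. by apply: integral_ge0 => xi _; rewrite lee_fin sqnormc_ge0. Qed.

Lemma L2norm_sqr h : ((L2norm h) `^ 2 = \int[mu]_xi (sqnormc h xi)%:E)%E.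
Proof.
by rewrite L2norm_root -poweRrM mulVf// poweRe1// int_sqnormc_ge0.
Qed.

Lemma L2norm_le h (e : R) : 0 <= e ->
  ((L2norm h <= e%:E) <-> (\int[mu]_xi (sqnormc h xi)%:E <= (e ^+ 2)%:E))%E.
Proof.
move=> e0; split => H.
  rewrite -L2norm_sqr -powR_mulrn// -poweR_EFin.
  apply: gt0_ler_poweR => //; rewrite in_itv/= ?leey ?andbT ?lee_fin//.
  by rewrite /L2norm Lnorm_ge0.
rewrite L2norm_root [leRHS](_ : _ = ((e ^+ 2)%:E `^ 2^-1)%E); last first.
  by rewrite poweR_EFin -powR_mulrn// -powRrM mulfV// powRr1.
apply: gt0_ler_poweR => //; rewrite in_itv/= ?leey ?andbT ?lee_fin ?sqr_ge0//.
exact: int_sqnormc_ge0.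
Qed.

Lemma ge0_cvge0P (T : Type) (F : set_system T) {FF : Filter F} (u : T -> \bar R) :
  (forall n, 0 <= u n)%E ->
  (u n @[n --> F] --> (0 : \bar R)%E) <-> (forall e : R, 0 < e -> \forall n \near F, (u n <= e%:E)%E).
Proof.
move=> u0; split.
  move=> /fine_cvgP[ufin /cvgr0Pnorm_le H] e e0.
  near=> n.
  have fn : u n \is a fin_num by near: n.
  rewrite -(fineK fn) lee_fin (le_trans (ler_norm _))//.
  by near: n; exact: H.
move=> H; apply/fine_cvgP; split.
  apply: filterS (H 1 ltr01) => n un.
  by rewrite ge0_fin_numE// (le_lt_trans un)// ltry.
apply/cvgr0Pnorm_le => e e0; apply: filterS (H e e0) => n un /=.
rewrite ger0_norm ?fine_ge0// -lee_fin fineK//.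
by rewrite ge0_fin_numE// (le_lt_trans un)// ltry.
Unshelve. all: by end_near. Qed.

Lemma L2norm_cvg0P (T : Type) (F : set_system T) {FF : Filter F} (h : T -> R -> R[i]) :
  (L2norm (h n) @[n --> F] --> (0 : \bar R)%E) <->
  (forall e : R, 0 < e -> \forall n \near F, (\int[mu]_xi (sqnormc (h n) xi)%:E <= e%:E)%E).
Proof.
rewrite ge0_cvge0P; last by move=> n; rewrite /L2norm Lnorm_ge0.
split => H e e0.
  have s0 : 0 < Num.sqrt e by rewrite sqrtr_gt0.
  apply: filterS (H _ s0) => n h1.
  by have := (L2norm_le (h n) (ltW s0)).1 h1; rewrite sqr_sqrtr// ltW.
apply: filterS (H (e ^+ 2) _) => [n|]; last exact: exprn_gt0.
by move=> h2; apply/L2norm_le => //; exact: ltW.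
Qed.

(** Membership in L^2 in terms of ordinary integrability of the square, the
form in which it is used throughout. *)
Lemma Lfun2P f : f \in Lfun mu 2%:E <->
  measurable_fun setT f /\ mu.-integrable setT (EFin \o (fun x => f x ^+ 2)).
Proof.
split => [h|[mf i2]].
  split; last exact: Lfun2_integrable_sqr.
  by move: h => /andP[]; rewrite inE.
rewrite inE/=; apply/andP; split; rewrite inE//=.
rewrite /finite_norm unlock poweR_lty//.
move/integrableP : i2 => [_]; apply: le_lt_trans.
apply: ge0_le_integral_nomeas => x _; first exact: poweR_ge0.
by rewrite [leLHS](_ : _ = (`|f x| `^ 2)%:E)// powR_mulrn// lee_fin real_normK ?num_real// ler_norm.
Qed.

(** Truncations of an L^2 function to bounded intervals are integrable, so
that their Fourier transform is given by integrals. *)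
Definition trunc f n x : R := if `|x| <= n%:R then f x else 0.

Lemma truncE f n : trunc f n = f \_ `[- n%:R, n%:R].
Proof.
apply/funext => x; rewrite /trunc /patch.
rewrite [x \in _](_ : _ = (`|x| <= n%:R))//.
by apply/idP/idP; rewrite inE/= in_itv/= -ler_norml.
Qed.

Lemma measurable_trunc f n : measurable_fun setT f -> measurable_fun setT (trunc f n).
Proof.
move=> mf; rewrite truncE; apply/(measurable_restrictT f) => //.
exact: measurable_funTS.
Qed.

Lemma L1_sqr_trunc f n : measurable_fun setT f ->
  mu.-integrable setT (EFin \o (fun x => f x ^+ 2)) ->
  mu.-integrable setT (EFin \o trunc f n).
Proof.
move=> mf i2; have mt := measurable_trunc n mf.
have io : mu.-integrable setT (EFin \o (trunc (cst 1) n)).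
  apply: L1_eq (@integrable_indic_itv R (- n%:R) n%:R true false) => x.
  by rewrite truncE indicE /patch; case: (x \in _).
apply: (L1_dom (g := fun x => trunc (cst 1) n x + f x ^+ 2)) => //; last exact: L1D.
move=> x; rewrite /trunc; case: ifP => _ /=.
  have := sqr_ge0 (`|f x| - 1); rewrite -(real_normK (num_real (f x))).
  by move: `|f x| => a; clear; nra.
by rewrite normr0 add0r sqr_ge0.
Qed.

Lemma L1_trunc_sqr f n : measurable_fun setT f ->
  mu.-integrable setT (EFin \o (fun x => f x ^+ 2)) ->
  mu.-integrable setT (EFin \o (fun x => trunc f n x ^+ 2)).
Proof.
move=> mf i2; apply: (L1_dom (g := fun x => f x ^+ 2)) => //.
  by apply: measurable_funX; exact: measurable_trunc.
move=> x; rewrite /trunc; case: ifP => _; first by rewrite ger0_norm// sqr_ge0.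
by rewrite expr0n normr0 sqr_ge0.
Qed.

Lemma truncated_fourierE f n xi : mu.-integrable setT (EFin \o trunc f n) ->
  complex.Re (truncated_fourier n f xi) = cosft (trunc f n) xi /\
  complex.Im (truncated_fourier n f xi) = - sinft (trunc f n) xi.
Proof.
move=> it; rewrite /truncated_fourier /cintegral /=; split.
  rewrite Rintegral_mkcond /cosft; apply: Rint_eq => x.
  rewrite truncE /patch; case: ifP => _ /=; last by rewrite mulr0.
  by rewrite cosN mulr0 subr0.
rewrite Rintegral_mkcond /sinft -[RHS]mulN1r -RintZ; last exact: integrable_sin_mul.
apply: Rint_eq => x.
rewrite truncE /patch; case: ifP => _ /=; last by rewrite !mulr0.
by rewrite sinN mulr0 add0r; ring.
Qed.

Lemma tail_sqr_cvg0 f : measurable_fun setT f ->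
  mu.-integrable setT (EFin \o (fun x => f x ^+ 2)) ->
  2 * pi * \int[mu]_x (f x - trunc f n x) ^+ 2 @[n --> \oo] --> (0 : R).
Proof.
move=> mf i2.
rewrite -[X in _ --> X](mulr0 (2 * pi)); apply: cvgMl_tmp.
have E n : \int[mu]_x (f x - trunc f n x) ^+ 2 =
    \int[mu]_x (f x ^+ 2) - \int[mu]_(x in `[- n%:R, n%:R]) (f x ^+ 2).
  rewrite [X in _ - X]Rintegral_mkcond -RintB//.
    apply: Rint_eq => x; rewrite truncE /patch; case: ifP => _ /=.
      by rewrite !subrr expr0n.
    by rewrite !subr0.
  apply: L1_eq (L1_trunc_sqr n mf i2) => x; rewrite truncE /patch; case: ifP => _ //=.
  by rewrite expr0n.
under eq_fun do rewrite E.
rewrite -(subrr (\int[mu]_x (f x ^+ 2))); apply: cvgB; first exact: cvg_cst.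
have := cvg_Rintegral_trunc measurableT i2.
by under eq_fun do rewrite setTI.
Qed.

Lemma L1_tail_sqr f n : measurable_fun setT f ->
  mu.-integrable setT (EFin \o (fun x => f x ^+ 2)) ->
  mu.-integrable setT (EFin \o (fun x => (f x - trunc f n x) ^+ 2)).
Proof.
move=> mf i2; apply: (L1_dom (g := fun x => f x ^+ 2)) => //.
  by apply: measurable_funX; apply: measurable_funB => //; exact: measurable_trunc.
move=> x; rewrite ger0_norm ?sqr_ge0// /trunc; case: ifP => _; last by rewrite subr0.
by rewrite subrr expr0n sqr_ge0.
Qed.

Lemma cosftB (f1 f2 : R -> R) xi : mu.-integrable setT (EFin \o f1) -> mu.-integrable setT (EFin \o f2) ->
  cosft (fun x => f1 x - f2 x) xi = cosft f1 xi - cosft f2 xi.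
Proof.
move=> i1 i2; rewrite /cosft -(RintB (integrable_cos_mul xi i1) (integrable_cos_mul xi i2)).
by apply: Rint_eq => x; rewrite mulrBr.
Qed.

Lemma sinftB (f1 f2 : R -> R) xi : mu.-integrable setT (EFin \o f1) -> mu.-integrable setT (EFin \o f2) ->
  sinft (fun x => f1 x - f2 x) xi = sinft f1 xi - sinft f2 xi.
Proof.
move=> i1 i2; rewrite /sinft -(RintB (integrable_sin_mul xi i1) (integrable_sin_mul xi i2)).
by apply: Rint_eq => x; rewrite mulrBr.
Qed.

Lemma L1_sqr_close (a b : R -> R) : measurable_fun setT a -> measurable_fun setT b ->
  (\int[mu]_xi ((a xi - b xi) ^+ 2)%:E < +oo)%E -> (\int[mu]_xi (b xi ^+ 2)%:E < +oo)%E ->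
  mu.-integrable setT (EFin \o (fun x => a x ^+ 2)).
Proof.
move=> ma mb hab hb.
have mab : measurable_fun setT (fun x => (a x - b x) ^+ 2).
  by apply: measurable_funX; exact: measurable_funB.
have mb2 : measurable_fun setT (fun x => b x ^+ 2) by exact: measurable_funX.
have iab : mu.-integrable setT (EFin \o (fun x => (a x - b x) ^+ 2)).
  apply/integrableP; split; first exact/measurable_EFinP.
  by under eq_integral do rewrite /= ger0_norm ?sqr_ge0//.
have ib : mu.-integrable setT (EFin \o (fun x => b x ^+ 2)).
  apply/integrableP; split; first exact/measurable_EFinP.
  by under eq_integral do rewrite /= ger0_norm ?sqr_ge0//.
apply: (L1_dom (g := fun x => 2 * (a x - b x) ^+ 2 + 2 * b x ^+ 2)).
- exact: measurable_funX.
- move=> x; rewrite ger0_norm ?sqr_ge0//.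
  have := sqr_ge0 (a x - 2 * b x); move: (a x) (b x) => p q; clear; nra.
- by apply: L1D; exact: L1Z.
Qed.

(** Existence part of Plancherel's theorem: the transforms of the truncations
are Cauchy in L^2 by Plancherel's inequality, hence converge by completeness.
Real and imaginary parts are treated separately. *)
Lemma fourier_exists f : f \in Lfun mu 2%:E -> exists g, is_fourier f g.
Proof.
move=> /Lfun2P[mf i2].
pose b n := 2 * pi * \int[mu]_x (f x - trunc f n x) ^+ 2.
have b0 : b n @[n --> \oo] --> (0 : R) by exact: tail_sqr_cvg0.
have it n := L1_sqr_trunc n mf i2.
have it2 n := L1_trunc_sqr n mf i2.
have dif m n : (m <= n)%N ->
   (\int[mu]_xi ((cosft (trunc f n) xi - cosft (trunc f m) xi) ^+ 2 +
     (sinft (trunc f n) xi - sinft (trunc f m) xi) ^+ 2)%:E <= (b m)%:E)%E.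
  move=> mn; pose d x := trunc f n x - trunc f m x.
  have id : mu.-integrable setT (EFin \o d) by exact: L1B.
  have dle x : d x ^+ 2 <= (f x - trunc f m x) ^+ 2.
    rewrite /d /trunc; case: (leP `|x| m%:R) => xm.
      by rewrite (le_trans xm) ?ler_nat// subrr.
    by case: ifP => _; rewrite !subr0// expr0n sqr_ge0.
  have id2 : mu.-integrable setT (EFin \o (fun x => d x ^+ 2)).
    apply: L1_dom (L1_tail_sqr m mf i2).
      by apply: measurable_funX; exact: L1_measurable.
    by move=> x; rewrite ger0_norm ?sqr_ge0.
  have := plancherel_le id id2.
  under eq_integral => xi _ do rewrite cosftB// sinftB//.
  move=> /le_trans; apply; rewrite lee_fin /b ler_wpM2l//.
    by rewrite mulr_ge0// pi_ge0.
  by apply: Rint_le => //; exact: L1_tail_sqr.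
have mC n := measurable_cosft (it n); have mS n := measurable_sinft (it n).
have difC m n : (m <= n)%N ->
   (\int[mu]_xi ((cosft (trunc f n) xi - cosft (trunc f m) xi) ^+ 2)%:E <= (b m)%:E)%E.
  move=> mn; apply: le_trans (dif _ _ mn).
  by apply: ge0_le_integral_nomeas => xi _; rewrite lee_fin ?sqr_ge0// lerDl sqr_ge0.
have difS m n : (m <= n)%N ->
   (\int[mu]_xi ((sinft (trunc f n) xi - sinft (trunc f m) xi) ^+ 2)%:E <= (b m)%:E)%E.
  move=> mn; apply: le_trans (dif _ _ mn).
  by apply: ge0_le_integral_nomeas => xi _; rewrite lee_fin ?sqr_ge0// lerDr sqr_ge0.
have [g1 mg1 hg1] := riesz_fischer mC b0 difC.
have [g2 mg2 hg2] := riesz_fischer mS b0 difS.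
have fin0 := plancherel_le (it 0%N) (it2 0%N).
have finC : (\int[mu]_xi (cosft (trunc f 0) xi ^+ 2)%:E < +oo)%E.
  apply: (@le_lt_trans _ _ (2 * pi * \int[mu]_x trunc f 0 x ^+ 2)%:E); last exact: ltry.
  apply: le_trans fin0.
  by apply: ge0_le_integral_nomeas => xi _; rewrite lee_fin ?sqr_ge0// lerDl sqr_ge0.
have finS : (\int[mu]_xi (sinft (trunc f 0) xi ^+ 2)%:E < +oo)%E.
  apply: (@le_lt_trans _ _ (2 * pi * \int[mu]_x trunc f 0 x ^+ 2)%:E); last exact: ltry.
  apply: le_trans fin0.
  by apply: ge0_le_integral_nomeas => xi _; rewrite lee_fin ?sqr_ge0// lerDr sqr_ge0.
exists (fun xi => (g1 xi +i* - g2 xi)%C); split.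
- apply/Lfun2P; split; first exact: mg1.
  apply: (L1_sqr_close mg1 (mC 0%N)); first by rewrite (le_lt_trans (hg1 _))// ltry.
  exact: finC.
- apply/Lfun2P; split; first exact: measurable_funN.
  have : mu.-integrable setT (EFin \o (fun x => g2 x ^+ 2)).
    apply: (L1_sqr_close mg2 (mS 0%N)); first by rewrite (le_lt_trans (hg2 _))// ltry.
    exact: finS.
  by apply: L1_eq => x /=; rewrite sqrrN.
- apply/L2norm_cvg0P => e e0.
  have e20 : 0 < e / 2 by rewrite divr_gt0.
  move/cvgr0Pnorm_le : b0 => /(_ _ e20); apply: filterS => n bn.
  have E : (\int[mu]_xi (sqnormc (truncated_fourier n f \- (fun xi => (g1 xi +i* - g2 xi)%C)) xi)%:E =
     \int[mu]_xi ((g1 xi - cosft (trunc f n) xi) ^+ 2)%:E +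
     \int[mu]_xi ((g2 xi - sinft (trunc f n) xi) ^+ 2)%:E)%E.
    rewrite -ge0_integralD//=.
    + apply: eq_integral => xi _; rewrite -EFinD /sqnormc; congr EFin.
      have [E1 E2] := truncated_fourierE xi (it n).
      rewrite [complex.Re _](_ : _ = complex.Re (truncated_fourier n f xi) - g1 xi); last first.
        by rewrite /=; case: (truncated_fourier n f xi).
      rewrite [complex.Im _](_ : _ = complex.Im (truncated_fourier n f xi) + g2 xi); last first.
        by rewrite /=; case: (truncated_fourier n f xi) => ? ? /=; rewrite opprK.
      by rewrite E1 E2; ring.
    + by move=> x _; rewrite lee_fin sqr_ge0.
    + by apply/measurable_EFinP; apply: measurable_funX; exact: mfB.
    + by move=> x _; rewrite lee_fin sqr_ge0.
    + by apply/measurable_EFinP; apply: measurable_funX; exact: mfB.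
  rewrite E (le_trans (leeD (hg1 n) (hg2 n)))// -EFinD lee_fin.
  by move: bn => /(le_trans (ler_norm _)) => h; rewrite (splitr e) lerD.
Qed.

End fourier_L2.

(** * Fourier inversion *)

Section inversion.
Context {R : realType}.
Notation mu := (@lebesgue_measure R).
Implicit Types (f : R -> R) (g h : R -> R[i]) (x y xi delta : R).

Lemma ReB (z w : R[i]) : complex.Re (z - w) = complex.Re z - complex.Re w.
Proof. by case: z; case: w. Qed.
Lemma ImB (z w : R[i]) : complex.Im (z - w) = complex.Im z - complex.Im w.
Proof. by case: z; case: w. Qed.

Lemma fourier_parts f g : is_fourier f g ->
  [/\ measurable_fun setT (complex.Re (R := R) \o g), measurable_fun setT (complex.Im (R := R) \o g),
   mu.-integrable setT (EFin \o (fun xi => complex.Re (g xi) ^+ 2)) &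
   mu.-integrable setT (EFin \o (fun xi => complex.Im (g xi) ^+ 2))].
Proof. by move=> [/Lfun2P[h1 h2] /Lfun2P[h3 h4] _]. Qed.

Lemma L1_decay_L2 delta (a : R -> R) : 0 < delta -> measurable_fun setT a ->
  mu.-integrable setT (EFin \o (fun xi => a xi ^+ 2)) ->
  mu.-integrable setT (EFin \o (fun xi => decay delta xi * `|a xi|)).
Proof.
move=> d0 ma ia.
have md : measurable_fun setT (decay delta).
  by apply: continuous_measurable_fun; exact: continuous_decay.
apply: (L1_dom (g := fun xi => decay delta xi + a xi ^+ 2)).
- by apply: mfM => //; exact: measurableT_comp.
- move=> xi; have := decay_ge0 delta xi; have := decay_le1 xi d0.
  rewrite normrM normr_id -(real_normK (num_real (a xi))) (ger0_norm (decay_ge0 _ _)).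
  have := normr_ge0 (a xi); move: (decay _ _) `|a xi| => d e e0 d1 d0'.
  have h1 : 0 <= d * (1 - d) by rewrite mulr_ge0// subr_ge0.
  have h2 := sqr_ge0 (d - e); move: h1 h2; clear; nra.
- by apply: L1D => //; exact: integrable_decay.
Qed.

(** The real part of exp(i x xi) (a + i b)(xi), the integrand of the inverse
Fourier transform of a real function. *)
Definition fourier_synthesis (a b : R -> R) x xi : R := a xi * cos (x * xi) - b xi * sin (x * xi).

Lemma measurable_fourier_synthesis a b x : measurable_fun setT a -> measurable_fun setT b ->
  measurable_fun setT (fourier_synthesis a b x).
Proof.
move=> ma mb; apply: mfB; apply: mfM => //.
  exact: measurable_cos_lin.
exact: measurable_sin_lin.
Qed.

Lemma sin_max1 (x : R) : `|sin x| <= 1.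
Proof. by rewrite ler_norml sin_geN1 sin_le1. Qed.

Lemma fourier_synthesis_le a b x xi : `|fourier_synthesis a b x xi| <= `|a xi| + `|b xi|.
Proof.
rewrite /fourier_synthesis (le_trans (ler_normB _ _))// lerD// normrM ler_piMr//.
  exact: cos_max.
exact: sin_max1.
Qed.

Lemma L1_sqr_mul_poisson (f : R -> R) d x : 0 < d -> measurable_fun setT f ->
  mu.-integrable setT (EFin \o (fun y => f y ^+ 2)) ->
  mu.-integrable setT (EFin \o (fun y => f y * poisson d (x - y))).
Proof.
move=> d0 mf i2; have ip := integrable_poisson x d0.
apply: (L1_dom (g := fun y => d^-1 * poisson d (x - y) + f y ^+ 2)).
- by apply: mfM => //; exact: L1_measurable ip.
- move=> y; have p0 := poisson_ge0 (x - y) d0.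
  rewrite normrM [X in _ * X]ger0_norm// -(real_normK (num_real (f y))).
  have pd : poisson d (x - y) <= d^-1.
    rewrite /poisson ler_pdivrMr ?poisson_den_gt0// mulrDr expr2 mulrA mulVf ?gt_eqF// mul1r.
    by rewrite lerDl mulr_ge0 ?sqr_ge0// invr_ge0 ltW.
  move: p0 pd (normr_ge0 (f y)); move: (poisson _ _) `|f y| (d^-1) => p e dv p0 pd e0.
  have h1 : 0 <= p * (dv - p) by rewrite mulr_ge0// subr_ge0.
  have h2 := sqr_ge0 (e - p); have h3 : 0 <= e * p by rewrite mulr_ge0.
  move: h1 h2 h3; clear; nra.
- by apply: L1D => //; exact: L1Z.
Qed.

(** Pass to the limit in the damped inversion formula for the truncations: the
left-hand side converges because the Poisson kernel is square integrable, the
right-hand side because the damping is square integrable and the transforms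
converge in L^2. *)
Lemma damped_inversion f g delta x : f \in Lfun mu 2%:E -> is_fourier f g -> 0 < delta ->
  \int[mu]_y (f y * (2 * poisson delta (x - y))) =
  \int[mu]_xi (decay delta xi * fourier_synthesis (complex.Re (R := R) \o g) (complex.Im (R := R) \o g) x xi).
Proof.
move=> /Lfun2P[mf i2] fg d0; have [ma mb ia ib] := fourier_parts fg.
set a := (X in fourier_synthesis X _); set b := (X in fourier_synthesis _ X).
have it n := L1_sqr_trunc n mf i2.
have md : measurable_fun setT (decay delta).
  by apply: continuous_measurable_fun; exact: continuous_decay.
have iab1 := L1_decay_L2 d0 ma ia; have iab2 := L1_decay_L2 d0 mb ib.
have iR : mu.-integrable setT (EFin \o (fun xi => decay delta xi * fourier_synthesis a b x xi)).
  apply: (L1_dom (g := fun xi => decay delta xi * `|a xi| + decay delta xi * `|b xi|)).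
  - by apply: mfM => //; exact: measurable_fourier_synthesis.
  - move=> xi; rewrite normrM (ger0_norm (decay_ge0 _ _)) -mulrDr ler_wpM2l ?decay_ge0//.
    exact: fourier_synthesis_le.
  - exact: L1D.
have if2 : mu.-integrable setT (EFin \o (fun y => f y * (2 * poisson delta (x - y)))).
  apply: L1_eq (L1Z 2 (L1_sqr_mul_poisson x d0 mf i2)) => y.
  by rewrite mulrCA.
pose u n := \int[mu]_y (trunc f n y * (2 * poisson delta (x - y))).
have u1 : u n @[n --> \oo] --> \int[mu]_y (f y * (2 * poisson delta (x - y))).
  have := cvg_Rintegral_trunc measurableT if2.
  rewrite (_ : (fun n => _) = u)//; apply/funext => n.
  rewrite setTI Rintegral_mkcond /u; apply: Rint_eq => y.
  by rewrite truncE /patch; case: ifP => _ //; rewrite mul0r.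
have u2 : u n @[n --> \oo] --> \int[mu]_xi (decay delta xi * fourier_synthesis a b x xi).
  apply/cvgrPdist_le => e e0.
  (* k balances the two terms of d p <= k d / 2 + p^2 / (2 k), integrated against
     the damping, whose integral is 2 / delta. *)
  pose k := e * delta / 4.
  have k0 : 0 < k by rewrite divr_gt0// mulr_gt0.
  have ke0 : 0 < k * e by rewrite mulr_gt0.
  have [_ _ /L2norm_cvg0P /(_ _ ke0)] := fg; apply: filterS => n hn.
  pose ca := cosft (trunc f n); pose cb := sinft (trunc f n).
  have mca : measurable_fun setT ca := measurable_cosft (it n).
  have mcb : measurable_fun setT cb := measurable_sinft (it n).
  have un : u n = \int[mu]_xi (decay delta xi * (cos (x * xi) * ca xi + sin (x * xi) * cb xi)).
    exact: poisson_fourier.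
  pose S xi := (ca xi - a xi) ^+ 2 + (- cb xi - b xi) ^+ 2.
  have mS : measurable_fun setT S.
    apply: mfD; apply: measurable_funX; apply: mfB => //.
    exact: measurable_funN.
  have S0 xi : 0 <= S xi by rewrite addr_ge0// sqr_ge0.
  have SE : (\int[mu]_xi (S xi)%:E <= (k * e)%:E)%E.
    apply: le_trans hn; apply: ge0_le_integral_nomeas => xi _; first by rewrite lee_fin.
    rewrite lee_fin /sqnormc /S.
    have [E1 E2] := truncated_fourierE xi (it n).
    rewrite [(_ \- _) xi]/(truncated_fourier n f xi - g xi) ReB ImB.
    by rewrite E1 E2.
  have iS : mu.-integrable setT (EFin \o S).
    apply/integrableP; split; first exact/measurable_EFinP.
    under eq_integral do rewrite /= ger0_norm//.
    by rewrite (le_lt_trans SE)// ltry.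
  have SE' : \int[mu]_xi S xi <= k * e.
    by rewrite -lee_fin /Rintegral fineK//; exact: (integrable_fin_num measurableT iS).
  have iu : mu.-integrable setT (EFin \o (fun xi => decay delta xi * (cos (x * xi) * ca xi + sin (x * xi) * cb xi))).
    pose N1 := \int[mu]_y `|trunc f n y|.
    apply: (L1_dom (g := fun xi => 2 * N1 * decay delta xi)).
    - apply: mfM => //; apply: mfD; apply: mfM => //.
        exact: measurable_cos_lin.
      exact: measurable_sin_lin.
    - move=> xi; rewrite normrM (ger0_norm (decay_ge0 _ _)) mulrC ler_wpM2r ?decay_ge0//.
      rewrite (le_trans (ler_normD _ _))// mulr_natl mulr2n lerD// normrM.
        by rewrite -[leRHS]mul1r ler_pM ?cos_max// normr_cosft.
      by rewrite -[leRHS]mul1r ler_pM ?sin_max1 ?normr_sinft.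
    - by apply: L1Z; exact: integrable_decay.
  rewrite un -(RintB iR iu).
  apply: (@le_trans _ _ (\int[mu]_xi (k * decay delta xi + (2 * k)^-1 * S xi))).
    apply: normr_Rintegral_dom => //; last first.
      by apply: L1D; apply: L1Z => //; exact: integrable_decay.
    move=> xi _; rewrite -mulrBr normrM (ger0_norm (decay_ge0 _ _)).
    set w := (X in `|X|).
    have wE : w = - (ca xi - a xi) * cos (x * xi) + (- cb xi - b xi) * sin (x * xi).
      by rewrite /w /fourier_synthesis; ring.
    have wle : `|w| <= `|ca xi - a xi| + `|- cb xi - b xi|.
      rewrite wE (le_trans (ler_normD _ _))// lerD// normrM ?normrN ler_piMr//.
        exact: cos_max.
      exact: sin_max1.
    apply: (@le_trans _ _ (decay delta xi * (`|ca xi - a xi| + `|- cb xi - b xi|))).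
      by rewrite ler_wpM2l ?decay_ge0.
    rewrite /S -(real_normK (num_real (ca xi - a xi))) -(real_normK (num_real (- cb xi - b xi))).
    have := decay_ge0 delta xi; have := decay_le1 xi d0.
    move: (decay _ _) `|ca xi - a xi| `|- cb xi - b xi| (normr_ge0 (ca xi - a xi)) (normr_ge0 (- cb xi - b xi)) => d p q p0 q0 d1 d00.
    clear -d00 d1 p0 q0 k0.
    have kv : k * (2 * k)^-1 = 2^-1 by field; rewrite gt_eqF.
    have kv0 : 0 < (2 * k)^-1 by rewrite invr_gt0 mulr_gt0.
    move: ((2 * k)^-1) kv kv0 => m km m0.
    have key z : 0 <= z -> d * z <= k * d / 2 + m * z ^+ 2.
      move=> z0; have : 0 <= m * (z - k * d) ^+ 2 by rewrite mulr_ge0 ?sqr_ge0// ltW.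
      rewrite (_ : m * _ = m * z ^+ 2 - 2 * (k * m) * (d * z) + (k * m) * (k * d * d)); last by ring.
      rewrite km => h.
      have h2 : k * d * d <= k * d by rewrite ler_piMr// mulr_ge0// ltW.
      move: h h2; move: (m * z ^+ 2) (d * z) (k * d * d) (k * d) => A B C D h h2; lra.
    have := key p p0; have := key q q0; rewrite !mulrDr.
    move: (d * p) (d * q) (k * d) (m * p ^+ 2) (m * q ^+ 2) => A B C D E; lra.
  rewrite RintD; [|by apply: L1Z; exact: integrable_decay|exact: L1Z].
  rewrite RintZ ?RintZ ?Rintegral_decay//; last exact: integrable_decay.
  have kv : k * (2 / delta) = e / 2 by rewrite /k; field; rewrite gt_eqF.
  rewrite kv [leRHS](splitr e) lerD2l ler_pdivrMl ?mulr_gt0// (le_trans SE')//.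
  by rewrite le_eqVlt; apply/orP; left; apply/eqP; field.
by have <- := cvg_lim _ u2; [have <- := cvg_lim _ u1|].
Qed.

(** Poisson kernels of shrinking width concentrate at x. Away from x they are
at most their width times a multiple of the fixed kernel of width one, against
which f is integrable. *)
Lemma approx_identity f x : f \in Lfun mu 2%:E -> {for x, continuous f} ->
  \int[mu]_y (f y * poisson n.+1%:R^-1 (x - y)) @[n --> \oo] --> pi * f x.
Proof.
move=> /Lfun2P[mf i2] cf.
apply/cvgrPdist_le => e e0.
have pi0 : 0 < pi :> R by exact: pi_gt0.
pose e1 := e / (2 * pi); have e10 : 0 < e1 by rewrite divr_gt0// mulr_gt0.
have /cvgrPdist_le /(_ _ e10) := cf.
move=> [rho /= rho0 Hrho].
have fclose y : `|x - y| < rho -> `|f x - f y| <= e1 by move=> h; apply: Hrho.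
pose q y : R := poisson 1 (x - y).
have iq : mu.-integrable setT (EFin \o q) by exact: integrable_poisson.
have q0 y : 0 <= q y by exact: poisson_ge0.
have mq : measurable_fun setT q := L1_measurable iq.
have ifq : mu.-integrable setT (EFin \o (fun y => `|f y| * q y)).
  apply: L1_eq (integrable_norm (L1_sqr_mul_poisson x ltr01 mf i2)) => y.
  transitivity `|f y * q y|; first by [].
  by rewrite normrM [X in _ * X]ger0_norm.
(* At distance at least rho from x the two kernels compare by this constant. *)
pose C := 1 + rho^-1 ^+ 2.
have C0 : 0 < C by rewrite ltr_pwDl ?sqr_ge0.
pose I1 := \int[mu]_y (`|f y| * q y + `|f x| * q y).
have I10 : 0 <= I1.
  by apply: Rintegral_ge0 => y _; rewrite addr_ge0// mulr_ge0.
near=> n.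
pose d : R := n.+1%:R^-1.
have d0 : 0 < d by rewrite invr_gt0.
have dsmall : d * (C * I1) <= e / 2.
  rewrite /d ler_pdivrMl// [leRHS]mulrC -ler_pdivrMl ?divr_gt0//.
  apply: (@le_trans _ _ n%:R); last by rewrite ler_nat.
  by near: n; exact: nbhs_infty_ger.
have ip := integrable_poisson x d0.
have mp := L1_measurable ip.
have far y : rho <= `|x - y| -> poisson d (x - y) <= d * (C * q y).
  move=> h; have xy0 : 0 < (x - y) ^+ 2.
    by rewrite -(real_normK (num_real _)) exprn_gt0// (lt_le_trans rho0).
  rewrite /q poisson1E /poisson ler_wpM2l ?(ltW d0)//.
  rewrite -[leLHS]mul1r ler_pdivrMr ?poisson_den_gt0// -mulrA mulrCA ler_pdivlMl; last first.
    by rewrite ltr_pwDl ?sqr_ge0.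
  rewrite mulr1 /C mulrDl mul1r.
  have h2 : 1 <= rho^-1 ^+ 2 * (x - y) ^+ 2.
    rewrite -exprMn -(real_normK (num_real _)) normrM (ger0_norm (_ : 0 <= rho^-1)); last by rewrite invr_ge0 ltW.
    by rewrite exprn_ege1// mulrC ler_pdivlMr// mul1r.
  have h3 := sqr_ge0 d; have h4 : 0 <= rho^-1 ^+ 2 * d ^+ 2 by rewrite mulr_ge0 ?sqr_ge0.
  move: h2 h3 h4; rewrite (mulrDr (rho^-1 ^+ 2)); move: (rho^-1 ^+ 2 * (x - y) ^+ 2) (rho^-1 ^+ 2 * d ^+ 2) (d ^+ 2) ((x - y) ^+ 2) => A B E F; clear; lra.
have ptw y : `|f x * poisson d (x - y) - f y * poisson d (x - y)| <=
    e1 * poisson d (x - y) + d * C * (`|f y| * q y + `|f x| * q y).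
  have p0 := poisson_ge0 (x - y) d0.
  rewrite -mulrBl normrM (ger0_norm p0).
  have r0 : 0 <= d * C * (`|f y| * q y + `|f x| * q y).
    have A (z : R) : 0 <= `|z| * q y := mulr_ge0 (normr_ge0 z) (q0 y).
    have dC : 0 <= d * C by rewrite mulr_ge0 // ltW.
    exact: (mulr_ge0 dC (addr_ge0 (A _) (A _))).
  have [h|h] := ltP `|x - y| rho.
    by rewrite (@le_trans _ _ (e1 * poisson d (x - y)))// ?lerDl// ler_wpM2r// fclose.
  apply: (@le_trans _ _ ((`|f x| + `|f y|) * (d * (C * q y)))).
    rewrite ler_pM//; first exact: ler_normB.
    exact: far.
  have -> : (`|f x| + `|f y|) * (d * (C * q y)) = d * C * (`|f y| * q y + `|f x| * q y).
    have alg (a b k p z : R) : (a + b) * (k * (p * z)) = k * p * (b * z + a * z) by ring.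
    exact: alg.
  by rewrite lerDr mulr_ge0 ?(ltW e10).
have ifx : mu.-integrable setT (EFin \o (fun y => f x * poisson d (x - y))) by exact: L1Z.
have ifd : mu.-integrable setT (EFin \o (fun y => `|f y| * q y + `|f x| * q y)).
  by apply: L1D => //; exact: L1Z.
have ibd : mu.-integrable setT (EFin \o (fun y => e1 * poisson d (x - y) + d * C * (`|f y| * q y + `|f x| * q y))).
  by apply: L1D; apply: L1Z.
have idf : mu.-integrable setT (EFin \o (fun y => f x * poisson d (x - y) - f y * poisson d (x - y))).
  by apply: (L1_dom _ ptw ibd); apply: mfB; apply: mfM.
have ify : mu.-integrable setT (EFin \o (fun y => f y * poisson d (x - y))).
  by apply: L1_eq (L1B ifx idf) => y; rewrite opprB addrCA subrr addr0.
have -> : pi * f x = \int[mu]_y (f x * poisson d (x - y)).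
  by rewrite (RintZ _ ip) Rintegral_poisson// mulrC.
rewrite -(RintB ifx ify).
apply: (le_trans (normr_Rintegral_dom measurableT (fun y _ => ptw y) ibd)).
rewrite (RintD (L1Z _ ip) (L1Z _ ifd)) (RintZ _ ip) (RintZ _ ifd) Rintegral_poisson//.
rewrite [leRHS](splitr e) lerD//.
  by rewrite /e1 le_eqVlt; apply/orP; left; apply/eqP; move: pi pi0 => p p0; field; rewrite gt_eqF.
by rewrite -mulrA.
Unshelve. all: by end_near. Qed.

(** Let the damping tend to one in the damped inversion formula: dominated
convergence on the frequency side, approximate identity on the space side. *)
Lemma inversion f g x : f \in Lfun mu 2%:E -> is_fourier f g -> {for x, continuous f} ->
  mu.-integrable setT (EFin \o (complex.Re (R := R) \o g)) ->
  mu.-integrable setT (EFin \o (complex.Im (R := R) \o g)) ->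
  2 * pi * f x = \int[mu]_xi fourier_synthesis (complex.Re (R := R) \o g) (complex.Im (R := R) \o g) x xi.
Proof.
move=> Lf fg cf ia ib.
set a := (X in fourier_synthesis X _); set b := (X in fourier_synthesis _ X).
have ma := L1_measurable ia; have mb := L1_measurable ib.
have A := approx_identity Lf cf.
have iab : mu.-integrable setT (EFin \o (fun xi => `|a xi| + `|b xi|)).
  by apply: L1D; exact: integrable_norm.
have B : \int[mu]_xi (decay n.+1%:R^-1 xi * fourier_synthesis a b x xi) @[n --> \oo] --> \int[mu]_xi fourier_synthesis a b x xi.
  have mfs := measurable_fourier_synthesis x ma mb.
  have ifs : mu.-integrable setT (EFin \o fourier_synthesis a b x).
    by apply: (L1_dom _ _ iab) => // xi; exact: fourier_synthesis_le.
  have md n : measurable_fun setT (fun xi => decay n.+1%:R^-1 xi * fourier_synthesis a b x xi).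
    apply: mfM; last exact: mfs.
    by apply: continuous_measurable_fun; exact: continuous_decay.
  have md' n : measurable_fun setT (fun xi => (decay n.+1%:R^-1 xi * fourier_synthesis a b x xi)%:E).
    exact/measurable_EFinP.
  apply: fine_cvg; rewrite fineK; last exact: (integrable_fin_num measurableT ifs).
  apply: (@dominated_cvg _ _ _ mu _ measurableT
    (fun n xi => (decay n.+1%:R^-1 xi * fourier_synthesis a b x xi)%:E) (EFin \o fourier_synthesis a b x) (EFin \o (fun xi => `|a xi| + `|b xi|))) => //.
  - move=> xi _; apply: cvg_EFin; first by apply: nearW.
    rewrite -[X in _ --> X]mul1r; apply: cvgMr_tmp; exact: cvg_decay.
  - move=> n xi _ /=; rewrite lee_fin normrM (ger0_norm (decay_ge0 _ _)).
    rewrite (@le_trans _ _ `|fourier_synthesis a b x xi|) ?fourier_synthesis_le// ler_piMl//.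
    by rewrite decay_le1.
have E n : \int[mu]_xi (decay n.+1%:R^-1 xi * fourier_synthesis a b x xi) =
    2 * \int[mu]_y (f y * poisson n.+1%:R^-1 (x - y)).
  have d0 : 0 < n.+1%:R^-1 :> R by rewrite invr_gt0.
  have /Lfun2P[mf i2] := Lf.
  rewrite -(damped_inversion x Lf fg d0).
  have i1 := L1_sqr_mul_poisson x d0 mf i2.
  by rewrite -(RintZ _ i1); apply: Rint_eq => y; ring.
have B' : 2 * \int[mu]_y (f y * poisson n.+1%:R^-1 (x - y)) @[n --> \oo] --> \int[mu]_xi fourier_synthesis a b x xi.
  by move: B; under eq_fun do rewrite E.
have A' : 2 * \int[mu]_y (f y * poisson n.+1%:R^-1 (x - y)) @[n --> \oo] --> 2 * (pi * f x).
  exact: cvgMl_tmp.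
by rewrite -mulrA; have <- := cvg_lim _ A'; [have <- := cvg_lim _ B'|].
Qed.

End inversion.

(** * Sobolev embedding *)

Section sobolev.
Context {R : realType}.
Notation mu := (@lebesgue_measure R).
Implicit Types (f : R -> R) (g h : R -> R[i]) (x y xi s : R).

Definition sobolev_weight xi : R := 1 + xi ^+ 2.

Lemma sobolev_weight_ge1 xi : 1 <= sobolev_weight xi.
Proof. by rewrite lerDl sqr_ge0. Qed.

Lemma sobolev_weight_gt0 xi : 0 < sobolev_weight xi.
Proof. exact: lt_le_trans ltr01 (sobolev_weight_ge1 xi). Qed.

Lemma is_derive_sobolev_weight xi : is_derive xi 1 sobolev_weight (2 * xi).
Proof.
rewrite /sobolev_weight; apply: is_derive_eq.
by rewrite add0r /GRing.scale/=; ring.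
Qed.

Lemma is_derive_sobolev_weight_powR a xi :
  is_derive xi 1 (fun xi => sobolev_weight xi `^ a) (a * sobolev_weight xi `^ (a - 1) * (2 * xi)).
Proof.
have h1 := is_derive_sobolev_weight xi.
have h2 := is_derive1_powR a (sobolev_weight_gt0 xi).
have := @is_derive1_comp R (fun x => x `^ a) sobolev_weight xi _ _ h2 h1.
by [].
Qed.

Lemma continuous_sobolev_weight_powR a : continuous (fun xi => sobolev_weight xi `^ a).
Proof.
move=> xi; apply/differentiable_continuous/derivable1_diffP.
by have [] := is_derive_sobolev_weight_powR a xi.
Qed.

Lemma cvg_sobolev_weight_powR a : 0 < a -> sobolev_weight xi `^ (- a) @[xi --> +oo] --> 0.
Proof.
move=> a0; apply/cvgrPdist_le => e e0.
near=> xi.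
have xi1 : 1 <= xi by near: xi; apply: nbhs_pinfty_ge; rewrite num_real.
rewrite sub0r normrN ger0_norm ?powR_ge0// powRN invf_ple ?posrE ?powR_gt0 ?sobolev_weight_gt0//.
have : (e^-1) `^ a^-1 <= sobolev_weight xi.
  apply: (@le_trans _ _ xi).
    by near: xi; apply: nbhs_pinfty_ge; rewrite num_real.
  rewrite /sobolev_weight expr2; have : xi * 1 <= xi * xi by rewrite ler_wpM2l// (le_trans ler01).
  by rewrite mulr1; lra.
move=> h; have := @ge0_ler_powR _ a (ltW a0) _ _ _ _ h.
rewrite !nnegrE powR_ge0 (ltW (sobolev_weight_gt0 _)) => /(_ isT isT).
by rewrite -powRrM mulVf ?gt_eqF// powRr1// invr_ge0 ltW.
Unshelve. all: by end_near. Qed.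

(** Compare, for xi >= 1, with the derivative of - (1 + xi^2)^(1/2 - p), whose
integral telescopes, and with a Poisson kernel near zero. *)
Lemma integrable_sobolev_weight p : 2^-1 < p ->
  mu.-integrable setT (EFin \o (fun xi => sobolev_weight xi `^ (- p))).
Proof.
move=> p2; pose th := p - 2^-1; have th0 : 0 < th by rewrite subr_gt0.
pose F xi := - (sobolev_weight xi `^ (- th)).
pose dF xi := th * sobolev_weight xi `^ (- th - 1) * (2 * xi).
have dFE xi : is_derive xi 1 F (dF xi).
  have h := is_derive_sobolev_weight_powR (- th) xi.
  have := @is_deriveN _ _ _ _ _ _ _ h.
  by rewrite /dF !mulNr opprK.
have cdF : continuous dF.
  move=> xi; apply: cvgM; last by apply: cvgM; [exact: cvg_cst|exact: cvg_id].
  by apply: cvgM; [exact: cvg_cst|exact: continuous_sobolev_weight_powR].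
have dF0 xi : 0 <= xi -> 0 <= dF xi.
  by move=> x0; rewrite !mulr_ge0// ?powR_ge0// ltW.
have Fl : F xi @[xi --> +oo] --> 0.
  by rewrite -oppr0; apply: cvgN; exact: cvg_sobolev_weight_powR.
have iF := ge0_integral_halfline dFE cdF dF0 Fl.
have idF : mu.-integrable `[0, +oo[ (EFin \o dF).
  apply/integrableP; split.
    apply/measurable_EFinP; apply: measurable_funTS; exact: continuous_measurable_fun.
  have -> : (\int[mu]_(x in `[0%R, +oo[) `|(EFin \o dF) x| = \int[mu]_(x in `[0%R, +oo[) (dF x)%:E)%E.
    apply: eq_integral => x /set_mem/=; rewrite in_itv/= andbT => x0.
    by rewrite ger0_norm// dF0.
  by rewrite iF ltry.
have cm := @continuous_sobolev_weight_powR (- p).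
have em : (fun xi => sobolev_weight xi `^ (- p)) =1 (fun xi => sobolev_weight xi `^ (- p)) \o -%R.
  by move=> xi /=; rewrite /sobolev_weight sqrrN.
apply: (proj1 (even_halfline cm cm em em _ _)).
  by move=> x; rewrite ger0_norm ?powR_ge0.
apply: (@integrable_dom _ _ _ (fun xi => th^-1 * dF xi + 2 * poisson 1 (0 - xi))) => //.
- by apply: measurable_funTS; exact: continuous_measurable_fun.
- move=> xi; rewrite /= in_itv/= andbT => x0; rewrite ger0_norm ?powR_ge0//.
  rewrite sub0r poissonN poisson1E.
  have E : th^-1 * dF xi = 2 * xi * sobolev_weight xi `^ (- th - 1).
    rewrite /dF -mulrA mulKf ?gt_eqF//; ring.
  rewrite E; have w0 := sobolev_weight_gt0 xi; have w1 := sobolev_weight_ge1 xi.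
  have [x1|x1] := leP 1 xi.
    have -> : sobolev_weight xi `^ (- p) = sobolev_weight xi `^ 2^-1 * sobolev_weight xi `^ (- th - 1).
      rewrite -powRD; last by rewrite (gt_eqF w0) implybT.
      by congr powR; rewrite /th; field.
    have w2 : 0 <= 2 / (1 + xi ^+ 2) by rewrite divr_ge0// ltW.
    rewrite -[leLHS]addr0; apply: lerD => //; apply: ler_wpM2r; first exact: powR_ge0.
    rewrite (powR12_sqrt (ltW w0)) -[leRHS]ger0_norm ?mulr_ge0// -sqrtr_sqr ler_wsqrtr//.
    by rewrite /sobolev_weight; nra.
  have : sobolev_weight xi `^ (- p) <= 1.
    by rewrite powRN invf_le1 ?powR_gt0// -[leLHS](powRr0 (sobolev_weight xi)) ler_powR// ltW// (lt_trans _ p2)// invr_gt0.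
  move=> h; rewrite (le_trans h)//.
  have h2 : 1 <= 2 * (sobolev_weight xi)^-1.
    by rewrite -ler_pdivrMr ?invr_gt0// invrK mul1r /sobolev_weight; nra.
  by rewrite -[leLHS]add0r lerD// mulr_ge0 ?powR_ge0// mulr_ge0.
- have ip0 := L1Z 2 (integrable_poisson (0 : R) ltr01).
  have ip : mu.-integrable `[0, +oo[ (EFin \o (fun x => 2 * poisson 1 (0 - x))).
    by apply: integrableS ip0.
  have idF' : mu.-integrable `[0, +oo[ (EFin \o (fun x => th^-1 * dF x)).
    by exact: (integrableZl _ th^-1 idF).
  by exact: (integrableD _ idF' ip).
Qed.

Definition sobolev_const s : R := 2 * \int[mu]_xi (sobolev_weight xi `^ (1 - s)).

(** Cauchy-Schwarz in pointwise form: with P = (1 + xi^2)^((1 - s)/2) and Q =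
(1 + xi^2)^(s/2), both 1 and |xi| are at most P Q, and P Q |a| <= P^2 + Q^2
a^2. The first term is integrable when s > 3/2, the second one by definition
of the Sobolev norm. *)
Lemma weight_split s a xi : `|a| <= sobolev_weight xi `^ (1 - s) + sobolev_weight xi `^ s * a ^+ 2 /\
  `|xi * a| <= sobolev_weight xi `^ (1 - s) + sobolev_weight xi `^ s * a ^+ 2.
Proof.
have w0 := sobolev_weight_gt0 xi; have w1 := sobolev_weight_ge1 xi.
pose P := sobolev_weight xi `^ ((1 - s) / 2); pose Q := sobolev_weight xi `^ (s / 2).
have P0 : 0 <= P by exact: powR_ge0.
have Q0 : 0 <= Q by exact: powR_ge0.
have EP : sobolev_weight xi `^ (1 - s) = P ^+ 2.
  by rewrite -powR_mulrn// -powRrM; congr powR; field.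
have EQ : sobolev_weight xi `^ s = Q ^+ 2.
  by rewrite -powR_mulrn// -powRrM; congr powR; field.
have PQ : P * Q = Num.sqrt (sobolev_weight xi).
  rewrite -powR12_sqrt ?ltW// -powRD; last by rewrite (gt_eqF w0) implybT.
  by congr powR; field.
have key : P * Q * `|a| <= sobolev_weight xi `^ (1 - s) + sobolev_weight xi `^ s * a ^+ 2.
  rewrite EP EQ -(real_normK (num_real a)).
  move: (normr_ge0 a); move: `|a| P0 Q0; clear; move: P Q => P Q e P0 Q0 e0.
  have h1 := sqr_ge0 (P - Q * e); have h2 : 0 <= P * (Q * e) by rewrite !mulr_ge0.
  rewrite -mulrA -exprMn; move: h1 h2; nra.
split; apply: le_trans key.
- by rewrite ler_peMl// PQ -[leLHS]sqrtr1 ler_wsqrtr.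
- by rewrite normrM ler_wpM2r// PQ -sqrtr_sqr ler_wsqrtr// lerDr.
Qed.

(** For s > 3/2 the Fourier transform stays integrable after multiplication by
xi, so the inversion formula can be differentiated once. The constants depend
on s and on a bound of the norm only. *)
Lemma sobolev s f (N : R) : 3 / 2 < s -> 0 <= N -> f \in Lfun mu 2%:E -> continuous f ->
  (Hs_norm s f <= N%:E)%E ->
  exists df : R -> R, [/\ continuous df, forall x, is_derive x 1 f (df x),
    forall x, `|f x| <= sobolev_const s + N ^+ 2 &
    forall x, `|df x| <= sobolev_const s + N ^+ 2].
Proof.
move=> s32 N0 Lf cf hN.
have fg : is_fourier f (fourier f) by apply: xgetPex; exact: fourier_exists.
have [ma mb ia2 ib2] := fourier_parts fg.
pose a := complex.Re (R := R) \o fourier f; pose b := complex.Im (R := R) \o fourier f.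
have {}ma : measurable_fun setT a by [].
have {}mb : measurable_fun setT b by [].
pose W xi := sobolev_weight xi `^ s * (a xi ^+ 2 + b xi ^+ 2).
have W0 xi : 0 <= W xi by rewrite mulr_ge0 ?powR_ge0// addr_ge0 ?sqr_ge0.
have mW : measurable_fun setT W.
  apply: mfM; last by apply: mfD; exact: measurable_funX.
  by apply: continuous_measurable_fun; exact: continuous_sobolev_weight_powR.
have IW : (\int[mu]_xi (W xi)%:E <= (N ^+ 2)%:E)%E.
  move/L2norm_le : hN => /(_ N0); apply: le_trans; apply: ge0_le_integral_nomeas => xi _.
    by rewrite lee_fin.
  rewrite lee_fin /W /a /b /sqnormc /=; case: (fourier f xi) => p q /=.
  rewrite !mul0r subr0 addr0.
  have -> : sobolev_weight xi `^ s = (sobolev_weight xi `^ (s / 2)) ^+ 2.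
    by rewrite -powR_mulrn ?powR_ge0// -powRrM; congr powR; field.
  by rewrite !exprMn -mulrDr.
have iW : mu.-integrable setT (EFin \o W).
  apply/integrableP; split; first exact/measurable_EFinP.
  under eq_integral do rewrite /= ger0_norm//.
  by rewrite (le_lt_trans IW)// ltry.
have IW' : \int[mu]_xi W xi <= N ^+ 2.
  by rewrite -lee_fin /Rintegral fineK//; exact: (integrable_fin_num measurableT iW).
pose m xi := sobolev_weight xi `^ (1 - s).
have im : mu.-integrable setT (EFin \o m).
  have h : 2^-1 < s - 1 by lra.
  by apply: L1_eq (integrable_sobolev_weight h) => xi; rewrite /m opprB.
have imW : mu.-integrable setT (EFin \o (fun xi => 2 * m xi + W xi)).
  by apply: L1D => //; exact: L1Z.
have ImW : \int[mu]_xi (2 * m xi + W xi) <= sobolev_const s + N ^+ 2.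
  by rewrite (RintD (L1Z 2 im) iW) (RintZ 2 im) lerD2l.
have wab xi : `|a xi| + `|b xi| <= 2 * m xi + W xi.
  have [+ _] := weight_split s (a xi) xi; have [+ _] := weight_split s (b xi) xi.
  by rewrite /W -/(m xi); move: (m xi) (_ `^ s) `|a xi| `|b xi| => A B C D; lra.
have wab' xi : `|xi * a xi| + `|xi * b xi| <= 2 * m xi + W xi.
  have [_ +] := weight_split s (a xi) xi; have [_ +] := weight_split s (b xi) xi.
  by rewrite /W -/(m xi); move: (m xi) (_ `^ s) `|xi * a xi| `|xi * b xi| => A B C D; lra.
have ia : mu.-integrable setT (EFin \o a).
  by apply: (L1_dom ma _ imW) => xi; rewrite (le_trans _ (wab xi))// lerDl.
have ib : mu.-integrable setT (EFin \o b).
  by apply: (L1_dom mb _ imW) => xi; rewrite (le_trans _ (wab xi))// lerDr.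
have fE x : f x = (2 * pi)^-1 * \int[mu]_xi fourier_synthesis a b x xi.
  rewrite -(inversion Lf fg (cf x) ia ib) mulKf//.
  by rewrite gt_eqF// mulr_gt0// pi_gt0.
pose a' xi := - (xi * b xi); pose b' xi := xi * a xi.
have mid : measurable_fun setT (fun xi : R => xi) by exact: measurable_id.
have ma' : measurable_fun setT a' by apply: measurable_funN; exact: mfM.
have mb' : measurable_fun setT b' by exact: mfM.
have fs1 x xi : `|fourier_synthesis a b x xi| <= 2 * m xi + W xi.
  exact: le_trans (fourier_synthesis_le _ _ _ _) (wab xi).
have fs2 x xi : `|fourier_synthesis a' b' x xi| <= 2 * m xi + W xi.
  by rewrite (le_trans (fourier_synthesis_le _ _ _ _))// /a' normrN addrC wab'.
have is1 x : mu.-integrable setT (EFin \o fourier_synthesis a b x).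
  by apply: (L1_dom _ (fs1 x) imW); exact: measurable_fourier_synthesis.
have is2 x : mu.-integrable setT (EFin \o fourier_synthesis a' b' x).
  by apply: (L1_dom _ (fs2 x) imW); exact: measurable_fourier_synthesis.
have c0 : (0 <= (2 * pi)^-1 :> R) && ((2 * pi)^-1 <= 1 :> R).
  have := @pi_ge2 R; move: pi => p p2.
  by rewrite invr_ge0 invf_le1; lra.
have bnd (v : R -> R) : (forall xi, `|v xi| <= 2 * m xi + W xi) ->
    `|(2 * pi)^-1 * \int[mu]_xi v xi| <= sobolev_const s + N ^+ 2.
  move=> hv; case/andP : c0 => c0 c1.
  rewrite normrM (ger0_norm c0) (le_trans _ ImW)//.
  rewrite -[leRHS]mul1r ler_pM//.
  exact: normr_Rintegral_dom.
have dfs x xi : is_derive x 1 (fun x => fourier_synthesis a b x xi) (fourier_synthesis a' b' x xi).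
  rewrite /fourier_synthesis; apply: is_derive_eq.
  by rewrite /a' /b' /GRing.scale/=; ring.
exists (fun x => (2 * pi)^-1 * \int[mu]_xi fourier_synthesis a' b' x xi); split.
- move=> x; apply: cvgM; first exact: cvg_cst.
  have := @continuity_under_integral R _ _ mu (fun x => fourier_synthesis a' b' x) setT measurableT (x - 1) (x + 1) _ _
    (fun xi => 2 * m xi + W xi) imW.
  apply.
  + by move=> z _; exact: is2.
  + apply: nearW => xi _ z _.
    apply: cvgB; apply: cvgM; try exact: cvg_cst.
      apply: continuous_comp; [|exact: continuous_cos].
      by apply: cvgM; [exact: cvg_id|exact: cvg_cst].
    apply: continuous_comp; [|exact: continuous_sin].
    by apply: cvgM; [exact: cvg_id|exact: cvg_cst].
  + by move=> z _; apply: nearW => xi _; exact: fs2.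
  + by rewrite inE/= in_itv/= ltrBlDr ltrDl ltr01.
- move=> x.
  have h := @is_derive_integral R setT (fourier_synthesis a b) (fourier_synthesis a' b') (fun xi => 2 * m xi + W xi)
    measurableT is1 (fun x y _ => dfs x y) imW.
  have h' := h (fun xi => le_trans (normr_ge0 _) (fs1 0 xi)) (fun x y _ => fs2 x y) x.
  have -> : f = (fun x => (2 * pi)^-1 * \int[mu]_xi fourier_synthesis a b x xi) by apply/funext.
  by apply: is_derive_eq; rewrite /GRing.scale/=; ring.
- by move=> x; rewrite fE; exact: bnd.
- by move=> x; exact: bnd.
Qed.

End sobolev.

(** * Decay profiles and convolution estimates *)

Section profiles.
Context {R : realType}.
Notation mu := (@lebesgue_measure R).
Implicit Types (x y z r : R).

(** The two spatial profiles of the proof: u decays like tail2 and the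
nonlinear term like tail3. *)
Definition tail2 x : R := (1 + x ^+ 2)^-1.
Definition tail3 x : R := (1 + `|x| ^+ 3)^-1.

Lemma tail2_den x : 0 < 1 + x ^+ 2.
Proof. by rewrite ltr_pwDl ?sqr_ge0. Qed.

Lemma tail3_den x : 0 < 1 + `|x| ^+ 3.
Proof. by rewrite ltr_pwDl ?exprn_ge0. Qed.

Lemma tail2_gt0 x : 0 < tail2 x. Proof. by rewrite invr_gt0 tail2_den. Qed.
Lemma tail3_gt0 x : 0 < tail3 x. Proof. by rewrite invr_gt0 tail3_den. Qed.
Lemma tail2_ge0 x : 0 <= tail2 x. Proof. exact/ltW/tail2_gt0. Qed.
Lemma tail3_ge0 x : 0 <= tail3 x. Proof. exact/ltW/tail3_gt0. Qed.
Lemma tail2_le1 x : tail2 x <= 1.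
Proof. by rewrite invf_le1 ?tail2_den// lerDl sqr_ge0. Qed.

Lemma tail3_le_tail2 x : tail3 x <= 2 * tail2 x.
Proof.
rewrite -[leLHS]mul1r ler_pdivrMr ?tail3_den// -mulrA mulrCA mulrC -ler_pdivrMr ?tail2_gt0// invrK mul1r.
rewrite -(real_normK (num_real x)); move: (normr_ge0 x); move: `|x| => a a0.
have [h|h] := leP a 1; nra.
Qed.

Lemma sqr_tail2_le_tail3 x : tail2 x ^+ 2 <= tail3 x.
Proof.
rewrite /tail2 /tail3 exprVn lef_pV2 ?posrE ?tail3_den ?exprn_gt0 ?tail2_den//.
rewrite -(real_normK (num_real x)); move: (normr_ge0 x); move: `|x| => a a0.
have := sqr_ge0 (a ^+ 2 - a); have := sqr_ge0 a; nra.
Qed.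

(** Elementary source of all convolution estimates: when c <= k (a + b), a
product of two decaying factors 1/a and 1/b is at most k/c times their sum. *)
Lemma inv_split (k a b c : R) : 0 < a -> 0 < b -> 0 < c -> c <= k * (a + b) ->
  a^-1 * b^-1 <= k * c^-1 * (a^-1 + b^-1).
Proof.
move=> a0 b0 c0 h.
have -> : k * c^-1 * (a^-1 + b^-1) = (a^-1 * b^-1) * (k * (a + b) / c).
  by field; rewrite !gt_eqF.
have ab0 : 0 <= a^-1 * b^-1 by rewrite mulr_ge0 ?invr_ge0 ?ltW.
by rewrite ler_peMr// ler_pdivlMr// mul1r.
Qed.

Lemma tail2_split x y : tail2 (x - y) * tail2 y <= 4 * tail2 x * (tail2 (x - y) + tail2 y).
Proof.
apply: inv_split; rewrite ?tail2_den//.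
have := sqr_ge0 (x - 2 * y); have := sqr_ge0 y; nra.
Qed.

Lemma tail3_split x y : tail3 (x - y) * tail3 y <= 8 * tail3 x * (tail3 (x - y) + tail3 y).
Proof.
apply: inv_split; rewrite ?tail3_den//.
have : `|x| <= `|x - y| + `|y| by rewrite -{1}(subrK y x) ler_normD.
move: `|x - y| `|y| `|x| (normr_ge0 x) (normr_ge0 y) (normr_ge0 (x - y)) => p q a a0 q0 p0 h.
have h3 : a ^+ 3 <= (p + q) ^+ 3 by rewrite lerXn2r ?nnegrE ?addr_ge0.
have h4 : 0 <= (p + q) * (p - q) ^+ 2 by rewrite mulr_ge0 ?addr_ge0 ?sqr_ge0.
have h5 : (p + q) ^+ 3 = 4 * (p ^+ 3 + q ^+ 3) - 3 * ((p + q) * (p - q) ^+ 2) by ring.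
have p3 : 0 <= p ^+ 3 by rewrite exprn_ge0.
have tail3' : 0 <= q ^+ 3 by rewrite exprn_ge0.
lra.
Qed.

(** The constant is uniform in the width r, so the bound also covers small
times, when the kernel concentrates. *)
Lemma poisson_tail2_split (b r x y : R) : 0 < r <= b ->
  poisson r (x - y) * tail2 y <= 2 * (1 + b) * tail2 x * (poisson r (x - y) + tail2 y).
Proof.
move=> /andP[r0 rb]; have rn : r != 0 by rewrite gt_eqF.
have d0 := poisson_den_gt0 (x - y) r0.
have E : poisson r (x - y) = (r^-1 * (r ^+ 2 + (x - y) ^+ 2))^-1.
  by rewrite /poisson invfM invrK.
rewrite E; apply: inv_split; rewrite ?tail2_den ?mulr_gt0 ?invr_gt0//.
have -> : 2 * (1 + b) * (r^-1 * (r ^+ 2 + (x - y) ^+ 2) + (1 + y ^+ 2)) =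
    r^-1 * (2 * (1 + b) * (r ^+ 2 + (x - y) ^+ 2 + r * (1 + y ^+ 2))) by field.
rewrite ler_pdivlMl//; move: (x - y) (subrK y x) => z <- {x E d0 rn}.
have := sqr_ge0 (z - y); have := sqr_ge0 z; have := sqr_ge0 y; have := sqr_ge0 r.
rewrite (_ : (z + y) ^+ 2 = 2 * z ^+ 2 + 2 * y ^+ 2 - (z - y) ^+ 2); last by ring.
move: (z ^+ 2) (y ^+ 2) (r ^+ 2) ((z - y) ^+ 2) => Z Y Q W q0 y0 z0 w0.
have h1 : 0 <= (b - r) * Z by rewrite mulr_ge0// subr_ge0.
have h2 : 0 <= b * Q by rewrite mulr_ge0// ltW// (lt_le_trans r0).
have h3 : 0 <= r * Y by rewrite mulr_ge0// ltW.
have h4 : 0 <= b * (r * Y) by rewrite mulr_ge0// ltW// (lt_le_trans r0).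
have h5 : 0 <= b * r by rewrite mulr_ge0// ltW// (lt_le_trans r0).
have h6 : 0 <= r * W by rewrite mulr_ge0// ltW.
move: h1 h2 h3 h4 h5 h6; nra.
Qed.

Lemma cvg0_tail2 (k : R) (F : R -> R) (s : nat -> R) : (forall n, `|s n| = n%:R) ->
  (forall y, `|F y| <= k * tail2 y) -> F (s n) @[n --> \oo] --> 0.
Proof.
move=> hs hF; apply/cvgrPdist_le => e e0; near=> n.
rewrite sub0r normrN (le_trans (hF _))// ler_pdivrMr ?tail2_den//.
rewrite -(real_normK (num_real (s n))) hs mulrC -ler_pdivrMr//.
apply: (@le_trans _ _ n%:R); first by near: n; exact: nbhs_infty_ger.
have := sqr_ge0 (n%:R - 1 : R); have : 0 <= n%:R :> R by []; nra.
Unshelve. all: by end_near. Qed.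

Lemma tail2E x : tail2 x = poisson 1 x. Proof. by rewrite poisson1E. Qed.

Lemma integrable_tail2B x : mu.-integrable setT (EFin \o (fun y => tail2 (x - y))).
Proof. by apply: L1_eq (integrable_poisson x ltr01) => y; rewrite tail2E. Qed.

Lemma Rintegral_tail2B x : \int[mu]_y tail2 (x - y) = pi.
Proof. by rewrite -(Rintegral_poisson x ltr01); apply: Rint_eq => y; rewrite tail2E. Qed.

Lemma tail2N x : tail2 (- x) = tail2 x. Proof. by rewrite /tail2 sqrrN. Qed.

Lemma integrable_tail2 : mu.-integrable setT (EFin \o tail2).
Proof. by apply: L1_eq (integrable_tail2B 0) => y; rewrite sub0r tail2N. Qed.

Lemma Rintegral_tail2 : \int[mu]_y tail2 y = pi.
Proof. by rewrite -(Rintegral_tail2B 0); apply: Rint_eq => y; rewrite sub0r tail2N. Qed.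

Lemma integrable_tail2_pair k x :
  mu.-integrable setT (EFin \o (fun y => k * (tail2 (x - y) + tail2 y))).
Proof. by apply: L1Z; apply: L1D; [exact: integrable_tail2B|exact: integrable_tail2]. Qed.

Lemma Rintegral_tail2_pair k x : \int[mu]_y (k * (tail2 (x - y) + tail2 y)) = k * (2 * pi).
Proof.
rewrite RintZ; last by apply: L1D; [exact: integrable_tail2B|exact: integrable_tail2].
rewrite RintD; [|exact: integrable_tail2B|exact: integrable_tail2].
by rewrite Rintegral_tail2B Rintegral_tail2 mulr_natl mulr2n.
Qed.

Lemma integrable_poisson_tail2_pair k r x : 0 < r ->
  mu.-integrable setT (EFin \o (fun y => k * (poisson r (x - y) + tail2 y))).
Proof. by move=> r0; apply: L1Z; apply: L1D; [exact: integrable_poisson|exact: integrable_tail2]. Qed.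

Lemma Rintegral_poisson_tail2_pair k r x : 0 < r ->
  \int[mu]_y (k * (poisson r (x - y) + tail2 y)) = k * (2 * pi).
Proof.
move=> r0; rewrite RintZ; last by apply: L1D; [exact: integrable_poisson|exact: integrable_tail2].
rewrite RintD; [|exact: integrable_poisson|exact: integrable_tail2].
by rewrite Rintegral_poisson// Rintegral_tail2 mulr_natl mulr2n.
Qed.

End profiles.

Section convolutions.
Context {R : realType}.
Notation mu := (@lebesgue_measure R).
Variable eta : R.
Hypothesis eta_gt0 : 0 < eta.

(** The uniformity as r tends to zero is what the a priori estimate needs at
small times. *)
Lemma linear_decay (b M : R) : 0 < b -> 0 <= M -> exists2 C : R, 0 <= C &
  forall (r : R) (v : R -> R) x, 0 < r <= b -> (forall y, `|v y| <= M * tail2 y) ->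
    `|convolution (K eta (r ^+ 3)) v x| <= C * tail2 x.
Proof.
move=> b0 M0; have [C C0 HC] := K_bound eta_gt0 b.
exists (C * M * (2 * (1 + b)) * (2 * pi)) => [|r v x rb hv].
  by rewrite !mulr_ge0 ?pi_ge0 ?addr_ge0// ltW.
have r0 : 0 < r by case/andP : rb.
rewrite (_ : _ * tail2 x = (C * M * (2 * (1 + b)) * tail2 x) * (2 * pi)); last by ring.
rewrite -(Rintegral_poisson_tail2_pair _ x r0).
apply: (normr_Rintegral_dom measurableT) => [y _|]; last exact: integrable_poisson_tail2_pair.
rewrite normrM (le_trans (ler_pM _ _ (HC r (x - y) rb) (hv y)))//.
have := poisson_tail2_split x y rb.
move: (poisson _ _) (tail2 y) (tail2 x) => p q qx h.
have := ler_wpM2l (mulr_ge0 C0 M0) h.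
by rewrite !mulrA [C * p * M]mulrAC.
Qed.

(** The profile w is left free: it is taken to be tail2 + delta in the a
priori estimate and tail3 at the end. *)
Lemma nonlinear_bound (b : R) : 0 < b -> exists2 C : R, 0 <= C &
  forall (D M r : R) (w v : R -> R) x, 0 < r <= b -> 0 <= M ->
    (forall y, tail3 (x - y) * w y <= D * w x * (tail2 (x - y) + tail2 y)) ->
    (forall y, `|v y| <= M * w y) ->
    `|convolution (G eta r) v x| <= C * M * D * r ^- 2 * w x.
Proof.
move=> b0; have [C C0 HC] := G_bound eta_gt0 b.
exists (C * (2 * pi)) => [|D M r w v x rb M0 hw hv].
  by rewrite !mulr_ge0 ?pi_ge0.
have r0 : 0 < r by case/andP : rb.
rewrite (_ : _ * w x = (C * M * r ^- 2 * (D * w x)) * (2 * pi)); last by ring.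
rewrite -(Rintegral_tail2_pair _ x).
apply: (normr_Rintegral_dom measurableT) => [y _|]; last exact: integrable_tail2_pair.
rewrite normrM (le_trans (ler_pM _ _ (HC r (x - y) rb) (hv y)))//.
have k0 : 0 <= C * M * r ^- 2 by rewrite !mulr_ge0 ?invr_ge0 ?exprn_ge0 // ltW.
have := ler_wpM2l k0 (hw y); rewrite /tail3.
by move: (r ^- 2) (_^-1) => A B; rewrite !mulrA => h; apply: le_trans h; rewrite le_eqVlt; apply/orP; left; apply/eqP; ring.
Qed.

(** Moves the derivative in the Duhamel term from the square of u, on which no
decay of derivatives is known, to the kernel. *)
Lemma integration_by_parts (r N : R) (v dv : R -> R) x : 0 < r ->
  (forall y : R, is_derive y 1 v (dv y)) -> continuous dv ->
  (forall y, `|v y| <= N) -> (forall y, `|dv y| <= N) ->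
  convolution (K eta (r ^+ 3)) dv x = convolution (G eta r) v x.
Proof.
move=> r0 vdv cdv hv hdv.
have rr : 0 < r <= r by rewrite r0 lexx.
have [C C0 HC] := K_bound eta_gt0 r.
have [C' C'0 HC'] := G_bound eta_gt0 r.
have N0 : 0 <= N := le_trans (normr_ge0 _) (hv 0).
have cv : continuous v.
  by move=> y; apply/differentiable_continuous/derivable1_diffP; have [] := vdv y.
have cB (h : R -> R) : continuous h -> continuous (fun y : R => h (x - y)).
  move=> ch y; apply: (@continuous_comp _ _ _ (fun y : R => x - y) h); last exact: ch.
  by apply: cvgB; [exact: cvg_cst|exact: cvg_id].
have cK := cB _ (continuous_K eta_gt0 r0).
have cG := cB _ (continuous_G eta_gt0 r0).
have iK : mu.-integrable setT (EFin \o (fun y => K eta (r ^+ 3) (x - y) * dv y)).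
  apply: (L1_dom (g := fun y => C * N * poisson r (x - y))).
  - by apply: mfM; exact: continuous_measurable_fun.
  - by move=> y; rewrite normrM mulrAC ler_pM// HC.
  - by apply: L1Z; exact: integrable_poisson.
have iG : mu.-integrable setT (EFin \o (fun y => G eta r (x - y) * v y)).
  apply: (L1_dom (g := fun y => C' / r ^+ 2 * N * 2 * tail2 (x - y))).
  - by apply: mfM; exact: continuous_measurable_fun.
  - move=> y; rewrite normrM.
    apply: (le_trans (ler_pM _ _ (HC' r (x - y) rr) (hv y))) => //.
    have k0 : 0 <= C' / r ^+ 2 * N by rewrite mulr_ge0// divr_ge0// exprn_ge0// ltW.
    have := ler_wpM2l k0 (tail3_le_tail2 (x - y)); rewrite /tail3.
    by rewrite !mulrA [leLHS]mulrAC.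
  - by apply: L1Z; exact: integrable_tail2B.
pose F y := K eta (r ^+ 3) (x - y) * v y.
have FE (y : R) : is_derive y 1 F (K eta (r ^+ 3) (x - y) * dv y - G eta r (x - y) * v y).
  have h1 := is_derive_K eta_gt0 (x - y) r0.
  have h2 : is_derive y 1 (fun y : R => x - y) (- 1).
    have := is_deriveB (is_derive_cst x y 1) (is_derive_id y (1 : R)).
    by rewrite sub0r.
  have h3 := @is_derive1_comp R (K eta (r ^+ 3)) (fun y => x - y) y _ _ h1 h2.
  have h4 := vdv y.
  have := @is_deriveM _ _ _ _ _ _ _ _ h3 h4.
  rewrite /F /GRing.scale/= => h5; apply: is_derive_eq.
  by rewrite /GRing.scale/=; ring.
have Fb y : `|F y| <= C * N * (2 * r + (1 + 2 * x ^+ 2) / r) * tail2 y.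
  rewrite /F normrM; apply: (le_trans (ler_pM _ _ (HC r (x - y) rr) (hv y))) => //.
  rewrite mulrAC -[leRHS]mulrA ler_wpM2l ?mulr_ge0//.
  rewrite /poisson /tail2 ler_pdivrMr ?poisson_den_gt0// mulrAC ler_pdivlMr ?tail2_den//.
  rewrite -{1}[r]mulr1 -{1}(mulfV (lt0r_neq0 r0)) -(ler_pM2l r0).
  have -> : r * ((2 * r + (1 + 2 * x ^+ 2) / r) * (r ^+ 2 + (x - y) ^+ 2)) =
     (2 * r ^+ 2 + (1 + 2 * x ^+ 2)) * (r ^+ 2 + (x - y) ^+ 2) by field; rewrite gt_eqF.
  have -> : r * (r * (r / r) * (1 + y ^+ 2)) = r ^+ 2 * (1 + y ^+ 2) by field; rewrite gt_eqF.
  have := sqr_ge0 r; move: (r ^+ 2) => Q Q0; have := sqr_ge0 (x - y).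
  have := sqr_ge0 (2 * x - y); have := sqr_ge0 x; have := sqr_ge0 Q.
  rewrite (_ : (2 * x - y) ^+ 2 = 2 * x ^+ 2 + 2 * (x - y) ^+ 2 - y ^+ 2); last by ring.
  move: (x ^+ 2) ((x - y) ^+ 2) (y ^+ 2) => X Z Y q0 x0 h z0.
  have h1 : 0 <= Q * (2 * X + 2 * Z - Y) by rewrite mulr_ge0.
  have h2 : 0 <= X * Z by rewrite mulr_ge0.
  move: h1 h2; nra.
have := FTC_line FE _ _ (cvg0_tail2 _ Fb) (cvg0_tail2 _ Fb).
rewrite RintB//; move=> h; apply/eqP; rewrite -subr_eq0; apply/eqP; apply: h.
- move=> y; apply: cvgB; apply: cvgM; [exact: cK|exact: cdv|exact: cG|exact: cv].
- exact: L1B.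
- by move=> n; rewrite ger0_norm.
- by move=> n; rewrite normrN ger0_norm.
Qed.

End convolutions.

(** * Asymptotics of the free evolution *)

Section tail_weights.
Context {R : realType}.
Implicit Types (x y e : R).

Lemma powR2D e (a : R) : 0 < a -> a `^ (2 + e) = a ^+ 2 * a `^ e.
Proof. by move=> a0; rewrite powRD ?(gt_eqF a0) ?implybT// powR_mulrn// ltW. Qed.

Lemma powR3D e (a : R) : 0 < a -> a `^ (2 + e) = a ^+ 3 * a `^ (e - 1).
Proof.
move=> a0; rewrite -powR_mulrn ?(ltW a0)// -powRD ?(gt_eqF a0) ?implybT//.
by congr powR; ring.
Qed.

Lemma tail_ge0 x e : 0 < 1 + `|x| `^ (2 + e).
Proof. by rewrite ltr_pwDl ?powR_ge0. Qed.

Lemma tail_le_tail2 y e : 0 <= e -> (1 + `|y| `^ (2 + e))^-1 <= 2 * tail2 y.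
Proof.
move=> e0; rewrite -[leLHS]mul1r ler_pdivrMr ?tail_ge0// /tail2 mulrAC ler_pdivlMr ?tail2_den// mul1r.
rewrite -(real_normK (num_real y)); have [y1|y1] := leP 1 `|y|.
  have : `|y| `^ 2%:R <= `|y| `^ (2 + e) by rewrite ler_powR// lerDl.
  by rewrite powR_mulrn//; have := sqr_ge0 `|y|; move: (`|y| ^+ 2) (_ `^ _) => *; lra.
have := powR_ge0 `|y| (2 + e); move: (_ `^ _) => p p0.
have := normr_ge0 y; move: `|y| y1 => a a1 a0; nra.
Qed.

(** With m = max 1 |y|, the hypotheses give |x| >= m; the power |x|^(e - 1) is
therefore at most m^(e - 1), which turns the extra factor 1 + |y| into an
integrable function of y. *)
Lemma tail_near x y e : 0 < e <= 1 -> 1 <= `|x| -> `|y| <= `|x| / 2 ->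
  (1 + `|y|) / `|x| ^+ 3 * (1 + `|y| `^ (2 + e))^-1 <= 4 * tail2 y / `|x| `^ (2 + e).
Proof.
move=> /andP[e0 e1] x1 yx; have x0 : 0 < `|x| := lt_le_trans ltr01 x1.
rewrite ler_pdivlMr ?powR_gt0// mulrAC ler_pdivrMr ?tail_ge0//.
rewrite /tail2 mulrAC [leRHS]mulrAC ler_pdivlMr ?tail2_den// [leRHS]mulrC.
rewrite (mulrAC ((1 + `|y|) * `|x| `^ (2 + e))) ler_pdivrMr ?exprn_gt0//.
pose m := Num.max 1 `|y|.
have m1 : 1 <= m by rewrite le_max lexx.
have ym : `|y| <= m by rewrite le_max lexx orbT.
have m0 : 0 < m := lt_le_trans ltr01 m1.
have mx : m <= `|x|.
  by rewrite ge_max x1 (le_trans yx)// ler_piMr// invf_le1// ler1n.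
have mW : m `^ (2 + e) <= 1 + `|y| `^ (2 + e).
  rewrite /m; have [h|h] := leP 1 `|y|; first by rewrite lerDr.
  by rewrite powR1 lerDl powR_ge0.
have xm : `|x| `^ (e - 1) <= m `^ (e - 1).
  rewrite -opprB !powRN lef_pV2 ?posrE ?powR_gt0//.
  by apply: ge0_ler_powR mx; rewrite ?nnegrE ?subr_ge0// ltW.
rewrite powR3D//.
have mm0 : 0 <= m `^ (e - 1) := powR_ge0 _ _.
have xx0 : 0 <= `|x| `^ (e - 1) := powR_ge0 _ _.
have x3 : 0 <= `|x| ^+ 3 by rewrite exprn_ge0.
have h1 : 1 + `|y| <= 2 * m by lra.
have h2 : 1 + y ^+ 2 <= 2 * m ^+ 2.
  rewrite -(real_normK (num_real y)).
  have : `|y| ^+ 2 <= m ^+ 2 by rewrite lerXn2r ?nnegrE ?(ltW m0).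
  have : 1 <= m ^+ 2 by rewrite exprn_ege1.
  lra.
rewrite powR3D// in mW.
apply: (@le_trans _ _ (2 * m * (`|x| ^+ 3 * m `^ (e - 1)) * (2 * m ^+ 2))).
  apply: ler_pM => //.
  - by rewrite addr_ge0// sqr_ge0.
  - by apply: ler_pM => //; rewrite ?addr_ge0 ?mulr_ge0 ?ler_wpM2l.
have := ler_wpM2l x3 mW; move: (_ `^ _) (_ ^+ 3) (_ `^ (2 + e)) => A B W; nra.
Qed.

(** Here |y| is comparable to or larger than |x|, so the decay of the datum at
y can be traded for decay in x. *)
Lemma tail_far x y e : 0 < e <= 1 -> 1 <= `|x| -> `|x| / 2 < `|y| ->
  (1 + `|y| `^ (2 + e))^-1 <= 8 / `|x| `^ (2 + e) /\
  (`|x| ^+ 2)^-1 * (1 + `|y| `^ (2 + e))^-1 <= 10 * tail2 y / `|x| `^ (2 + e).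
Proof.
move=> /andP[e0 e1] x1 yx; have x0 : 0 < `|x| := lt_le_trans ltr01 x1.
have y0 : 0 < `|y| by rewrite (lt_trans _ yx)// divr_gt0.
have xy2 : `|x| <= 2 * `|y| by move: yx; lra.
have h : `|x| `^ e <= 2 * `|y| `^ e.
  apply: (@le_trans _ _ ((2 * `|y|) `^ e)).
    by apply: ge0_ler_powR xy2; rewrite ?nnegrE ?mulr_ge0 ?ltW.
  rewrite powRM// ler_wpM2r ?powR_ge0//.
  by apply: ler1_powR => //; rewrite ler1n.
have yW : `|y| ^+ 2 * `|y| `^ e <= 1 + `|y| `^ (2 + e) by rewrite powR2D// lerDr.
have X0 : 0 <= `|x| `^ e := powR_ge0 _ _.
have Y0 : 0 <= `|y| `^ e := powR_ge0 _ _.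
have W0 := tail_ge0 y e.
have x2 : 0 < `|x| ^+ 2 by rewrite exprn_gt0.
have X2 : 0 < `|x| `^ (2 + e) by rewrite powR_gt0.
split.
  rewrite ler_pdivlMr// mulrC ler_pdivrMr// powR2D//.
  apply: (@le_trans _ _ (8 * (`|y| ^+ 2 * `|y| `^ e))); last by rewrite ler_wpM2l.
  apply: (@le_trans _ _ ((2 * `|y|) ^+ 2 * (2 * `|y| `^ e))).
    by apply: ler_pM => //; rewrite ?sqr_ge0// lerXn2r ?nnegrE ?mulr_ge0.
  by rewrite le_eqVlt; apply/orP; left; apply/eqP; ring.
rewrite -invfM -[leLHS]mul1r ler_pdivrMr ?mulr_gt0// mulrAC ler_pdivlMr// mul1r.
rewrite /tail2 mulrAC ler_pdivlMr ?tail2_den// powR2D//.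
apply: (@le_trans _ _ (`|x| ^+ 2 * (2 * `|y| `^ e) * (5 * `|y| ^+ 2))).
  apply: ler_pM => //.
  - by rewrite addr_ge0 ?sqr_ge0.
  - by rewrite ler_wpM2l// ltW.
  - rewrite -(real_normK (num_real y)); move: `|y| y0 xy2 => a a0 h2.
    have : 1 <= 2 * a by lra.
    by move=> h3; nra.
have := ler_wpM2l (ltW x2) yW; move: (_ ^+ 2 * (1 + _)) => A.
by move: (`|x| ^+ 2) (`|y| ^+ 2) (`|y| `^ e) => B C D; lra.
Qed.

End tail_weights.

Section linear_asymptotics.
Context {R : realType}.
Notation mu := (@lebesgue_measure R).
Variable eta : R.
Hypothesis eta_gt0 : 0 < eta.

(** Replace K(x - y) by its value - k / x^2 at infinity, k = eta t / pi. For
|y| <= |x| / 2 the error is O((1 + |y|) |x|^-3); for |y| > |x| / 2 the datum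
itself is small. *)
Lemma linear_asymptotics (r e c : R) (u0 : R -> R) : 0 < r -> 0 < e <= 1 -> 0 <= c ->
  continuous u0 -> (forall y, `|u0 y| <= c / (1 + `|y| `^ (2 + e))) ->
  exists2 C : R, 0 <= C & forall x, 1 <= `|x| ->
    `|convolution (K eta (r ^+ 3)) u0 x + eta * r ^+ 3 / (pi * x ^+ 2) * \int[mu]_y u0 y|
      <= C / `|x| `^ (2 + e).
Proof.
move=> r0 ee c0 cu hu.
have rr : 0 < r <= r by rewrite r0 lexx.
have [CK CK0 HK] := K_bound eta_gt0 r.
have [CA CA0 HA] := K_asymp eta_gt0 r0.
pose k := eta * r ^+ 3 / pi.
have k0 : 0 <= k by rewrite divr_ge0 ?pi_ge0// mulr_ge0 ?exprn_ge0 ?ltW.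
have kE (x : R) : eta * r ^+ 3 / (pi * x ^+ 2) = k / x ^+ 2 by rewrite /k invfM mulrA.
move: k k0 kE => k k0 kE.
pose D := c * (4 * (8 * CA + 10 * k) + 8 * CK + 10 * k).
have D0 : 0 <= D by rewrite mulr_ge0// !addr_ge0// mulr_ge0// addr_ge0// mulr_ge0.
have e0 : 0 <= e by case/andP : ee => /ltW.
have hu2 y : `|u0 y| <= 2 * c * tail2 y.
  by rewrite (le_trans (hu y))// mulrAC mulrC ler_wpM2r// tail_le_tail2.
have mu0 : measurable_fun setT u0 by exact: continuous_measurable_fun.
have iu : mu.-integrable setT (EFin \o u0).
  by apply: (L1_dom mu0 hu2); apply: L1Z; exact: integrable_tail2.
exists (D * (2 * pi)) => [|x x1]; first by rewrite mulr_ge0// mulr_ge0 ?pi_ge0.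
have x0 : 0 < `|x| := lt_le_trans ltr01 x1.
have X0 : 0 < `|x| `^ (2 + e) by rewrite powR_gt0.
have iK : mu.-integrable setT (EFin \o (fun y => K eta (r ^+ 3) (x - y) * u0 y)).
  apply: (L1_dom (g := fun y => CK * (2 * c) * poisson r (x - y))).
  - apply: mfM => //; apply: continuous_measurable_fun => y.
    apply: (@continuous_comp _ _ _ (fun y : R => x - y)); last exact: continuous_K.
    by apply: cvgB; [exact: cvg_cst|exact: cvg_id].
  - move=> y; rewrite normrM mulrAC ler_pM// ?HK// (le_trans (hu2 y))// ler_piMr ?mulr_ge0//.
    exact: tail2_le1.
  - by apply: L1Z; exact: integrable_poisson.
rewrite kE /convolution -RintZ// -RintD//; last exact: L1Z.
rewrite (_ : D * (2 * pi) / _ = D / `|x| `^ (2 + e) * (2 * pi)); last by rewrite mulrAC.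
rewrite -(Rintegral_poisson_tail2_pair _ x r0).
apply: (normr_Rintegral_dom measurableT) => [y _|]; last exact: integrable_poisson_tail2_pair.
rewrite -mulrDl.
have P0 := poisson_ge0 (x - y) r0; have Q0 := tail2_ge0 y.
have W0 := tail_ge0 y e.
have Wi0 : 0 <= (1 + `|y| `^ (2 + e))^-1 by rewrite invr_ge0 ltW.
have Xi0 : 0 <= (`|x| `^ (2 + e))^-1 by rewrite invr_ge0 ltW.
rewrite normrM; apply: (le_trans (ler_wpM2l (normr_ge0 _) (hu y))).
have [yx|yx] := leP `|y| (`|x| / 2).
  have zx : `|x| / 2 <= `|x - y|.
    have : `|x| <= `|x - y| + `|y| by rewrite -{1}(subrK y x) ler_normD.
    by move: yx; lra.
  have z0 : 0 < `|x - y| by rewrite (lt_le_trans _ zx)// divr_gt0.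
  have zn : x - y != 0 by rewrite -normr_gt0.
  have B1 : `|K eta (r ^+ 3) (x - y) + k / (x - y) ^+ 2| <= 8 * CA / `|x| ^+ 3.
    rewrite -kE (le_trans (HA _ zn))// [8 * _]mulrC -mulrA ler_wpM2l//.
    rewrite -[leLHS]mul1r ler_pdivrMr ?exprn_gt0// mulrAC ler_pdivlMr ?exprn_gt0// mul1r.
    have -> : 8 * `|x - y| ^+ 3 = (2 * `|x - y|) ^+ 3 by ring.
    by rewrite lerXn2r ?nnegrE ?mulr_ge0//; move: zx; lra.
  have B2 : `|k / x ^+ 2 - k / (x - y) ^+ 2| <= 10 * k * `|y| / `|x| ^+ 3.
    have xn : x != 0 by rewrite -normr_gt0.
    have -> : k / x ^+ 2 - k / (x - y) ^+ 2 = k * (y * (y - 2 * x)) / (x ^+ 2 * (x - y) ^+ 2).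
      by field; rewrite zn.
    rewrite !normrM (ger0_norm k0) normfV normrM !normrX.
    have h : `|y - 2 * x| <= 5 / 2 * `|x|.
      rewrite (le_trans (ler_normB _ _))// normrM [`|2|]ger0_norm//; move: yx; lra.
    rewrite ler_pdivrMr ?mulr_gt0 ?exprn_gt0// mulrAC ler_pdivlMr ?exprn_gt0//.
    have -> : k * (`|y| * `|y - 2 * x|) * `|x| ^+ 3 = k * `|y| * (`|x| ^+ 3 * `|y - 2 * x|).
      by ring.
    have -> : 10 * k * `|y| * (`|x| ^+ 2 * `|x - y| ^+ 2) = k * `|y| * (10 * (`|x| ^+ 2 * `|x - y| ^+ 2)).
      by ring.
    apply: ler_wpM2l; first by rewrite mulr_ge0.
    apply: (@le_trans _ _ (`|x| ^+ 3 * (5 / 2 * `|x|))).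
      by rewrite ler_wpM2l// exprn_ge0.
    have -> : `|x| ^+ 3 * (5 / 2 * `|x|) = `|x| ^+ 2 * (10 * (`|x| / 2) ^+ 2) by field.
    rewrite [leRHS]mulrCA ler_wpM2l ?sqr_ge0// ler_wpM2l//.
    by rewrite lerXn2r ?nnegrE// divr_ge0.
  have B : `|K eta (r ^+ 3) (x - y) + k / x ^+ 2| <= (8 * CA + 10 * k) * ((1 + `|y|) / `|x| ^+ 3).
    have -> : K eta (r ^+ 3) (x - y) + k / x ^+ 2 =
      (K eta (r ^+ 3) (x - y) + k / (x - y) ^+ 2) + (k / x ^+ 2 - k / (x - y) ^+ 2).
      by rewrite addrACA [k / (x - y) ^+ 2 - _]subrr addr0.
    rewrite (le_trans (ler_normD _ _))// (le_trans (lerD B1 B2))//.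
    rewrite -mulrDl mulrA ler_wpM2r ?invr_ge0 ?exprn_ge0//.
    have h1 : 0 <= CA * `|y| by rewrite mulr_ge0.
    rewrite -subr_ge0 (_ : _ - _ = 8 * (CA * `|y|) + 10 * k); last by ring.
    by rewrite addr_ge0// mulr_ge0.
  apply: (le_trans (ler_wpM2r _ B)); first by rewrite divr_ge0// ltW.
  have := tail_near ee x1 yx; move: B1 B2 B => _ _ _.
  set u := (_ / _ ^+ 3); set w := (_^-1); move=> h.
  have -> : (8 * CA + 10 * k) * u * (c * w) = c * (8 * CA + 10 * k) * (u * w).
    by ring.
  have c1 : 0 <= c * (8 * CA + 10 * k) by rewrite mulr_ge0// addr_ge0// mulr_ge0.
  apply: (le_trans (ler_wpM2l c1 h)).
  rewrite !mulrA [leRHS]mulrAC ler_wpM2r//.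
  have h2 : c * (8 * CA + 10 * k) * 4 <= D.
    rewrite /D -mulrA ler_wpM2l// mulrC -addrA lerDl addr_ge0// mulr_ge0//.
  apply: (@le_trans _ _ (D * tail2 y)); first by rewrite ler_wpM2r.
  by rewrite ler_wpM2l// lerDr.
have [T1 T2] := tail_far ee x1 yx.
have x20 : 0 <= (`|x| ^+ 2)^-1 by rewrite invr_ge0 exprn_ge0.
have B : `|K eta (r ^+ 3) (x - y) + k / x ^+ 2| <= CK * poisson r (x - y) + k * (`|x| ^+ 2)^-1.
  rewrite (le_trans (ler_normD _ _))// lerD ?HK// normrM normfV normrX.
  by rewrite ger0_norm.
apply: (le_trans (ler_wpM2r _ B)); first by rewrite divr_ge0// ltW.
move: B => _; move: (poisson r (x - y)) P0 => P P0.
move: (_^-1) T1 T2 Wi0 => w T1 T2 w0.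
have -> : (CK * P + k * (`|x| ^+ 2)^-1) * (c * w) = c * CK * P * w + c * k * ((`|x| ^+ 2)^-1 * w).
  by move: (_^-1) => z; ring.
have c1 : 0 <= c * CK * P by rewrite !mulr_ge0.
have c2 : 0 <= c * k by rewrite !mulr_ge0.
apply: (le_trans (lerD (ler_wpM2l c1 T1) (ler_wpM2l c2 T2))).
rewrite !mulrA -mulrDl [leRHS]mulrAC ler_wpM2r//.
rewrite [leRHS]mulrDr; apply: lerD.
  rewrite mulrAC ler_wpM2r// /D -subr_ge0.
  rewrite (_ : _ - _ = c * (4 * (8 * CA + 10 * k) + 10 * k)); last by ring.
  by rewrite mulr_ge0// !addr_ge0 ?mulr_ge0// addr_ge0// mulr_ge0.
rewrite ler_wpM2r// /D -subr_ge0.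
rewrite (_ : _ - _ = c * (4 * (8 * CA + 10 * k) + 8 * CK)); last by ring.
by rewrite mulr_ge0// !addr_ge0 ?mulr_ge0// addr_ge0// mulr_ge0.
Qed.

End linear_asymptotics.

(** * The Duhamel integral *)

Section time_integral.
Context {R : realType}.
Notation mu := (@lebesgue_measure R).
Implicit Types (t tau sigma lam : R).

(** The exponent 5/6 leaves the room 1/6 between the singularity 2/3 of the
kernel and integrability; the a priori estimate spends it. *)
Definition singular_weight t tau : R := (t - tau) `^ (- (5 / 6)).

Lemma singular_weight_ge0 t tau : 0 <= singular_weight t tau. Proof. exact: powR_ge0. Qed.

Lemma measurable_singular_weight t : measurable_fun setT (singular_weight t).
Proof.
apply: (@measurableT_comp _ _ _ _ _ _ (fun x : R => x `^ (- (5 / 6)))).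
  exact: measurable_powR.
by apply: mfB; [exact: measurable_cst|exact: measurable_id].
Qed.

Lemma singular_weight_primitive t tau : tau < t ->
  is_derive tau 1 (fun tau => - (6 * (t - tau) `^ 6^-1)) (singular_weight t tau).
Proof.
move=> tt; have st : 0 < t - tau by rewrite subr_gt0.
have h1 := is_derive1_powR 6^-1 st.
have h2 : is_derive tau 1 (fun tau : R => t - tau) (- 1).
  have := is_deriveB (is_derive_cst t tau 1) (is_derive_id tau (1 : R)).
  by rewrite sub0r.
have h3 := @is_derive1_comp R (fun x => x `^ 6^-1) (fun tau => t - tau) tau _ _ h1 h2.
have h4 := @is_deriveN _ _ _ _ _ _ _ (@is_deriveZ _ _ _ _ 6 _ _ _ h3).
apply: (@is_derive_eq _ _ _ _ _ _ _ _ h4); rewrite /GRing.scale/= /singular_weight.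
have -> : - (5 / 6) = 6^-1 - 1 :> R by field.
by move: (_ `^ _) => z; field.
Qed.

(** Exhaust the open interval by the segments from 0 to t - t / (n + 1), on
which the primitive is smooth, and use monotone convergence. *)
Lemma singular_weight_integral t : 0 < t ->
  mu.-integrable `]0, t[ (EFin \o singular_weight t) /\
  \int[mu]_(tau in `]0, t[) singular_weight t tau <= 6 * t `^ 6^-1.
Proof.
move=> t0; pose E n : set R := `[0, t - t / n.+1%:R]%classic.
have En n tau : E n tau -> tau < t.
  rewrite /E/= in_itv/= => /andP[_ h]; apply: le_lt_trans h _.
  by rewrite ltrBlDr ltrDl divr_gt0.
have cF tau : tau < t -> {for tau, continuous (fun tau : R => - (6 * (t - tau) `^ 6^-1))}.
  by move=> /singular_weight_primitive [h _]; apply/differentiable_continuous/derivable1_diffP.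
have cs tau : tau < t -> {for tau, continuous (singular_weight t)}.
  move=> tt; have st : 0 < t - tau by rewrite subr_gt0.
  apply: (@continuous_comp _ _ _ (fun tau : R => t - tau) (fun x : R => x `^ (- (5 / 6)))).
    by apply: cvgB; [exact: cvg_cst|exact: cvg_id].
  by apply/differentiable_continuous/derivable1_diffP; have [] := is_derive1_powR (- (5 / 6)) st.
have ndE : {homo E : n m / (n <= m)%N >-> (n <= m)%O}.
  move=> n m nm; apply/subsetPset => x; rewrite /E/= !in_itv/= => /andP[-> h]/=.
  rewrite (le_trans h)// lerD2l lerN2 ler_wpM2l ?(ltW t0)//.
  by rewrite lef_pV2 ?posrE// ler_nat.
have mE n : measurable (E n) by exact: measurable_itv.
have ms n : measurable_fun (E n) (EFin \o singular_weight t).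
  by apply/measurable_EFinP; apply: measurable_funTS; exact: measurable_singular_weight.
have IE n : (\int[mu]_(x in E n) (singular_weight t x)%:E <= (6 * t `^ 6^-1)%:E)%E.
  have : 0 <= t - t / n.+1%:R.
    by rewrite subr_ge0 ler_pdivrMr// ler_peMr ?ler1n// ltW.
  rewrite le_eqVlt => /orP[/eqP h|h].
    by rewrite /E -h set_itv1 integral_set1 lee_fin mulr_ge0 ?powR_ge0.
  have hb : t - t / n.+1%:R < t by rewrite ltrBlDr ltrDl divr_gt0.
  rewrite (@continuous_FTC2 _ (singular_weight t) (fun tau => - (6 * (t - tau) `^ 6^-1)))//.
  - rewrite -EFinB lee_fin subr0 opprK gerDr oppr_le0 mulr_ge0//; exact: powR_ge0.
  - apply: continuous_in_subspaceT => x /set_mem; rewrite -/(E n) => /En; exact: cs.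
  - split.
    + by move=> x; rewrite in_itv/= => /andP[_ xb]; have [] := singular_weight_primitive (lt_trans xb hb).
    + by apply: cvg_at_right_filter; exact: cF.
    + by apply: cvg_at_left_filter; exact: cF.
  - move=> x; rewrite in_itv/= => /andP[_ xb]; rewrite derive1E.
    by have [_ ->] := singular_weight_primitive (lt_trans xb hb).
have UE : (`]0, t[%classic : set R) `<=` \bigcup_n E n.
  move=> x /=; rewrite in_itv/= => /andP[x0 xt].
  have tx : 0 < t - x by rewrite subr_gt0.
  exists (Num.truncn (t / (t - x))) => //; rewrite /E/= in_itv/= (ltW x0)/=.
  rewrite lerBrDr -lerBrDl ler_pdivrMr// mulrC -ler_pdivrMr//.
  by rewrite ltW// truncnS_gt.
have mU : measurable (\bigcup_n E n) by exact: bigcup_measurable.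
have mD : measurable (`]0, t[%classic : set R) by exact: measurable_itv.
have msU : measurable_fun (\bigcup_n E n) (EFin \o singular_weight t).
  by apply/measurable_EFinP; apply: measurable_funTS; exact: measurable_singular_weight.
have IU : (\int[mu]_(x in \bigcup_n E n) (singular_weight t x)%:E <= (6 * t `^ 6^-1)%:E)%E.
  have s0 n x : E n x -> (0 <= (EFin \o singular_weight t) x)%E by rewrite /= lee_fin singular_weight_ge0.
  have h := @ge0_nondecreasing_set_cvg_integral _ _ _ _ _ mu ndE mE ms s0.
  have <- := cvg_lim _ h; last by [].
  by apply: lime_le; [apply/cvg_ex; eexists; exact: h|exact: nearW].
have ID : (\int[mu]_(x in `]0%R, t[) (singular_weight t x)%:E <= (6 * t `^ 6^-1)%:E)%E.
  apply: le_trans IU; apply: ge0_subset_integral => //.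
  by move=> x _; rewrite /= lee_fin singular_weight_ge0.
have iD : mu.-integrable `]0, t[ (EFin \o singular_weight t).
  apply/integrableP; split.
    by apply/measurable_EFinP; apply: measurable_funTS; exact: measurable_singular_weight.
  under eq_integral do rewrite /= ger0_norm ?singular_weight_ge0//.
  by rewrite (le_lt_trans ID)// ltry.
split=> //.
have fD : (\int[mu]_(x in `]0%R, t[) (singular_weight t x)%:E)%E \is a fin_num.
  exact: (integrable_fin_num _ iD).
by rewrite -lee_fin /Rintegral fineK.
Qed.

(** An exponential factor in time makes the singular integral small: this is
how the a priori estimate closes on an arbitrarily long interval. *)
Lemma powR_damped lam sigma : 0 < lam -> 0 < sigma ->
  sigma `^ (- (2 / 3)) * expR (- (lam * sigma)) <= lam `^ (- 6^-1) * sigma `^ (- (5 / 6)).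
Proof.
move=> l0 s0; have z0 : 0 < lam * sigma by rewrite mulr_gt0.
have h : (lam * sigma) `^ 6^-1 <= expR (lam * sigma).
  apply: le_trans (expR_ge1Dx _); have [z1|z1] := leP 1 (lam * sigma).
    by rewrite (le_trans (ler1_powR z1 _))// ?lerDr// invf_le1// ler1n.
  apply: (@le_trans _ _ 1); last by rewrite lerDl ltW.
  have E1 : 1 `^ 6^-1 = 1 :> R by rewrite powR1.
  rewrite -[leRHS]E1;  apply: ge0_ler_powR (ltW z1); rewrite ?nnegrE//.
  exact: ltW.
have -> : sigma `^ (- (2 / 3)) = sigma `^ 6^-1 * sigma `^ (- (5 / 6)).
  by rewrite -powRD ?(gt_eqF s0) ?implybT//; congr powR; field.
rewrite mulrAC ler_wpM2r ?powR_ge0// powRN -[leRHS]mul1r ler_pdivlMr ?powR_gt0//.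
rewrite expRN mulrAC ler_pdivrMr ?expR_gt0// mul1r mulrC.
by rewrite -powRM ?(ltW l0) ?(ltW s0).
Qed.

Lemma powR_short t sigma : 0 < sigma <= t ->
  sigma `^ (- (2 / 3)) <= t `^ 6^-1 * sigma `^ (- (5 / 6)).
Proof.
move=> /andP[s0 st].
have -> : sigma `^ (- (2 / 3)) = sigma `^ 6^-1 * sigma `^ (- (5 / 6)).
  by rewrite -powRD ?(gt_eqF s0) ?implybT//; congr powR; field.
rewrite ler_wpM2r ?powR_ge0//; apply: ge0_ler_powR (st); rewrite ?nnegrE ?(ltW s0)//.
exact: le_trans (ltW s0) st.
Qed.

End time_integral.

Section duhamel.
Context {R : realType}.
Notation mu := (@lebesgue_measure R).
Variable eta : R.
Hypothesis eta_gt0 : 0 < eta.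

(** The regularity of the square of u that integration by parts requires. *)
Definition C1_bounded (v : R -> R) : Prop := exists N : R,
  [/\ forall y : R, is_derive y 1 v (derive1 v y), continuous (derive1 v),
    forall y, `|v y| <= N & forall y, `|derive1 v y| <= N].

(** Bound for the Duhamel integral when the source at time tau is at most
N(tau) times a spatial profile w that convolution with the derivative of the
kernel preserves. *)
Lemma duhamel_bound (b : R) : 0 < b -> exists2 C : R, 0 <= C &
  forall (t D H : R) (w N : R -> R) (v : R -> R -> R) x, 0 < t <= b -> 0 <= D -> 0 <= w x ->
    (forall tau, 0 < tau < t -> C1_bounded (v tau)) ->
    (forall tau, 0 < tau < t -> 0 <= N tau) ->
    (forall tau y, 0 < tau < t -> `|v tau y| <= N tau * w y) ->
    (forall y, tail3 (x - y) * w y <= D * w x * (tail2 (x - y) + tail2 y)) ->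
    (forall tau, 0 < tau < t -> N tau * (t - tau) `^ (- (2 / 3)) <= H * singular_weight t tau) ->
    `|\int[mu]_(tau in `]0, t[) convolution (K eta (t - tau)) (derive1 (v tau)) x|
      <= C * D * H * w x.
Proof.
move=> b0; pose r0 := b `^ 3^-1.
have r00 : 0 < r0 by rewrite powR_gt0.
have [C C0 HC] := nonlinear_bound eta_gt0 r00.
exists (C * (6 * b `^ 6^-1)) => [|t D H w N v x /andP[t0 tb] D0 w0 hv N0 hN hw hH].
  by rewrite !mulr_ge0// powR_ge0.
have [iS IS] := singular_weight_integral t0.
have H0 : 0 <= H.
  have h2 : 0 < t / 2 < t by rewrite divr_gt0//= ltr_pdivrMr// mulr_natr mulr2n ltrDl.
  have := hH _ h2; rewrite -ler_pdivrMr; last first.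
    by rewrite powR_gt0// subr_gt0; case/andP : h2.
  by apply: le_trans; rewrite divr_ge0 ?singular_weight_ge0// mulr_ge0 ?powR_ge0// N0.
apply: (@le_trans _ _ (\int[mu]_(tau in `]0, t[) (C * D * H * w x * singular_weight t tau))).
  apply: normr_Rintegral_dom => //; last first.
    by exact: (integrableZl _ (C * D * H * w x) iS).
  move=> tau; rewrite /= in_itv/= => tt; have s0 : 0 < t - tau by rewrite subr_gt0; case/andP : tt.
  pose r := (t - tau) `^ 3^-1.
  have r_gt0 : 0 < r by rewrite powR_gt0.
  have r3 : t - tau = r ^+ 3.
    by rewrite -powR_mulrn ?(ltW r_gt0)// -powRrM mulVf ?powRr1 ?(ltW s0).
  have rr : 0 < r <= r0.
    rewrite r_gt0; apply: ge0_ler_powR; rewrite ?nnegrE ?(ltW s0) ?(ltW b0)//.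
    by rewrite (le_trans _ tb)// gerDl oppr_le0 ltW//; case/andP : tt.
  have r2 : r ^- 2 = (t - tau) `^ (- (2 / 3)).
    by rewrite powRN -powR_mulrn ?(ltW r_gt0)// -powRrM; congr (_ `^ _)^-1; field.
  have [Nb [h1 h2 h3 h4]] := hv _ tt.
  rewrite r3 (integration_by_parts eta_gt0 x r_gt0 h1 h2 h3 h4).
  apply: (le_trans (HC D (N tau) r w (v tau) x rr (N0 _ tt) hw _)) => [y|]; first exact: hN.
  rewrite r2; have := ler_wpM2l (mulr_ge0 (mulr_ge0 C0 D0) w0) (hH _ tt).
  move=> h; apply: le_trans (le_trans h _); rewrite le_eqVlt; apply/orP; left; apply/eqP; ring.
rewrite RintegralZl//.
have k0 : 0 <= C * D * H * w x by rewrite !mulr_ge0.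
apply: (le_trans (ler_wpM2l k0 IS)).
have -> : C * (6 * b `^ 6^-1) * D * H * w x = C * D * H * w x * (6 * b `^ 6^-1) by ring.
rewrite ler_wpM2l// ler_wpM2l//; apply: ge0_ler_powR tb; rewrite ?nnegrE ?ltW//.
Qed.

Definition duhamel_eq (u : R -> R -> R) (t : R) : Prop := forall x,
  u t x = convolution (K eta t) (u 0) x - 2^-1 * \int[mu]_(tau in `]0, t[)
    convolution (K eta (t - tau)) (derive1 (fun y => u tau y ^+ 2)) x.

Lemma cube_root (t : R) : 0 < t -> exists2 r : R, 0 < r & t = r ^+ 3.
Proof.
move=> t0; exists (t `^ 3^-1); first by rewrite powR_gt0.
by rewrite -powR_mulrn ?powR_ge0// -powRrM mulVf ?powRr1 ?(ltW t0).
Qed.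

(** A priori estimate. Inserting a bound B e^(lam tau) (tail2 + delta) for one
factor of u^2 and a uniform bound A for the other, the Duhamel formula returns
the same bound with C + B / 2, provided that lam is large. The summand delta
makes the initial bound available, since u is only known to be bounded; the
constants do not depend on it. *)
Lemma decay_step (T A M : R) (u : R -> R -> R) : 0 < T -> 0 <= A -> 0 <= M ->
  (forall tau, 0 <= tau <= T -> C1_bounded (fun y => u tau y ^+ 2)) ->
  (forall tau x, 0 <= tau <= T -> `|u tau x| <= A) ->
  (forall x, `|u 0 x| <= M * tail2 x) ->
  (forall tau, 0 < tau <= T -> duhamel_eq u tau) ->
  exists C lam : R, [/\ 0 <= C, 0 <= lam & forall delta B, 0 < delta -> 0 <= B ->
    (forall tau x, 0 <= tau <= T -> `|u tau x| <= B * expR (lam * tau) * (tail2 x + delta)) ->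
    (forall tau x, 0 <= tau <= T ->
      `|u tau x| <= (C + B / 2) * expR (lam * tau) * (tail2 x + delta))].
Proof.
move=> T0 A0 M0 uC uA uM uD.
have [rT rT0 ET] := cube_root T0.
have [CL CL0 HL] := linear_decay eta_gt0 rT0 M0.
have [CN CN0 HN] := duhamel_bound T0.
(* Chosen so that lam^(-1/6) = 1/m, which turns the constant of the Duhamel
   bound into at most 1 in hm below; the remaining 1/2 is that of the equation. *)
pose m := 8 * CN * A + 1; pose lam := m ^+ 6.
have m0 : 0 < m by rewrite ltr_wpDl// !mulr_ge0.
have l0 : 0 < lam by rewrite exprn_gt0.
have lm : lam `^ (- 6^-1) = m^-1.
  by rewrite powRN /lam -powR_mulrn ?(ltW m0)// -powRrM mulfV// powRr1// (ltW m0).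
move: lam l0 lm => lam l0 lm.
exists (CL + M), lam; split; [by rewrite addr_ge0|exact: ltW|].
move=> delta B d0 B0 hB tau x /andP[tau0 tauT].
have w0 y : 0 < tail2 y + delta by rewrite ltr_wpDl// tail2_ge0.
have e1 : 1 <= expR (lam * tau) by rewrite -expR0 ler_expR mulr_ge0// ltW.
have e0 := expR_gt0 (lam * tau).
have lin (k : R) : 0 <= k -> k * tail2 x <= k * expR (lam * tau) * (tail2 x + delta).
  move=> k0; rewrite -mulrA ler_wpM2l//.
  apply: (@le_trans _ _ (1 * (tail2 x + delta))); first by rewrite mul1r lerDl ltW.
  by rewrite ler_wpM2r// ltW.
have [tau00|tau_gt0] := eqVneq tau 0.
  rewrite {1}tau00 (le_trans (uM x))// (le_trans (lin _ M0))// -!mulrA ler_wpM2r//.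
    by rewrite mulr_ge0 ?(ltW e0) ?(ltW (w0 x)).
  by rewrite addrAC lerDr addr_ge0// divr_ge0.
have {}tau0 : 0 < tau by rewrite lt_neqAle eq_sym tau_gt0.
rewrite (uD tau _ x); last by rewrite tau0.
have -> : (CL + M + B / 2) * expR (lam * tau) * (tail2 x + delta) =
    (CL * expR (lam * tau) * (tail2 x + delta) + M * expR (lam * tau) * (tail2 x + delta)) +
    B / 2 * expR (lam * tau) * (tail2 x + delta) by move: (expR _) (_ / 2) => a b; ring.
rewrite (le_trans (ler_normB _ _))//; apply: lerD.
  have [r r0 Er] := cube_root tau0.
  have rr : 0 < r <= rT.
    by rewrite r0 -(@ler_pXn2r _ 3%N) ?nnegrE ?(ltW r0) ?(ltW rT0)// -Er -ET.
  have := HL r (u 0) x rr uM; rewrite -Er => h; apply: (le_trans h).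
  by rewrite (le_trans (lin _ CL0))// lerDl mulr_ge0 ?(ltW (w0 x))// mulr_ge0// ltW.
rewrite normrM ger0_norm ?invr_ge0//.
pose N rho := A * (B * expR (lam * rho)).
pose H := A * B * expR (lam * tau) * m^-1.
have := HN tau 8 H (fun y => tail2 y + delta) N (fun rho y => u rho y ^+ 2) x.
rewrite tau0 tauT => /(_ isT _ (ltW (w0 x))) h.
have rhoT rho : 0 < rho < tau -> 0 <= rho <= T.
  by move=> /andP[r0 rt]; rewrite (ltW r0) (le_trans (ltW rt)).
have {}h : `|\int[mu]_(rho in `]0, tau[) convolution (K eta (tau - rho)) (derive1 (fun y => u rho y ^+ 2)) x|
   <= CN * 8 * H * (tail2 x + delta).
  apply: h => //.
  - by move=> rho /rhoT; exact: uC.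
  - by move=> rho _; rewrite /N !mulr_ge0// ltW// expR_gt0.
  - move=> rho y /rhoT rr; rewrite normrX expr2 /N -mulrA ler_pM ?uA//.
    exact: hB.
  - move=> y; have h1 := tail2_split x y.
    have h2 := tail3_le_tail2 (x - y); have h3 := tail2_ge0 y; have h4 := tail2_ge0 (x - y); have h5 := tail2_ge0 x.
    have h6 := tail3_ge0 (x - y).
    have k1 : 0 <= (2 * tail2 (x - y) - tail3 (x - y)) * tail2 y by rewrite mulr_ge0// subr_ge0.
    have k2 : 0 <= (2 * tail2 (x - y) - tail3 (x - y)) * delta by rewrite mulr_ge0 ?subr_ge0// ltW.
    have k3 : 0 <= delta * tail2 (x - y) by rewrite mulr_ge0// ltW.
    have k4 : 0 <= delta * tail2 y by rewrite mulr_ge0// ltW.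
    move: h1 k1 k2 k3 k4; clear; nra.
  - move=> rho /andP[r0 rt]; have s0 : 0 < tau - rho by rewrite subr_gt0.
    have := powR_damped l0 s0; rewrite lm.
    have ab0 : 0 <= A * B * expR (lam * tau) by rewrite !mulr_ge0// ltW.
    move=> /(ler_wpM2l ab0); rewrite /N /H /singular_weight.
    have -> : expR (lam * rho) = expR (lam * tau) * expR (- (lam * (tau - rho))).
      by rewrite -expRD; congr expR; ring.
    move=> h; apply: (le_trans (le_trans _ h)); rewrite le_eqVlt; apply/orP; left; apply/eqP.
      by ring.
    by rewrite !mulrA.
rewrite (le_trans (ler_wpM2l _ h))//.
have hm : CN * 8 * A * m^-1 <= 1.
  by rewrite ler_pdivrMr// mul1r /m [CN * 8]mulrC lerDl.
have k0 : 0 <= B / 2 * expR (lam * tau) * (tail2 x + delta) by rewrite !mulr_ge0// ltW.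
have -> : 2^-1 * (CN * 8 * H * (tail2 x + delta)) =
   (CN * 8 * A * m^-1) * (B / 2 * expR (lam * tau) * (tail2 x + delta)).
  by rewrite /H; move: (m^-1) => z; field.
have := ler_wpM2r k0 hm; rewrite mul1r => h1; apply: (le_trans h1).
by rewrite lexx.
Qed.

End duhamel.

(** * Spatial decay and regularity of the solution *)

Section decay.
Context {R : realType}.
Notation mu := (@lebesgue_measure R).
Variable eta : R.
Hypothesis eta_gt0 : 0 < eta.

(** Iterating the a priori estimate from B = A / delta gives 2 C in the limit,
and then delta tends to zero. *)
Lemma decay_propagates (T A M : R) (u : R -> R -> R) : 0 < T -> 0 <= A -> 0 <= M ->
  (forall tau, 0 <= tau <= T -> C1_bounded (fun y => u tau y ^+ 2)) ->
  (forall tau x, 0 <= tau <= T -> `|u tau x| <= A) ->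
  (forall x, `|u 0 x| <= M * tail2 x) ->
  (forall tau, 0 < tau <= T -> duhamel_eq eta u tau) ->
  exists2 N : R, 0 <= N & forall tau x, 0 <= tau <= T -> `|u tau x| <= N * tail2 x.
Proof.
move=> T0 A0 M0 uC uA uM uD.
have [C [lam [C0 l0 step]]] := decay_step eta_gt0 T0 A0 M0 uC uA uM uD.
have iter delta n : 0 < delta -> forall tau x, 0 <= tau <= T ->
    `|u tau x| <= (2 * C + A / delta / 2 ^+ n) * expR (lam * tau) * (tail2 x + delta).
  move=> d0; have Ad n' : 0 <= A / delta / 2 ^+ n' by rewrite !divr_ge0 ?exprn_ge0// ltW.
  elim: n => [tau x tt|n IH].
    rewrite (le_trans (uA _ x tt))// expr0 divr1.
    have e1 : 1 <= expR (lam * tau) by rewrite -expR0 ler_expR mulr_ge0//; case/andP : tt.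
    have Ad0 : 0 <= A / delta by rewrite divr_ge0// ltW.
    apply: (@le_trans _ _ (A / delta * 1 * delta)); first by rewrite mulr1 divfK ?gt_eqF.
    apply: ler_pM; [by rewrite mulr1|exact: ltW| |by rewrite lerDr tail2_ge0].
    by apply: ler_pM => //; rewrite lerDr mulr_ge0.
  have B0 : 0 <= 2 * C + A / delta / 2 ^+ n by rewrite addr_ge0// mulr_ge0.
  have := step delta _ d0 B0 IH.
  have -> : C + (2 * C + A / delta / 2 ^+ n) / 2 = 2 * C + A / delta / 2 ^+ n.+1.
    rewrite exprS; move: (A / delta) => z; field.
    by rewrite expf_neq0.
  by [].
exists (2 * C * expR (lam * T)) => [|tau x tt]; first by rewrite !mulr_ge0// ltW// expR_gt0.
have eT : expR (lam * tau) <= expR (lam * T).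
  by rewrite ler_expR ler_wpM2l//; case/andP : tt.
apply: (@le_trans _ _ (2 * C * expR (lam * tau) * tail2 x)); last first.
  by rewrite ler_wpM2r ?tail2_ge0// ler_wpM2l// mulr_ge0.
apply/ler_addgt0Pr => e e0.
have E0 := expR_gt0 (lam * tau).
(* delta below satisfies both delta <= 1 and delta * k <= e. *)
pose k := expR (lam * tau) * (2 * C + 2).
have k0 : 0 < k by rewrite mulr_gt0// ltr_wpDl// mulr_ge0.
pose delta := e / (k + e).
have ke : 0 < k + e by rewrite addr_gt0.
have d0 : 0 < delta by rewrite divr_gt0.
have d1 : delta <= 1 by rewrite ler_pdivrMr// mul1r lerDr ltW.
have dk : delta * k <= e.
  by rewrite mulrAC ler_pdivrMr// mulrDr lerDl mulr_ge0// ltW.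
pose n := (Num.truncn (A / delta / delta)).+1.
have An : A / delta / 2 ^+ n <= delta.
  rewrite ler_pdivrMr ?exprn_gt0// [leRHS]mulrC -ler_pdivrMr//.
  apply: (@le_trans _ _ n%:R); first by rewrite ltW// truncnS_gt.
  by rewrite -natrX ler_nat ltnW// ltn_expl.
apply: (le_trans (iter delta n d0 tau x tt)).
apply: (@le_trans _ _ ((2 * C + delta) * expR (lam * tau) * (tail2 x + delta))).
  rewrite ler_wpM2r ?addr_ge0 ?tail2_ge0 ?(ltW d0)// ler_wpM2r ?(ltW E0)//.
  by rewrite lerD2l.
have q1 := tail2_le1 x; have q0 := tail2_ge0 x.
move: dk d0 d1; rewrite /k; move: (delta) => d.
move: (expR _) E0 => E E0; clear -q0 q1 E0 C0 => dk d0 d1.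
have h1 : 0 <= E * d * (2 - tail2 x - d) by rewrite !mulr_ge0 ?(ltW E0) ?(ltW d0)//; lra.
move: h1 dk; nra.
Qed.

End decay.

Section regularity.
Context {R : realType}.
Notation mu := (@lebesgue_measure R).

Lemma Hs_norm_ge0 (s : R) (f : R -> R) : (0 <= Hs_norm s f)%E.
Proof. exact: Lnorm_ge0. Qed.

Lemma Hs_norm_fin (s : R) (f : R -> R) : (Hs_norm s f < +oo)%E ->
  exists2 N : R, 0 <= N & (Hs_norm s f <= N%:E)%E.
Proof.
move=> h; exists (fine (Hs_norm s f)); first by rewrite fine_ge0// Hs_norm_ge0.
by rewrite fineK// ge0_fin_numE// Hs_norm_ge0.
Qed.

Lemma Lfun2B (f g : R -> R) : f \in Lfun mu 2%:E -> g \in Lfun mu 2%:E ->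
  (f \- g) \in Lfun mu 2%:E.
Proof.
move=> /Lfun2P[mf f2] /Lfun2P[mg g2]; apply/Lfun2P; split; first exact: mfB.
apply: (L1_dom (g := fun x => 2 * f x ^+ 2 + 2 * g x ^+ 2)).
- by apply: measurable_funX; exact: mfB.
- move=> x; rewrite ger0_norm ?sqr_ge0//; have -> : (f \- g) x = f x - g x by [].
  by have := sqr_ge0 (f x + g x); nra.
- by apply: L1D; exact: L1Z.
Qed.

Lemma C1_bounded_sqr (s : R) (f : R -> R) : 3 / 2 < s -> Hs s f -> continuous f ->
  C1_bounded (fun y => f y ^+ 2).
Proof.
move=> s32 [Lf /Hs_norm_fin[N N0 hN]] cf.
have [df [cdf fdf]] := sobolev s32 N0 Lf cf hN.
set B := _ + _ => fB dfB.
have B0 : 0 <= B := le_trans (normr_ge0 _) (fB 0).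
have D (y : R) : is_derive y 1 (fun y => f y ^+ 2) (2 * f y * df y).
  have h := fdf y; apply: is_derive_eq.
  by rewrite /GRing.scale/=; ring.
have E : derive1 (fun y => f y ^+ 2) = (fun y => 2 * f y * df y).
  by apply/funext => y; rewrite derive1E; have [_ ->] := D y.
exists (2 * B * B); rewrite E; split => //.
- by move=> y; apply: cvgM; [apply: cvgM; [exact: cvg_cst|exact: cf]|exact: cdf].
- move=> y; rewrite normrX expr2; apply: ler_pM => //.
  by rewrite (le_trans (fB y))// ler_peMl// ler1n.
- move=> y; rewrite !normrM [`|2|]ger0_norm//; apply: ler_pM => //; last exact: ler_wpM2l.
Qed.

(** Each time has a neighbourhood in which u stays within Sobolev distance
one, hence within bounded uniform distance, of its value; the time interval is
compact. *)
Lemma uniform_bound (s T : R) (u : R -> R -> R) : 3 / 2 < s ->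
  continuous_path_Hs s u -> (forall t, 0 <= t -> continuous (u t)) ->
  exists2 A : R, 0 <= A & forall tau x, 0 <= tau <= T -> `|u tau x| <= A.
Proof.
move=> s32 hu cu.
have /compact_near_coveringP := @segment_compact R 0 T.
move=> /(_ R (pinfty_nbhs R) (fun A r => 0 <= r -> forall x, `|u r x| <= A)).
have : Filter (pinfty_nbhs R) by exact: _.
move=> FF /(_ FF).
have loc t : `[0, T]%classic t ->
    \forall r \near t & A \near +oo, 0 <= r -> forall x : R, `|u r x| <= A.
  rewrite /= in_itv/= => /andP[t0 _].
  have [[Lt /Hs_norm_fin[N N0 hN]] ut] := hu t t0.
  have [_ [_ _ bt _]] := sobolev s32 N0 Lt (cu t t0) hN.
  have ut0 : \forall r \near within `[0, +oo[ (nbhs t), (Hs_norm s (u r \- u t)%R <= 1%:E)%E.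
    by apply: (proj1 (ge0_cvge0P (fun r => Hs_norm_ge0 s (u r \- u t))) ut 1 ltr01).
  pose B := (sobolev_const s + N ^+ 2) + (sobolev_const s + 1 ^+ 2).
  exists ([set r | 0 <= r -> forall x, `|u r x| <= B], [set A | B <= A]).
    split => /=; last by apply: nbhs_pinfty_ge; rewrite num_real.
    move: ut0; rewrite near_withinE; apply: filterS => r h r0 x.
    have {}h : (Hs_norm s (u r \- u t)%R <= 1%:E)%E by apply: h; rewrite /= in_itv/= r0.
    have [[Lr _] _] := hu r r0.
    have crt : continuous (u r \- u t).
      by move=> y; apply: cvgB; [exact: cu|exact: cu].
    have [_ [_ _ brt _]] := sobolev s32 ler01 (Lfun2B Lr Lt) crt h.
    rewrite -[u r x](subrK (u t x)) addrC (le_trans (ler_normD _ _))// lerD//.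
    exact: brt.
  by move=> [r A]/= [hr hA] r0 x; exact: le_trans (hr r0 x) hA.
move=> /(_ loc) [M [Mr HM]]; exists (`|M| + 1) => [|tau x tt]; first by rewrite addr_ge0.
apply: HM; last by case/andP : tt.
- by rewrite (le_lt_trans (ler_norm _))// ltrDl.
- by rewrite /= in_itv/=.
Qed.

End regularity.

(** * Asymptotics of the solution *)

Section asymptotics.
Context {R : realType}.
Notation mu := (@lebesgue_measure R).

Lemma tail_weaken (e1 e2 c y : R) : 0 <= e1 <= e2 -> 0 <= c ->
  c / (1 + `|y| `^ (2 + e2)) <= 2 * c / (1 + `|y| `^ (2 + e1)).
Proof.
move=> /andP[e0 e12] c0; rewrite [2 * c]mulrC -mulrA ler_wpM2l//.
rewrite -[leLHS]mul1r ler_pdivrMr ?tail_ge0// mulrAC ler_pdivlMr ?tail_ge0// mul1r.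
have p1 := powR_ge0 `|y| (2 + e1); have p2 := powR_ge0 `|y| (2 + e2).
have [y1|y1] := leP 1 `|y|.
  have : `|y| `^ (2 + e1) <= `|y| `^ (2 + e2) by rewrite ler_powR// lerD2l.
  lra.
have : `|y| `^ (2 + e1) <= 1.
  have E : 1 `^ (2 + e1) = 1 :> R by rewrite powR1.
  rewrite -[leRHS]E; apply: ge0_ler_powR (ltW y1); rewrite ?nnegrE// addr_ge0//.
lra.
Qed.

Lemma global_solution_bounded (eta s t : R) (u0 : R -> R) (u : R -> R -> R) :
  3 / 2 < s -> global_solution eta s u0 u -> exists2 A : R, 0 <= A &
    forall tau x, 0 <= tau <= t -> `|u tau x| <= A.
Proof. by move=> s32 [hu cu _ _]; exact: uniform_bound s32 hu cu. Qed.

(** Sum of the asymptotics of the free evolution and of a nonlinear term that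
is O(|x|^-3): the solution decays like tail2 on [0, t], so its square is at
most a multiple of tail3. *)
Lemma solution_asymptotics (eta s t e c : R) (u0 : R -> R) (u : R -> R -> R) :
  0 < eta -> 3 / 2 < s -> 0 < t -> 0 < e <= 1 -> 0 <= c ->
  (forall y, `|u0 y| <= c / (1 + `|y| `^ (2 + e))) -> global_solution eta s u0 u ->
  exists2 C : R, 0 <= C & forall x, 1 <= `|x| ->
    `|u t x + eta * t / (pi * x ^+ 2) * \int[mu]_y u0 y| <= C / `|x| `^ (2 + e).
Proof.
move=> eta0 s32 t0 ee c0 hu0 gs.
have [A A0 uA] := global_solution_bounded t s32 gs.
have [hu cu u00 ud] := gs.
have cu0 : continuous u0 by rewrite -u00; exact: cu.
have e0 : 0 <= e by case/andP : ee => /ltW.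
have uC tau : 0 <= tau <= t -> C1_bounded (fun y => u tau y ^+ 2).
  by move=> /andP[tau0 _]; apply: C1_bounded_sqr s32 (hu _ tau0).1 (cu _ tau0).
have c20 : 0 <= 2 * c by rewrite mulr_ge0.
have uM x : `|u 0 x| <= 2 * c * tail2 x.
  by rewrite u00 (le_trans (hu0 x))// mulrAC mulrC ler_wpM2r// tail_le_tail2.
have uD tau : 0 < tau <= t -> duhamel_eq eta u tau.
  by move=> /andP[tau0 _] x; rewrite u00 ud.
have [N N0 uN] := decay_propagates eta0 t0 A0 c20 uC uA uM uD.
have [r r0 Er] := cube_root t0.
have [CL CL0 HL] := linear_asymptotics eta0 r0 ee c0 cu0 hu0.
have [CN CN0 HN] := duhamel_bound eta0 t0.
pose H := N ^+ 2 * t `^ 6^-1.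
have H0 : 0 <= H by rewrite mulr_ge0 ?powR_ge0// sqr_ge0.
have CH0 : 0 <= CN * 16 * H := mulr_ge0 (mulr_ge0 CN0 (ler0n _ 16)) H0.
exists (CL + CN * 16 * H) => [|x x1]; first by rewrite addr_ge0.
have x0 : 0 < `|x| := lt_le_trans ltr01 x1.
have X0 : 0 < `|x| `^ (2 + e) by rewrite powR_gt0.
rewrite ud// addrAC (le_trans (ler_normB _ _))// [leRHS]mulrDl; apply: lerD.
  by have := HL x x1; rewrite -Er.
rewrite normrM ger0_norm ?invr_ge0//.
have ttT tau : 0 < tau < t -> 0 <= tau <= t by move=> /andP[/ltW-> /ltW->].
have h : `|\int[mu]_(tau in `]0, t[) convolution (K eta (t - tau)) (derive1 (fun y => u tau y ^+ 2)) x|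
    <= CN * 16 * H * tail3 x.
  apply: (HN t 16 H tail3 (fun=> N ^+ 2) (fun tau y => u tau y ^+ 2) x).
  - by rewrite t0 lexx.
  - by [].
  - exact: tail3_ge0.
  - by move=> tau /ttT; exact: uC.
  - by move=> tau _; exact: sqr_ge0.
  - move=> tau y /ttT tt; rewrite normrX.
    apply: (@le_trans _ _ ((N * tail2 y) ^+ 2)).
      by rewrite lerXn2r ?nnegrE ?mulr_ge0 ?tail2_ge0 ?uN.
    by rewrite exprMn ler_wpM2l ?sqr_ge0// sqr_tail2_le_tail3.
  - move=> y; apply: (le_trans (tail3_split x y)).
    have := tail3_le_tail2 (x - y); have := tail3_le_tail2 y; have := tail3_ge0 x.
    move: (tail3 x) (tail3 (x - y)) (tail3 y) (tail2 (x - y)) (tail2 y) => a b d f g a0 h1 h2.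
    have h3 : 0 <= a * (2 * (f + g) - (b + d)) by rewrite mulr_ge0//; lra.
    by move: h3; lra.
  - move=> tau /andP[tau0 taut]; rewrite /H -mulrA ler_wpM2l ?sqr_ge0// powR_short//.
    by rewrite subr_gt0 taut gerDl oppr_le0 ltW.
have q3x : tail3 x <= (`|x| `^ (2 + e))^-1.
  rewrite lef_pV2 ?posrE ?tail3_den//.
  apply: (@le_trans _ _ (`|x| `^ 3%:R)); last by rewrite powR_mulrn// lerDr.
  by rewrite ler_powR//; case/andP : ee; lra.
apply: (@le_trans _ _ (1 * (CN * 16 * H * tail3 x))).
  by apply: ler_pM => //; rewrite invf_le1// ler1n.
by rewrite mul1r ler_wpM2l.
Qed.

End asymptotics.

Theorem theorem3 (R : realType) (eta : R) (eta_gt0 : 0 < eta) :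
  exists c_eta : R, 0 < c_eta /\
  forall t : R, 0 < t ->
  exists c_eta_t : R, (0 < c_eta_t < c_eta * expR (4 * eta * t)) /\
  forall (s : R) (u0 : R -> R) (eps c : R) (u : R -> R -> R),
    3 / 2 < s -> s <= 2 ->
    Hs s u0 ->
    0 < eps -> 0 < c ->
    (forall x : R, `|u0 x| <= c / (1 + `|x| `^ (2 + eps))) ->
    (forall x : R, derivable u0 x 1 /\ `|derive1 u0 x| <= c / (1 + `|x| ^+ 2)) ->
    global_solution eta s u0 u ->
    (\int[@lebesgue_measure R]_y u0 y != 0 ->
       exists M : R, 0 < M /\
       forall x : R, M < `|x| ->
         c_eta_t * t / (2 * `|x| ^+ 2) * `|\int[@lebesgue_measure R]_y u0 y|
           <= `|u t x|) /\
    (\int[@lebesgue_measure R]_y u0 y = 0 -> eps <= 1 ->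
       exists C' : R, 0 < C' /\
       forall x : R, `|u t x| <= C' / (1 + `|x| `^ (2 + eps))).
Proof.
have pi_pos : 0 < pi :> R by exact: pi_gt0.
have pi1 : 1 < pi :> R by have := @pi_ge2 R; lra.
exists eta; split=> // t t0; exists (eta / pi); split.
  rewrite divr_gt0//= (@lt_le_trans _ _ eta)//.
    by rewrite ltr_pdivrMr// ltr_pMr.
  by rewrite ler_peMr ?(ltW eta_gt0)// -expR0 ler_expR !mulr_ge0// ltW.
move=> s u0 eps c u s32 _ _ eps0 /ltW c0 hu0 _ gs; split.
  set I0 := Rintegral _ _ _ => I0_neq0.
  pose e := Num.min eps 1.
  have e01 : 0 < e <= 1 by rewrite /e lt_min eps0 ltr01 ge_min lexx orbT.
  have hu0' y : `|u0 y| <= 2 * c / (1 + `|y| `^ (2 + e)).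
    apply: (le_trans (hu0 y)); apply: tail_weaken => //.
    by case/andP : e01 => /ltW -> _; rewrite /e ge_min lexx.
  have c20 : 0 <= 2 * c by rewrite mulr_ge0.
  have [C C0 HC] := solution_asymptotics eta_gt0 s32 t0 e01 c20 hu0' gs.
  have e_gt0 : 0 < e by case/andP : e01.
  have I_gt0 : 0 < `|I0| by rewrite normr_gt0.
  pose k := eta / pi * t / 2 * `|I0|.
  have k0 : 0 < k by rewrite !mulr_gt0 ?invr_gt0.
  (* Beyond M the error is at most k / |x|^2, half of the main term. *)
  pose M := Num.max 1 ((C / k) `^ e^-1).
  have M1 : 1 <= M by rewrite le_max lexx.
  exists M; split; first exact: lt_le_trans ltr01 M1.
  move=> x Mx; have x1 : 1 <= `|x| := le_trans M1 (ltW Mx).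
  have x0 : 0 < `|x| := lt_le_trans ltr01 x1.
  have kx : C / `|x| `^ (2 + e) <= k / `|x| ^+ 2.
    rewrite powR2D// invfM mulrC -mulrA mulrC ler_wpM2r ?invr_ge0 ?exprn_ge0//.
    rewrite mulrC ler_pdivrMr ?powR_gt0// mulrC -ler_pdivrMr//.
    have : (C / k) `^ e^-1 <= `|x| by rewrite (le_trans _ (ltW Mx))// le_max lexx orbT.
    have Ck0 : 0 <= C / k by rewrite divr_ge0// ltW.
    move=> h; have := @ge0_ler_powR _ e (ltW e_gt0) _ _ _ _ h.
    rewrite !nnegrE powR_ge0 normr_ge0 => /(_ isT isT).
    by rewrite -powRrM mulVf ?gt_eqF// powRr1.
  have := le_trans (HC x x1) kx; rewrite -/I0 => h.
  have E : `|eta * t / (pi * x ^+ 2) * I0| = 2 * (k / `|x| ^+ 2).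
    rewrite normrM (ger0_norm (_ : 0 <= eta * t / (pi * x ^+ 2))); last first.
      exact: divr_ge0 (mulr_ge0 (ltW eta_gt0) (ltW t0)) (mulr_ge0 (ltW pi_pos) (sqr_ge0 x)).
    rewrite /k -(real_normK (num_real x)).
    by move: pi pi_pos {k k0 kx pi1 h M M1 Mx} => p p0; field; rewrite !gt_eqF.
  have -> : eta / pi * t / (2 * `|x| ^+ 2) * `|I0| = k / `|x| ^+ 2.
    by rewrite /k; move: pi pi_pos {k k0 kx pi1 h M M1 Mx E} => p p0; field; rewrite !gt_eqF.
  have h2 : `|eta * t / (pi * x ^+ 2) * I0| <= `|u t x + eta * t / (pi * x ^+ 2) * I0| + `|u t x|.
    by rewrite -{1}(addKr (u t x) (eta * _ / _ * _)) addrC (le_trans (ler_normB _ _)).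
  rewrite E in h2; move: h h2; move: (k / _) `|_ + _| `|u t x| => a b d; lra.
move=> I00 eps1.
have e01 : 0 < eps <= 1 by rewrite eps0.
have [C C0 HC] := solution_asymptotics eta_gt0 s32 t0 e01 c0 hu0 gs.
have [A A0 HA] := global_solution_bounded t s32 gs.
have uA x : `|u t x| <= A by apply: HA; rewrite (ltW t0) lexx.
exists (2 * C + 2 * A + 1); split; first by rewrite ltr_wpDl// addr_ge0// mulr_ge0.
move=> x; have W0 := tail_ge0 x eps; rewrite ler_pdivlMr//.
have p0 := powR_ge0 `|x| (2 + eps).
have [x1|x1] := leP 1 `|x|.
  have p1 : 1 <= `|x| `^ (2 + eps).
    by rewrite -[leLHS](powRr0 `|x|) ler_powR// addr_ge0// ltW.
  have := HC x x1; rewrite I00 mulr0 addr0 ler_pdivlMr ?(lt_le_trans ltr01)//.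
  have := normr_ge0 (u t x).
  by move: `|u t x| (_ `^ _) p1 => a p p1 a0 h; nra.
have p1 : `|x| `^ (2 + eps) <= 1.
  have E : 1 `^ (2 + eps) = 1 :> R by rewrite powR1.
  by rewrite -[leRHS]E; apply: ge0_ler_powR (ltW x1); rewrite ?nnegrE// addr_ge0// ltW.
apply: (@le_trans _ _ (A * 2)); first by apply: ler_pM => //; lra.
by move: C0; lra.
Qed.
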